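(* Let $d$ be a metric on $\langle\mathbb{F}_0\rangle$ such that $d$-balls in $\langle\mathbb{F}_0\rangle$ are convex sets and such that $\mathbb{F}_0$ is compact with respect to $d$. Suppose that: (1) for every $\epsilon>0$, $\Pi\left(f: K^\star(f_0,f)<\epsilon\right)>0$; (2) for every $\epsilon>0$ there is $\delta>0$ such that $\{f\in\langle\mathbb{F}_0\rangle: K^\star(f_0,f)<\delta\}\subseteq\{f\in\langle\mathbb{F}_0\rangle: d(f,f^\star)<\epsilon\}$. Then for every $\epsilon>0$, with $U=\{f\in\langle\mathbb{F}_0\rangle: d(f,f^\star)<\epsilon\}$, $$\Pi(U^c\mid Y_{1:n})\to0\quad\text{as }n\to\infty,\qquad\mathsf{P}_0\text{-almost surely}.$$
   Context: Let $(\mathbb{Y},\mathscr{Y})$ be a measurable space with a $\sigma$-finite measure $\mu$, $\mathbb{F}_0$ a family of probability densities with respect to $\mu$, and $f_0$ a ''true'' probability density with respect to $\mu$, not necessarily in $\mathbb{F}_0$. $Y_1,Y_2,\dots$ are i.i.d. with density $f_0$, $Y_{1:n}=(Y_1,\dots,Y_n)$; $\mathsf{P}_0,\mathsf{E}_0$ denote probability and expectation under $f_0$ (and under its products). $\Pi$ is a probability measure (prior) on $\mathbb{F}_0$; all sets and functions are understood to be suitably measurable. $K(f_0,f)=\mathsf{E}_0\log(f_0/f)=\int\log(f_0/f)\,f_0\,d\mu$. There is a fixed unique $f^\star\in\mathbb{F}_0$ with $K(f_0,f^\star)=\inf_{f\in\mathbb{F}_0}K(f_0,f)$ (understood to be finite),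 and for any density $f$, $K^\star(f_0,f)=K(f_0,f)-K(f_0,f^\star)$. A set $A$ of densities is called convex if it is closed under mixtures: for every probability measure $\nu$ on $A$, the density $\int_A f\,\nu(df)$ belongs to $A$. $\langle\mathbb{F}_0\rangle$ is the smallest convex set (in this sense) containing $\mathbb{F}_0$, and $\Pi$ is extended to $\langle\mathbb{F}_0\rangle$ by $\Pi(A)=\Pi(A\cap\mathbb{F}_0)$. Standing assumptions: $\int(f/f^\star)f_0\,d\mu<\infty$ for all $f\in\mathbb{F}_0$, and $\int(f_0/f^\star)\,d\mu<\infty$. The posterior is $$\Pi(A\mid Y_{1:n})=\frac{\int_A\prod_{i=1}^n \frac{f(Y_i)}{f^\star(Y_i)}\,d\Pi(f)}{\int\prod_{i=1}^n \frac{f(Y_i)}{f^\star(Y_i)}\,d\Pi(f)}.$$ *)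

(* Defs.v *)
From HB Require Import structures.
From mathcomp Require Import all_boot all_order all_algebra.
From mathcomp Require Import finmap.
From mathcomp Require Import all_classical all_reals all_analysis.

Set Implicit Arguments.
Unset Strict Implicit.
Unset Printing Implicit Defensive.
Import Order.TTheory GRing.Theory Num.Theory.
Import numFieldNormedType.Exports.

Local Open Scope classical_set_scope.
Local Open Scope ring_scope.

(* Conventions.  Densities with respect to mu are identified when they are
   equal mu-almost everywhere.  They are represented by the points of a
   measurable type T through an evaluation map [dens : T -> S -> R]; the sigma
   algebra of T is the one for which priors and mixing measures on sets of
   densities are defined.  Evaluation has to be jointly measurable: this is what
   makes likelihoods and pointwise mixtures meaningful. *)

Section densities.
Context {dS : measure_display} {S : measurableType dS} {R : realType}.
Variable mu : {measure set S -> \bar R}.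

Definition is_density (f : S -> R) : Prop :=
  [/\ measurable_fun setT f, forall y, 0 <= f y
    & (\int[mu]_y (f y)%:E = 1)%E].

(* K(f0, f) as an extended real.  In [\bar R], a / 0 = +oo for a > 0,
   lne +oo = +oo and 0 * x = 0, so the integrand is 0 where f0 vanishes and +oo
   where f vanishes but f0 does not. *)
Definition KL (f0 f : S -> R) : \bar R :=
  (\int[mu]_y ((f0 y)%:E * lne ((f0 y)%:E / (f y)%:E)))%E.

(* K*(f0, f); only meaningful when KL f0 fstar is finite. *)
Definition KLstar (f0 fstar f : S -> R) : \bar R :=
  (KL f0 f - KL f0 fstar)%E.

Context {dT : measure_display} {T : measurableType dT}.
Variable dens : T -> S -> R.

(* The mixing integral is extended-real valued, and may be infinite on a
   mu-null set. *)
Definition is_mixture (nu : probability T R) (t : T) : Prop :=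
  {ae mu, forall y, (dens t y)%:E = (\int[nu]_s (dens s y)%:E)%E}.

(* Points of T are densities modulo mu, without repetition, and T contains all
   mixtures of its points.  When the sigma algebra of S is countably generated, T
   can be the space of all densities.  In general a jointly measurable evaluation
   only sees a countably generated sub-sigma-algebra of S, and T can be the
   space of all densities measurable for such a sub-sigma-algebra. *)
Record density_space : Prop := DensitySpace {
  ds_density : forall t, is_density (dens t) ;
  ds_measurable : measurable_fun [set: T * S] (fun ty => dens ty.1 ty.2) ;
  ds_inj : forall s t, {ae mu, forall y, dens s y = dens t y} -> s = t ;
  ds_mixture : forall nu : probability T R, exists t, is_mixture nu t }.

(* nu is a probability measure on A; for measurable A this is nu A = 1. *)
Definition carried_by (nu : probability T R) (A : set T) : Prop :=
  exists B, [/\ measurable B, B `<=` A & nu B = 1%E].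

Definition mixture_convex (A : set T) : Prop :=
  forall nu : probability T R, carried_by nu A ->
    exists2 t, A t & is_mixture nu t.

Definition mixture_hull (F : set T) : set T :=
  \bigcap_(A in [set A | mixture_convex A /\ F `<=` A]) A.

Lemma sub_mixture_hull (F : set T) : F `<=` mixture_hull F.
Proof. by move=> t Ft A [_]; apply. Qed.

Lemma mixture_hull_convex (F : set T) :
  density_space -> mixture_convex (mixture_hull F).
Proof.
move=> dsT nu [B [mB BF nuB]]; have [t nut] := ds_mixture dsT nu.
exists t => // A [cA FA].
have [|s As nus] := cA nu; first by exists B; split=> // x /BF; apply.
suff -> : t = s by [].
apply: (ds_inj dsT); near=> y.
have ty : (dens t y)%:E = (\int[nu]_s (dens s y)%:E)%E by near: y.
have sy : (dens s y)%:E = (\int[nu]_s (dens s y)%:E)%E by near: y.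
by apply: EFin_inj; rewrite ty sy.
Unshelve. all: by end_near. Qed.

(* fstar is the unique minimizer of K(f0, .) over F, with finite minimum. *)
Definition unique_KL_minimizer (f0 : S -> R) (F : set T) (fstar : T) : Prop :=
  [/\ F fstar,
      KL f0 (dens fstar) = ereal_inf [set KL f0 (dens f) | f in F],
      KL f0 (dens fstar) \is a fin_num
    & forall f, F f -> KL f0 (dens f) = KL f0 (dens fstar) -> f = fstar].

Definition likelihood_ratio (fstar : T) (y : nat -> S) (n : nat) (f : T) : R :=
  \prod_(i < n) (dens f (y i) / dens fstar (y i)).

(* Posterior mass of A given y 0, ..., y n.-1, for a prior Pi on F, extended to
   all sets of densities by Pi(A) = Pi(A `&` F).  When KL f0 (dens fstar) is
   finite, dens fstar vanishes on a null set of the law f0 only, so that the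
   convention x / 0 = 0 in likelihood ratios does not matter. *)
Definition posterior (F : set T) (Pi : probability T R) (fstar : T)
    (y : nat -> S) (n : nat) (A : set T) : \bar R :=
  ((\int[Pi]_(f in A `&` F) (likelihood_ratio fstar y n f)%:E) /
   (\int[Pi]_(f in F) (likelihood_ratio fstar y n f)%:E))%E.

End densities.

Section iid.
Context {dS : measure_display} {S : measurableType dS} {R : realType}.
Context {dO : measure_display} {Omega : measurableType dO}.

Record iid_with_density (mu : {measure set S -> \bar R})
    (P : probability Omega R) (f0 : S -> R) (Y : nat -> Omega -> S) : Prop :=
  IidWithDensity {
  iid_measurable : forall i, measurable_fun setT (Y i) ;
  iid_law : forall i (B : set S), measurable B ->
    P (Y i @^-1` B) = (\int[mu]_(y in B) (f0 y)%:E)%E ;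
  iid_indep : forall (J : {fset nat}) (B : nat -> set S),
    (forall i, measurable (B i)) ->
    P (\bigcap_(i in [set` J]) (Y i @^-1` B i)) =
      (\prod_(i <- J) P (Y i @^-1` B i))%E }.

End iid.

Section metric.
Context {R : realType} {T : choiceType}.

Record metric_on (A : set T) := MetricOn {
  dist :> T -> T -> R ;
  dist_xx : forall x, A x -> dist x x = 0 ;
  dist_eq0 : forall x y, A x -> A y -> dist x y = 0 -> x = y ;
  dist_sym : forall x y, A x -> A y -> dist x y = dist y x ;
  dist_triangle : forall y x z, A x -> A y -> A z ->
    dist x z <= dist x y + dist y z }.

Definition dball (A : set T) (d : metric_on A) (c : T) (r : R) : set T :=
  [set f | A f /\ d f c < r].

(* The set A as a type, carrying the metric topology of d. *)
Definition metric_space (A : set T) (d : metric_on A) : Type := set_type A.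

Section instances.
Variables (A : set T) (d : metric_on A).

HB.instance Definition _ := Choice.copy (metric_space d) (set_type A).

Let memA (x : metric_space d) : A (\val x).
Proof. exact: set_mem (valP x). Qed.

HB.instance Definition _ := isMetric.Build R (metric_space d)
  (fun x => dist_xx d (memA x))
  (fun x y xy => val_inj (dist_eq0 (memA x) (memA y) xy))
  (fun x y => dist_sym d (memA x) (memA y))
  (fun y x z => dist_triangle d (memA x) (memA y) (memA z)).

End instances.

Definition metric_compact (A : set T) (d : metric_on A) (F : set T) : Prop :=
  F `<=` A /\ compact [set x : metric_space d | F (\val x)].

End metric.

(* Main.v *)
(* Take likelihood ratios relative to f0 instead of f*; this does not change the
   posterior.

   Numerator: let A be convex with K(f0, f) >= k' on A, and let k < k'.  Then
   there is one exponent a > 0 with E_0 (e^k f / f0)^a <= 1 for all f in A.  By a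
   second order expansion at a = 0 this holds if E_0 ln (e^k f / f0 + c) is at
   most (k - k') / 2 on A for some c > 0.  If not, there are f_j in A with
   E_0 ln (e^k f_j / f0 + 1/j) > (k - k') / 2, and by a convexity argument they
   can be taken such that f_j / f0 converges f0-almost surely; a countable mixture
   of a subsequence, which again lies in A, then has divergence less than k', a
   contradiction.  Given Y_1, ..., Y_n, the
   predictive density of the prior restricted to a measurable part B of A is a
   mixture of elements of A, so that
   E_0 (e^(kn) int_B prod_(i <= n) f / f0 (Y_i) dPi)^a <= 1 by induction on n,
   and the integral over B is O(e^(-k''n)) for every k'' < k by Borel-Cantelli.

   Denominator: for K(f0, f) < c the law of large numbers gives
   prod_(i <= n) f / f0 (Y_i) >= e^(-cn) eventually, and by Fubini this holds
   from one index on for a set of f of positive prior mass.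

   By compactness finitely many small balls with centers in F0 cover F0; those
   that meet the complement of U stay away from f*, hence K* is bounded below
   there by hypothesis (2), and the exponential rates can be compared. *)

Require Import Defs.
From HB Require Import structures.
From mathcomp Require Import all_boot all_order all_algebra.
From mathcomp Require Import finmap.
From mathcomp Require Import all_classical all_reals all_analysis.
From mathcomp Require Import measurable_realfun.
From mathcomp Require Import ring lra.
Import Order.TTheory GRing.Theory Num.Theory.
Import numFieldNormedType.Exports.
Local Open Scope classical_set_scope.
Local Open Scope ring_scope.

Set Implicit Arguments.
Unset Strict Implicit.
Unset Printing Implicit Defensive.

(** The exponent [a] must serve all of [A] at once, because the element of [A] that predicts the
    next observation depends on the past. The obstacle to a common [a] is the logarithm near 0; the
    shift by [c] bounds it from below and moves the difficulty to letting [c] tend to 0. Strict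
    convexity stands in for compactness there: near minimizers of [E_0 exp (- V)], over the nested
    convex sets where [E_0 ln (V + c)] stays large, are Cauchy in L2, and [exp (- V)] is bounded
    whatever [V] is. Their limit need not come from an element of [A]. A mixture with geometric
    weights comes close enough: its logarithm loses at most a constant for each initial index at
    which the component is still far below the limit, and along a fast subsequence the expected
    number of such indices is small.

    Log likelihood ratios are only known to have a first moment. The denominator needs just one side
    of the law of large numbers, which is proved for nonnegative functions by exponential moments,
    on dyadic blocks when the function is unbounded. *)

Section density.
Local Open Scope ereal_scope.
Context {d} {X : measurableType d} {R : realType}.
Variables (mu : {measure set X -> \bar R}) (h : X -> R).
Hypotheses (mh : measurable_fun setT h) (h0 : forall x, (0 <= h x)%R).

Let mEh (D : set X) : measurable_fun D (fun x => (h x)%:E).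
Proof. by apply/measurable_EFinP; exact: measurable_funTS. Qed.

Definition density_measure (A : set X) : \bar R := \int[mu]_(x in A) (h x)%:E.

Let density0 : density_measure set0 = 0.
Proof. exact: integral_set0. Qed.

Let density_ge0 A : 0 <= density_measure A.
Proof. by apply: integral_ge0 => x _; rewrite lee_fin. Qed.

Let density_sigma_additive : semi_sigma_additive density_measure.
Proof.
move=> F mF tF mUF; rewrite /density_measure ge0_integral_bigcup//.
- by apply: is_cvg_nneseries => n _ _; exact: density_ge0.
- by move=> x _; rewrite lee_fin.
Qed.

HB.instance Definition _ := isMeasure.Build _ _ _ density_measure
  density0 density_ge0 density_sigma_additive.

Lemma density_measureP :
  exists m : {measure set X -> \bar R}, forall A, m A = density_measure A.
Proof. by exists density_measure. Qed.

Import HBNNSimple.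

(** Both sides agree on simple functions, and monotone convergence passes to [g]. The lemma serves
    twice: for the law with density [f0] with respect to [mu], and for a prior reweighted by a
    normalized likelihood. *)
Lemma ge0_integral_density (nu : {measure set X -> \bar R}) (g : X -> \bar R) :
  (forall A, measurable A -> nu A = density_measure A) ->
  measurable_fun setT g -> (forall x, 0 <= g x) ->
  \int[nu]_x g x = \int[mu]_x (g x * (h x)%:E).
Proof.
move=> nuE mg g0; pose a := nnsfun_approx measurableT mg.
have ha n : \int[nu]_x (a n x)%:E = \int[mu]_x ((a n x)%:E * (h x)%:E).
  have aE x : (a n x)%:E =
      \sum_(y \in range (a n)) (y * \1_(a n @^-1` [set y]) x)%:E.
    by rewrite [in LHS](fimfunE (a n) x) fsumEFin.
  have y1_ge0 y x : 0 <= (y * \1_(a n @^-1` [set y]) x)%:E.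
    exact: nnfun_muleindic_ge0.
  have my1 y : measurable_fun setT (fun x => (y * \1_(a n @^-1` [set y]) x)%:E).
    by apply/measurable_EFinP; exact: measurable_funM.
  under eq_integral do rewrite aE.
  rewrite ge0_integral_fsum//.
  under [RHS]eq_integral do rewrite aE ge0_mule_fsuml//.
  rewrite ge0_integral_fsum//; last 2 first.
    by move=> y; apply: emeasurable_funM.
    by move=> y x _; rewrite mule_ge0// lee_fin.
  apply: eq_fsbigr => y /[1!inE] -[x _ yE].
  have y0 : (0 <= y)%R by rewrite -yE.
  under eq_integral do rewrite EFinM.
  under [RHS]eq_integral do rewrite EFinM -muleA.
  have m1 : measurable_fun setT (fun x => (\1_(a n @^-1` [set y]) x : R)%:E).
    by apply/measurable_EFinP; exact: measurable_indic.
  rewrite ge0_integralZl_EFin// ge0_integralZl_EFin//; last 2 first.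
    by move=> z _; rewrite mule_ge0// lee_fin.
    by apply: emeasurable_funM.
  congr (_ * _); rewrite integral_indic// setIT nuE//.
  rewrite /density_measure integral_mkcond; apply: eq_integral => z _.
  rewrite /= patchE; case: ifPn => zy; first by rewrite indicE zy mul1e.
  by rewrite indicE (negbTE zy) mul0e.
have nda x : {homo (fun n => (a n x)%:E) : m n / (m <= n)%N >-> m <= n}.
  by move=> m n mn; rewrite lee_fin; exact/lefP/nd_nnsfun_approx.
have ma n : measurable_fun setT (fun x => (a n x)%:E).
  by apply/measurable_EFinP; exact: measurable_funP.
have cva x : (a n x)%:E @[n --> \oo] --> g x by exact: cvg_nnsfun_approx.
have -> : \int[nu]_x g x = limn (fun n => \int[nu]_x (a n x)%:E).
  rewrite -monotone_convergence//; last by move=> n x _; rewrite lee_fin.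
  by apply: eq_integral => x _; apply/esym/cvg_lim.
have -> : \int[mu]_x (g x * (h x)%:E) =
    limn (fun n => \int[mu]_x ((a n x)%:E * (h x)%:E)).
  rewrite -monotone_convergence//.
  - by apply: eq_integral => x _; apply/esym/cvg_lim => //; exact: cvgeZr.
  - by move=> n; apply: emeasurable_funM => //; exact: mEh.
  - by move=> n x _; rewrite mule_ge0// lee_fin.
  - by move=> x _ m n mn; rewrite lee_wpmul2r ?lee_fin//; have := nda x _ _ mn; rewrite lee_fin.
by under eq_fun do rewrite ha.
Qed.

End density.

(** * Conditioning on the past *)

Section past.
Context {dS : measure_display} {S : measurableType dS} {R : realType}.
Context {dO : measure_display} {Omega : measurableType dO}.
Variables (P : probability Omega R) (Q : probability S R) (Y : nat -> Omega -> S).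
Hypotheses (mY : forall i, measurable_fun setT (Y i))
  (lawY : forall i B, measurable B -> P (Y i @^-1` B) = Q B)
  (indepY : forall (J : {fset nat}) (B : nat -> set S),
    (forall i, measurable (B i)) ->
    P (\bigcap_(i in [set` J]) (Y i @^-1` B i)) =
      (\prod_(i <- J) P (Y i @^-1` B i))%E).

Definition cylinders (n : nat) : set (set Omega) :=
  [set A | exists2 B : nat -> set S, (forall i, measurable (B i)) &
    A = \bigcap_(i in `I_n) (Y i @^-1` B i)].

(** The points are those of [Omega]; only the sigma-algebra shrinks to the one generated by the
    first [n] observations. A function of the past thus remains a function on [Omega]. Rectangles
    are taken as generators because they are closed under intersection. *)
Definition past (n : nat) := g_sigma_algebraType (cylinders n).

Let mpre i B : measurable B -> measurable (Y i @^-1` B).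
Proof. by move=> mB; rewrite -(setTI (_ @^-1` _)); exact: mY. Qed.

Let cylinders_measurable n : cylinders n `<=` measurable.
Proof.
move=> _ [B mB ->]; apply: bigcap_measurableType => // i _; exact: mpre.
Qed.

Lemma measurable_past n (A : set Omega) :
  (measurable : set (set (past n))) A -> measurable A.
Proof.
exact: (@smallest_sub _ (sigma_algebra setT) _ _
  (@sigma_algebra_measurable _ Omega) (cylinders_measurable (n:=n))).
Qed.

Lemma measurable_id_past n : measurable_fun setT (idfun : Omega -> past n).
Proof. by move=> _ A mA; rewrite setTI; exact: (measurable_past (n := n)). Qed.

Lemma measurable_past_coord n i : (i < n)%N ->
  measurable_fun setT (Y i : past n -> S).
Proof.
move=> ltin _ B mB; rewrite setTI; apply: sub_sigma_algebra.
exists (fun j => if j == i then B else setT).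
  by move=> j; case: ifP.
apply/seteqP; split=> [w Bw j|w /(_ i ltin)/=]; last by rewrite eqxx.
by rewrite /=; case: eqP => [->|].
Qed.

Let J (n : nat) : {fset nat} := iteri n (fun k A => k |` A)%fset fset0.

Let memJ n i : (i \in J n) = (i < n)%N.
Proof.
elim: n => [|n IHn].
  by rewrite in_fset0.
by rewrite /J /= in_fset1U -/(J n) IHn [RHS]ltnS [RHS]leq_eqVlt.
Qed.

Let bigcapJ n B : \bigcap_(i in `I_n) (Y i @^-1` B i) =
  \bigcap_(i in [set` J n]) (Y i @^-1` B i).
Proof. by congr bigcap; apply/seteqP; split=> i /=; rewrite memJ. Qed.

Let bigcapJS n (A B : nat -> set S) C :
  (\bigcap_(i in `I_n) (Y i @^-1` A i)) `&` Y n @^-1` C =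
  \bigcap_(i in `I_n.+1) (Y i @^-1` (if (i < n)%N then A i else C)).
Proof.
apply/seteqP; split=> [w [Aw Cw] i /=|w Bw].
  rewrite ltnS => leni; case: ifPn => [/Aw//|]; rewrite -leqNgt => ni.
  by rewrite (_ : i = n)//; apply/eqP; rewrite eqn_leq leni.
split=> [i /= ltin|]; last by have /= := Bw n; rewrite ltnn; exact.
by have /= := Bw i; rewrite ltin; apply; exact: ltnW.
Qed.

(** For fixed [B] both sides are finite measures in [A], so they only have to be compared on the
    cylinders, a generator closed under intersection. There the identity is independence of [n.+1]
    coordinates against that of [n]. *)
Lemma prod_law_past n (A : set Omega) (B : set S) :
  (measurable : set (set (past n))) A -> measurable B ->
  P (A `&` Y n @^-1` B) = (P A * Q B)%E.
Proof.
move=> mA mB; have mYB := mpre n mB.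
have QBfin : Q B \is a fin_num by exact: fin_num_measure.
have QB0 : (0 <= fine (Q B))%R by rewrite fine_ge0.
pose m1 := mrestr P mYB; pose m2 := mscale (NngNum QB0) P.
suff : m1 A = m2 A by rewrite /m1 /m2 /mrestr /mscale/= fineK// muleC.
apply: (@g_sigma_algebra_measure_unique _ R Omega (cylinders n)
  (cylinders_measurable (n := n)) (fun=> setT)) => //.
- move=> _; exists (fun=> setT) => //.
  by apply/seteqP; split.
- by rewrite bigcup_const.
- move=> _ _ [A1 mA1 ->] [A2 mA2 ->]; exists (fun i => A1 i `&` A2 i).
    by move=> i; exact: measurableI.
  by rewrite -bigcapI; apply: eq_bigcapr => i _; rewrite preimage_setI.
- move=> _ [C mC ->]; rewrite /= /mrestr /mscale/=. rewrite fineK//.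
  have mC' i : measurable (if (i < n)%N then C i else B) by case: ifP.
  rewrite bigcapJS// !bigcapJ (indepY (J n.+1) mC') (indepY (J n) mC)/=.
  rewrite big_fsetU1 ?memJ ?ltnn//= lawY//; congr (_ * _)%E.
  rewrite [LHS]big_seq_cond [RHS]big_seq_cond; apply: eq_bigr => i.
  by rewrite andbT memJ => ->.
- by move=> _; rewrite /m1 /mrestr ltey_eq fin_num_measure// setTI.
Qed.

(** Freezing the past: by [prod_law_past] the joint law of the past and [Y n] is a product, and
    Tonelli integrates the new observation out with the past held fixed. This takes the place of
    conditional expectations. *)
Lemma integral_past n (g : past n * S -> \bar R) :
  measurable_fun setT g -> (forall z, (0 <= g z)%E) ->
  (\int[P]_w g (w, Y n w) = \int[P]_w \int[Q]_y g (w, y))%E.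
Proof.
move=> mg g0.
pose X : {mfun Omega >-> past n} :=
  HB.pack (idfun : Omega -> past n)
    (isMeasurableFun.Build _ _ _ _ _ (measurable_id_past (n := n))).
have mXY : measurable_fun setT (fun w => (w, Y n w) : past n * S).
  exact: (@measurable_fun_pair _ _ _ Omega (past n) S idfun (Y n)
    (measurable_id_past (n := n)) (mY n)).
pose XY : {mfun Omega >-> (past n * S)%type} :=
  HB.pack (fun w => (w, Y n w) : past n * S) (isMeasurableFun.Build _ _ _ _ _ mXY).
have law Z : measurable Z -> (distribution P X \x Q)%E Z = distribution P XY Z.
  apply: product_measure_unique => A B mA mB; rewrite /distribution/= /pushforward.
  by rewrite -(prod_law_past mA mB).
transitivity (\int[distribution P XY]_z g z)%E.
  by rewrite ge0_integral_pushforward//; exact: measurable_funPT.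
transitivity (\int[distribution P X \x Q]_z g z)%E.
  by apply: eq_measure_integral => A mA _; apply/esym; exact: law.
rewrite fubini_tonelli1//.
rewrite ge0_integral_pushforward//.
- exact: measurable_fun_fubini_tonelli_F.
- by move=> y _; apply: integral_ge0.
Qed.

Lemma measurable_fun_past n (g : past n -> \bar R) :
  measurable_fun setT g -> measurable_fun setT (g : Omega -> \bar R).
Proof. by move=> mg; exact: measurableT_comp mg (measurable_id_past (n := n)). Qed.

Lemma integral_prod_le (h : S -> R) (c : R) n :
  measurable_fun setT h -> (forall y, 0 <= h y) ->
  (\int[Q]_y (h y)%:E <= c%:E)%E ->
  (\int[P]_w (\prod_(i < n) h (Y i w))%:E <= (c ^+ n)%:E)%E.
Proof.
move=> mh h0 hc; elim: n => [|n IHn].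
  under eq_integral do rewrite big_ord0.
  by rewrite integral_cst//= probability_setT mule1 expr0.
have mp : measurable_fun setT (fun w : past n => \prod_(i < n) h (Y i w)).
  apply: measurable_prod => i _; apply: measurableT_comp => //.
  exact: measurable_past_coord.
have p0 w : 0 <= \prod_(i < n) h (Y i w) by rewrite prodr_ge0.
under eq_integral do rewrite big_ord_recr/=.
rewrite (@integral_past n
  (fun z => ((\prod_(i < n) h (Y i (z.1 : Omega))) * h z.2)%:E)); last 2 first.
- apply/measurable_EFinP; apply: measurable_funM.
    by apply: (measurableT_comp mp).
  by apply: (measurableT_comp mh).
- by move=> z; rewrite lee_fin mulr_ge0.
have c0 : 0 <= c.
  by rewrite -lee_fin (le_trans _ hc)// integral_ge0// => y _; rewrite lee_fin.
under eq_integral => w _.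
  under eq_integral do rewrite /= EFinM.
  rewrite ge0_integralZl_EFin//; first over.
  - by move=> y _; rewrite lee_fin.
  - exact/measurable_EFinP.
have mp' : measurable_fun setT (fun w => (\prod_(i < n) h (Y i w))%:E : \bar R).
  by apply/measurable_EFinP; exact: (measurableT_comp mp (measurable_id_past (n := n))).
rewrite ge0_integralZr//; last 2 first.
- by move=> w _; rewrite lee_fin.
- by apply: integral_ge0 => y _; rewrite lee_fin.
rewrite exprSr EFinM; apply: lee_pmul => //.
- by apply: integral_ge0 => y _; rewrite lee_fin.
- by apply: integral_ge0 => y _; rewrite lee_fin.
Qed.

End past.

(** * Almost sure statements from convergent sums of integrals *)

Section ae_tools.
Local Open Scope ereal_scope.
Context {d} {X : measurableType d} {R : realType}.
Variable mu : {measure set X -> \bar R}.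

Lemma nneseries_le (u : nat -> \bar R) (M : \bar R) : (forall n, 0 <= u n) ->
  (forall N, \sum_(0 <= n < N) u n <= M) -> \sum_(n <oo) u n <= M.
Proof.
move=> u0 uM; apply: lime_le; first by apply: is_cvg_nneseries.
exact: nearW.
Qed.

Lemma geometric_nneseries_lty (q : R) : (0 <= q < 1)%R ->
  \sum_(n <oo) (q ^+ n)%:E < +oo.
Proof.
move=> /andP[q0 q1]; have q1' : (0 < 1 - q)%R by rewrite subr_gt0.
apply: (@le_lt_trans _ _ ((1 - q)^-1)%:E); last exact: ltry.
apply: nneseries_le => [n|N]; first by rewrite lee_fin exprn_ge0.
rewrite sumEFin lee_fin -[leRHS]mulr1 ler_pdivlMl// big_mkord.
by rewrite -opprB mulNr -subrX1 opprB lerBlDr lerDl exprn_ge0.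
Qed.

Lemma integrable_ge0 (f : X -> \bar R) : measurable_fun setT f ->
  (forall x, 0 <= f x) -> \int[mu]_x f x < +oo -> mu.-integrable setT f.
Proof.
move=> mf f0 foo; apply/integrableP; split=> //.
by under eq_integral do rewrite gee0_abs//.
Qed.

Lemma ae_lty (f : X -> \bar R) : measurable_fun setT f ->
  (forall x, 0 <= f x) -> \int[mu]_x f x < +oo ->
  {ae mu, forall x, f x < +oo}.
Proof.
move=> mf f0 foo; have fi := integrable_ge0 mf f0 foo.
apply: filterS (integrable_ae measurableT fi) => x /(_ Logic.I).
by rewrite ge0_fin_numE.
Qed.

(** Borel-Cantelli with the Markov inequality built in: the sum of the [f n] has a finite integral,
    hence is finite almost everywhere, and each term is at most a tail of that sum. *)
Lemma ae_eventually_lt1 (f : nat -> X -> \bar R) :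
  (forall n, measurable_fun setT (f n)) -> (forall n x, 0 <= f n x) ->
  \sum_(n <oo) \int[mu]_x f n x < +oo ->
  {ae mu, forall x, \forall n \near \oo, f n x < 1}.
Proof.
move=> mf f0 foo.
have : {ae mu, forall x, \sum_(n <oo) f n x < +oo}.
  apply: ae_lty => [|x|].
  - by apply: ge0_emeasurable_sum.
  - exact: nneseries_ge0.
  - by rewrite integral_nneseries.
apply: filterS => x fxoo.
have := @nneseries_tail_cvg _ (f ^~ x) xpredT fxoo (fun k _ => f0 k x).
move=> /fine_cvgP[fin_tail] /cvgr_lt /(_ 1%R ltr01) lt1.
near=> N.
have tailfin : \sum_(N <= k <oo) f k x \is a fin_num by near: N.
have tail1 : \sum_(N <= k <oo) f k x < 1.
  by rewrite -(fineK tailfin) lte_fin; near: N.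
apply: le_lt_trans tail1.
apply: le_trans (nneseries_lim_ge N.+1 _) => //.
by rewrite big_nat1.
Unshelve. all: by end_near. Qed.

End ae_tools.

(** * One-sided law of large numbers *)

(** From [(1 - x) * expR x <= 1]: the quotient [1 / (1 - x)] is [1 + x + x ^+ 2 / (1 - x)], and
    [1 - x] is at least 1/2. Arbitrarily negative [x] are covered. *)
Lemma expR_le_quad {R : realType} (x : R) : x <= 2^-1 ->
  expR x <= 1 + x + 2 * x ^+ 2.
Proof.
move=> x2; have e0 := expR_gt0 x.
have e1 : (1 - x) * expR x <= 1.
  have := expR_ge1Dx (- x); rewrite expRN => h.
  by rewrite -ler_pdivlMr// div1r.
by nra.
Qed.

(** Multiply [(1 - x) * expR x <= 1] by [1 + x]. *)
Lemma expR_le_quad_ge0 {R : realType} (x : R) : 0 <= x ->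
  expR x <= 1 + x + x ^+ 2 * expR x.
Proof.
move=> x0; have e0 := expR_gt0 x.
have e1 : (1 - x) * expR x <= 1.
  have := expR_ge1Dx (- x); rewrite expRN => h.
  by rewrite -ler_pdivlMr// div1r.
by nra.
Qed.

Section lln.
Context {dS : measure_display} {S : measurableType dS} {R : realType}.
Context {dO : measure_display} {Omega : measurableType dO}.
Variables (P : probability Omega R) (Q : probability S R) (Y : nat -> Omega -> S).
Hypotheses (mY : forall i, measurable_fun setT (Y i))
  (lawY : forall i B, measurable B -> P (Y i @^-1` B) = Q B)
  (indepY : forall (J : {fset nat}) (B : nat -> set S),
    (forall i, measurable (B i)) ->
    P (\bigcap_(i in [set` J]) (Y i @^-1` B i)) =
      (\prod_(i <- J) P (Y i @^-1` B i))%E).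

Lemma ae_prod_lt1 (h : S -> R) (q : R) :
  measurable_fun setT h -> (forall y, 0 <= h y) -> q < 1 ->
  (\int[Q]_y (h y)%:E <= q%:E)%E ->
  {ae P, forall w, \forall n \near \oo, \prod_(i < n) h (Y i w) < 1}.
Proof.
move=> mh h0 q1 hq.
have q0 : 0 <= q.
  by rewrite -lee_fin (le_trans _ hq)// integral_ge0// => y _; rewrite lee_fin.
have mp n : measurable_fun setT (fun w => (\prod_(i < n) h (Y i w))%:E : \bar R).
  by apply/measurable_EFinP; apply: measurable_prod => i _; exact: (measurableT_comp mh (mY i)).
have p0 n w : (0 <= (\prod_(i < n) h (Y i w))%:E)%E by rewrite lee_fin prodr_ge0.
have foo : (\sum_(n <oo) \int[P]_w (\prod_(i < n) h (Y i w))%:E < +oo)%E.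
  apply: le_lt_trans (geometric_nneseries_lty (q := q) _); last by rewrite q0.
  apply: lee_nneseries => [n _ _|n _]; first exact: integral_ge0.
  exact: (integral_prod_le mY lawY indepY).
apply: filterS (ae_eventually_lt1 mp p0 foo) => w.
by apply: filterS => n; rewrite lte_fin.
Qed.

Lemma lln_bounded (v : S -> R) (M c : R) :
  measurable_fun setT v -> (forall y, 0 <= v y <= M) ->
  (\int[Q]_y (v y)%:E < c%:E)%E ->
  {ae P, forall w, \forall n \near \oo, \sum_(i < n) v (Y i w) <= c * n%:R}.
Proof.
move=> mv vM vc.
have v0 y : 0 <= v y by case/andP: (vM y).
have iv0 : (0 <= \int[Q]_y (v y)%:E)%E.
  by apply: integral_ge0 => y _; rewrite lee_fin.
have ivfin : (\int[Q]_y (v y)%:E)%E \is a fin_num.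
  by rewrite ge0_fin_numE// (lt_trans vc)// ltry.
have M0 : 0 <= M by case/andP: (vM point) => /le_trans; apply.
pose m := fine (\int[Q]_y (v y)%:E)%E.
have mE : (\int[Q]_y (v y)%:E)%E = m%:E by rewrite fineK.
have m0 : 0 <= m by rewrite fine_ge0.
have mc : m < c by rewrite -lte_fin -mE.
(* Chernoff bound with tilt [l]. [K] dominates [|v y - c|]; the quadratic cost [2 * l ^+ 2 * K ^+ 2]
   is exactly half of the linear gain [l * (c - m)], and [l * K <= 1/4] keeps the exponent in the
   range of [expR_le_quad]. *)
pose K := M + c + 1; pose l := (c - m) / (4 * K ^+ 2).
have K1 : 1 <= K by rewrite /K; lra.
have Kn0 : K != 0 by rewrite gt_eqF//; lra.
have K20 : 0 < K ^+ 2 by rewrite exprn_gt0//; lra.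
have l0 : 0 < l by rewrite divr_gt0//; [lra|rewrite mulr_gt0].
have lK2 : 4 * (l * K ^+ 2) = c - m by rewrite /l; field.
have lK : l * K <= 4^-1.
  have : l * K * K <= 4^-1 * K by rewrite /K in lK2 *; nra.
  by rewrite ler_pM2r//; lra.
have lc : l * c <= 4^-1 by rewrite /K in lK; nra.
pose A := 1 - l * c + 2 * l ^+ 2 * K ^+ 2.
have A0 : 0 <= A by rewrite /A; have : 0 <= l ^+ 2 * K ^+ 2 by [rewrite mulr_ge0// sqr_ge0]; nra.
have hA y : expR (l * (v y - c)) <= A + l * v y.
  have /andP[vy0 vyM] := vM y.
  apply: le_trans (expR_le_quad _) _; first by rewrite /K in lK; nra.
  have : (v y - c) ^+ 2 <= K ^+ 2 by rewrite -subr_ge0 subr_sqr mulr_ge0// /K; lra.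
  have l2 : 0 <= l ^+ 2 by rewrite sqr_ge0.
  by move=> /(ler_wpM2l l2) h; rewrite /A exprMn; lra.
have mlv : measurable_fun setT (fun y => (l * v y)%:E : \bar R).
  by apply/measurable_EFinP; exact: measurable_funM.
have me : measurable_fun setT (fun y => expR (l * (v y - c))).
  by apply: measurableT_comp => //; apply: measurable_funM => //; exact: measurable_funB.
have := @ae_prod_lt1 (fun y => expR (l * (v y - c))) (1 - l * (c - m) / 2).
move=> /(_ me (fun=> expR_ge0 _)).
have q1 : 1 - l * (c - m) / 2 < 1 by nra.
move=> /(_ q1).
have hq : (\int[Q]_y (expR (l * (v y - c)))%:E <= (1 - l * (c - m) / 2)%:E)%E.
  apply: (@le_trans _ _ (\int[Q]_y (A%:E + (l * v y)%:E))%E).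
    apply: ge0_le_integral => //.
    - exact/measurable_EFinP.
    - by apply: emeasurable_funD.
    - by move=> y _; rewrite -EFinD lee_fin.
  rewrite ge0_integralD//; last by move=> y _; rewrite lee_fin mulr_ge0// ltW.
  rewrite integral_cst//= probability_setT mule1.
  under eq_integral do rewrite EFinM.
  rewrite ge0_integralZl_EFin//; last 3 first.
  - by move=> y _; rewrite lee_fin.
  - exact/measurable_EFinP.
  - exact: ltW.
  rewrite mE -EFinM -EFinD lee_fin /A.
  have : 2 * l ^+ 2 * K ^+ 2 = l * (c - m) / 2 by rewrite -lK2; field.
  by lra.
move=> /(_ hq); apply: filterS => w; apply: filterS => n.
move=> h; rewrite -expR_sum -expR0 ltr_expR in h.
have : \sum_(i < n) l * (v (Y i w) - c) = l * (\sum_(i < n) v (Y i w) - c * n%:R).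
  by rewrite -mulr_sumr sumrB sumr_const card_ord mulr_natr.
by move=> e; move: h; rewrite e pmulr_rlt0// subr_lt0 => /ltW.
Qed.

End lln.

(** The truncation estimate of the strong law. The potential [6 * (t * K / (t + K))] never exceeds
    [6 * t], and doubling [K] raises it by at least [min t K ^+ 2 / K]; summing over [K = 2 ^+ j]
    telescopes, with no need to locate the index where [2 ^+ j] passes [t]. *)
Lemma sum_min_sqr_dyadic_le {R : realFieldType} (t : R) (J : nat) : 0 <= t ->
  \sum_(j < J) (Num.min t (2 ^+ j) ^+ 2 / 2 ^+ j) <= 6 * t.
Proof.
move=> t0.
have two0 (j : nat) : (0 : R) < 2 ^+ j by rewrite exprn_gt0.
have step (K : R) : 0 < K ->
    6 * (t * K / (t + K)) + Num.min t K ^+ 2 / K <= 6 * (t * (2 * K) / (t + 2 * K)).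
  move=> K0.
  have h : Num.min t K ^+ 2 * (t + K) * (t + 2 * K) <= 6 * t ^+ 2 * K ^+ 2.
    case: (leP t K) => tK.
      have h1 : (t + K) * (t + 2 * K) <= 6 * K ^+ 2.
        rewrite -subr_ge0 (_ : _ - _ = (K - t) * (t + 4 * K)); last by ring.
        by rewrite mulr_ge0//; lra.
      by have := ler_wpM2l (sqr_ge0 t) h1; lra.
    have h1 : (t + K) * (t + 2 * K) <= 6 * t ^+ 2.
      rewrite -subr_ge0 (_ : _ - _ = (t - K) * (5 * t + 2 * K)); last by ring.
      by rewrite mulr_ge0//; lra.
    by have := ler_wpM2l (sqr_ge0 K) h1; lra.
  rewrite -subr_ge0.
  have -> : 6 * (t * (2 * K) / (t + 2 * K)) -
      (6 * (t * K / (t + K)) + Num.min t K ^+ 2 / K) =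
      (6 * t ^+ 2 * K ^+ 2 - Num.min t K ^+ 2 * (t + K) * (t + 2 * K)) /
      (K * (t + K) * (t + 2 * K)).
    by field; rewrite !gt_eqF//; lra.
  by rewrite divr_ge0 ?subr_ge0// !mulr_ge0//; lra.
apply: (@le_trans _ _ (6 * (t * 2 ^+ J / (t + 2 ^+ J)))).
  elim: J => [|J IHJ].
    by rewrite big_ord0 expr0 mulr1 mulr_ge0// divr_ge0//; lra.
  by rewrite big_ord_recr/= [2 ^+ J.+1]exprS (le_trans _ (step _ (two0 J)))// lerD2r.
rewrite ler_pM2l// ler_pdivrMr ?ltr_wpDl//.
by have := two0 J; nra.
Qed.

(** * Exponential bounds on dyadic blocks for nonnegative functions of finite mean *)

Section lln_tail.
Context {dS : measure_display} {S : measurableType dS} {R : realType}.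
Context {dO : measure_display} {Omega : measurableType dO}.
Variables (P : probability Omega R) (Q : probability S R) (Y : nat -> Omega -> S).
Hypotheses (mY : forall i, measurable_fun setT (Y i))
  (lawY : forall i B, measurable B -> P (Y i @^-1` B) = Q B)
  (indepY : forall (J : {fset nat}) (B : nat -> set S),
    (forall i, measurable (B i)) ->
    P (\bigcap_(i in [set` J]) (Y i @^-1` B i)) =
      (\prod_(i <- J) P (Y i @^-1` B i))%E).

Lemma integral_comp (i : nat) (g : S -> \bar R) : measurable_fun setT g ->
  (forall y, 0 <= g y)%E -> (\int[P]_w g (Y i w) = \int[Q]_y g y)%E.
Proof.
move=> mg g0.
pose X : {mfun Omega >-> S} :=
  HB.pack (Y i) (isMeasurableFun.Build _ _ _ _ _ (mY i)).
transitivity (\int[distribution P X]_y g y)%E.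
  by rewrite ge0_integral_pushforward//; exact: measurable_funPT.
by apply: eq_measure_integral => A mA _; exact: lawY.
Qed.

Section one_block.
Variables (t : S -> R) (K : R) (k : nat).
Hypotheses (mt : measurable_fun setT t) (t0 : forall y, 0 <= t y)
  (it : (\int[Q]_y (t y)%:E <= 1)%E) (K1 : 1 <= K) (kK : k%:R = K).

Let v := (\int[Q]_y (Num.min (t y) K ^+ 2 / K)%:E)%E.
Let bad := t @^-1` `]K, +oo[%classic.

Let mmin : measurable_fun setT (fun y => Num.min (t y) K).
Proof. exact: measurable_minr. Qed.

Let mv : measurable_fun setT (fun y => Num.min (t y) K ^+ 2 / K).
Proof. by apply: measurable_funM => //; exact: measurable_funX. Qed.

Let mbad : measurable bad.
Proof. by rewrite -[bad]setTI; apply: mt => //; exact: measurable_itv. Qed.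

(* [f] adds the indicators of [t (Y i) > K] to [exp (-4a) * prod_i exp (a v_i)],
   where [v_i = min (t (Y i)) K / K]; the choice [exp (-3a) = v + 1/K] makes the
   bound summable over [K = 2 ^ j]. *)
Lemma block_sum_bound : exists f : Omega -> R,
  [/\ measurable_fun setT f, forall w, 0 <= f w,
      (forall w, f w < 1 -> \sum_(i < k) t (Y i w) <= 4 * K) &
      (\int[P]_w (f w)%:E <= 5%:E * (v + (K^-1)%:E))%E].
Proof.
have K0 : 0 < K by exact: lt_le_trans ltr01 K1.
have min0 y : 0 <= Num.min (t y) K by rewrite le_min t0 ltW.
have minK y : Num.min (t y) K <= K by rewrite ge_min lexx orbT.
have mint y : Num.min (t y) K <= t y by rewrite ge_min lexx.
have mtE : measurable_fun setT (fun y => (t y)%:E : \bar R) by exact/measurable_EFinP.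
have mvE : measurable_fun setT (fun y => (Num.min (t y) K ^+ 2 / K)%:E : \bar R).
  exact/measurable_EFinP.
have v_ge0 : (0 <= v)%E.
  by apply: integral_ge0 => y _; rewrite lee_fin divr_ge0 ?sqr_ge0// ltW.
have v_le1 : (v <= 1)%E.
  apply: le_trans it; apply: ge0_le_integral => //.
  - by move=> y _; rewrite lee_fin divr_ge0 ?sqr_ge0// ltW.
  - move=> y _; rewrite lee_fin ler_pdivrMr// expr2.
    by apply: ler_pM.
have v_fin : v \is a fin_num by rewrite ge0_fin_numE// (le_lt_trans v_le1)// ltry.
pose r := fine v; have vE : v = r%:E by rewrite fineK.
have r0 : 0 <= r by rewrite fine_ge0.
have r1 : r <= 1 by rewrite -lee_fin -vE.
pose r' := r + K^-1.
have r'0 : 0 < r' by rewrite ltr_wpDl// invr_gt0.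
have [a [a0 a_exp a_r']] : exists a, [/\ 0 <= a, expR (3 * a) * r <= 1 & expR (- (3 * a)) <= r'].
  (* The equation [expR (- (3 * a)) = r'] would make [a] negative when [r' > 1]; [a = 0] then
     satisfies all three requirements, because [r <= 1]. *)
  have [r'1|r'1] := leP 1 r'.
    by exists 0; split => //; rewrite mulr0 ?oppr0 expR0// mul1r.
  exists (- ln r' / 3); have e : 3 * (- ln r' / 3) = - ln r' by field.
  split; last by rewrite e opprK lnK.
    by rewrite divr_ge0// oppr_ge0 ln_le0// ltW.
  rewrite e expRN lnK// mulrC ler_pdivrMr// mul1r /r' lerDl invr_ge0.
  exact: ltW.
pose h y := expR (a / K * Num.min (t y) K).
pose q := 1 + a / K + expR (3 * a) * r / K.
have mh : measurable_fun setT h.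
  by apply: measurableT_comp => //; exact: measurable_funM.
have hq : (\int[Q]_y (h y)%:E <= q%:E)%E.
  have hle y : h y <= 1 + a / K * t y + expR (3 * a) / K * (Num.min (t y) K ^+ 2 / K).
    set x := a / K * Num.min (t y) K.
    have x0 : 0 <= x by rewrite /x mulr_ge0// divr_ge0// ltW.
    have xa : x <= a.
      by rewrite /x mulrAC ler_pdivrMr// ler_wpM2l.
    apply: le_trans (expR_le_quad_ge0 x0) _; apply: lerD.
      by rewrite lerD2l /x ler_wpM2l// divr_ge0// ltW.
    have -> : x ^+ 2 * expR x = (a ^+ 2 * expR x) / K * (Num.min (t y) K ^+ 2 / K).
      by rewrite /x; field; rewrite gt_eqF.
    apply: ler_wpM2r; first by rewrite divr_ge0 ?sqr_ge0// ltW.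
    apply: ler_wpM2r; first by rewrite invr_ge0 ltW.
    (* Origin of the factor 3: [a ^+ 2 * expR x] is at most [expR (3 * a)], one [expR a] for each
       factor [a] and one because [x <= a]. *)
    have aa : a <= expR a by have := expR_ge1Dx a; lra.
    rewrite (_ : 3 * a = a + a + a); last by ring.
    rewrite !expRD; apply: ler_pM => //; first by rewrite sqr_ge0.
      by rewrite expr2 ler_pM.
    by rewrite ler_expR.
  apply: (@le_trans _ _ (\int[Q]_y (1 + ((a / K)%:E * (t y)%:E +
      (expR (3 * a) / K)%:E * (Num.min (t y) K ^+ 2 / K)%:E)))%E).
    apply: ge0_le_integral => //.
    - by move=> y _; rewrite lee_fin expR_ge0.
    - exact/measurable_EFinP.
    - apply: emeasurable_funD => //.
      by apply: emeasurable_funD; exact: measurable_funeM.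
    - by move=> y _; rewrite -!EFinM -!EFinD lee_fin addrA.
  have aK0 : 0 <= a / K by rewrite divr_ge0// ltW.
  have eK0 : 0 <= expR (3 * a) / K by rewrite divr_ge0// ltW.
  have p1 y : (0 <= (a / K)%:E * (t y)%:E)%E by rewrite mule_ge0// lee_fin.
  have p2 y : (0 <= (expR (3 * a) / K)%:E * (Num.min (t y) K ^+ 2 / K)%:E)%E.
    by rewrite mule_ge0// lee_fin// divr_ge0 ?sqr_ge0// ltW.
  have m1 : measurable_fun setT (fun y => ((a / K)%:E * (t y)%:E)%E).
    exact: measurable_funeM.
  have m2 : measurable_fun setT
      (fun y => ((expR (3 * a) / K)%:E * (Num.min (t y) K ^+ 2 / K)%:E)%E).
    exact: measurable_funeM.
  rewrite ge0_integralD//; last 2 first.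
  - by move=> y _; rewrite adde_ge0.
  - exact: emeasurable_funD.
  rewrite ge0_integralD// integral_cst//= probability_setT mule1.
  rewrite !ge0_integralZl_EFin//; last 2 first.
    by move=> y _; rewrite lee_fin divr_ge0 ?sqr_ge0// ltW.
    by move=> y _; rewrite lee_fin.
  rewrite -/v vE /q -addrA EFinD leeD2l// EFinD; apply: leeD; last first.
    by rewrite -EFinM lee_fin mulrAC.
  apply: (@le_trans _ _ ((a / K)%:E * 1)%E); last by rewrite mule1.
  by rewrite lee_wpmul2l// lee_fin.
have q_exp : q ^+ k <= expR (a + expR (3 * a) * r).
  have -> : a + expR (3 * a) * r = k%:R * ((a + expR (3 * a) * r) / K).
    by rewrite kK; field; rewrite gt_eqF.
  rewrite expRM_natl; apply: lerXn2r.
  - rewrite nnegrE /q !addr_ge0// divr_ge0//; [exact: ltW|rewrite mulr_ge0// expR_ge0|exact: ltW].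
  - by rewrite nnegrE expR_ge0.
  - by have := expR_ge1Dx ((a + expR (3 * a) * r) / K); rewrite /q mulrDl addrA.
have mbadP i : measurable_fun setT (fun w => \1_bad (Y i w) : R).
  by apply: (measurableT_comp (measurable_indic _)).
pose f1 w := \sum_(i < k) (\1_bad (Y i w) : R).
pose f2 w := \prod_(i < k) h (Y i w).
have mf1 : measurable_fun setT f1 by apply: measurable_sum => i.
have mf2 : measurable_fun setT f2.
  by apply: measurable_prod => i _; exact: (measurableT_comp mh (mY i)).
have f10 w : 0 <= f1 w by rewrite sumr_ge0.
have f20 w : 0 <= f2 w by rewrite prodr_ge0// => i _; exact: expR_ge0.
have ea0 : 0 <= expR (- (4 * a)) by exact: expR_ge0.
exists (fun w => f1 w + expR (- (4 * a)) * f2 w); split.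
- by apply: measurable_funD => //; exact: measurable_funM.
- by move=> w; rewrite addr_ge0// mulr_ge0.
- move=> w fw.
  have f1w : f1 w < 1 by apply: le_lt_trans fw; rewrite lerDl mulr_ge0.
  have f2w : expR (- (4 * a)) * f2 w < 1 by apply: le_lt_trans fw; rewrite lerDr.
  have tK (i : 'I_k) : t (Y i w) <= K.
    rewrite leNgt; apply/negP => Kt.
    have : 1 <= f1 w.
      rewrite /f1 (bigD1 i)//= indicE mem_set; last by rewrite /bad/= in_itv/= Kt.
      by rewrite lerDl sumr_ge0.
    by rewrite leNgt f1w.
  move: f2w; rewrite /f2 /h -expR_sum -expRD => f2w; rewrite -[ltRHS]expR0 ltr_expR in f2w.
  have sE : \sum_(i < k) a / K * Num.min (t (Y i w)) K = a / K * \sum_(i < k) t (Y i w).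
    by rewrite mulr_sumr; apply: eq_bigr => i _; rewrite min_l.
  rewrite sE in f2w.
  (* With [a = 0] the exponential term of [f] equals 1, so [f w < 1] is impossible. *)
  have a_gt0 : 0 < a.
    rewrite lt_neqAle a0 andbT; apply/eqP => a_eq0.
    by move: f2w; rewrite -a_eq0 !(mulr0,mul0r,oppr0,addr0) ltxx.
  have : a * (K^-1 * \sum_(i < k) t (Y i w)) < a * 4 by rewrite mulrA; lra.
  by rewrite ltr_pM2l// mulrC ltr_pdivrMr// => /ltW.
under eq_integral do rewrite EFinD.
rewrite ge0_integralD//; last 4 first.
- by move=> w _; rewrite lee_fin.
- exact/measurable_EFinP.
- by move=> w _; rewrite lee_fin mulr_ge0.
- by apply/measurable_EFinP; exact: measurable_funM.
under [X in (_ + X)%E]eq_integral do rewrite EFinM.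
rewrite ge0_integralZl_EFin//; last 2 first.
- by move=> w _; rewrite lee_fin.
- exact/measurable_EFinP.
have -> : (\int[P]_w (f1 w)%:E = K%:E * Q bad)%E.
  under eq_integral do rewrite /f1 -sumEFin.
  rewrite ge0_integral_sum//; last first.
    by move=> i; exact/measurable_EFinP.
  rewrite (eq_bigr (fun=> Q bad)) => [|i _].
    have -> : Q bad = (fine (Q bad))%:E by rewrite fineK// fin_num_measure.
    by rewrite sumEFin sumr_const card_ord -mulr_natl kK EFinM.
  rewrite (@integral_comp i (fun y => (\1_bad y)%:E)).
  - by rewrite integral_indic// setIT.
  - by apply/measurable_EFinP; exact: measurable_indic.
  - by move=> y; rewrite lee_fin.
have Kbad : (K%:E * Q bad <= v)%E.
  rewrite -[bad]setIT -integral_indic// -ge0_integralZl_EFin//; last 2 first.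
  - by apply/measurable_EFinP; exact: measurable_indic.
  - exact: ltW.
  apply: ge0_le_integral => //.
  - by move=> y _; rewrite mule_ge0// lee_fin// ltW.
  - by apply: measurable_funeM; apply/measurable_EFinP; exact: measurable_indic.
  - move=> y _; rewrite -EFinM lee_fin indicE; have [/set_mem|_] := boolP (y \in bad).
      rewrite /bad/= in_itv/= andbT => Kt.
      by rewrite (min_r (ltW Kt)) mulr1 expr2 -mulrA divff ?mulr1// gt_eqF.
    by rewrite mulr0 divr_ge0 ?sqr_ge0// ltW.
have f2le : (\int[P]_w (f2 w)%:E <= (q ^+ k)%:E)%E.
  by apply: (integral_prod_le mY lawY indepY) => // y; exact: expR_ge0.
(* The constant 5 of the bound: the indicators contribute at most [v], and the exponential term at
   most [expR (1 - 3 * a) <= 4 * r'], by [expR (3 * a) * r <= 1]. *)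
have e4 : expR 1 <= 4 :> R.
  have := @expR_le_quad R 2^-1 (lexx _).
  have -> : expR 1 = expR (2^-1) * expR (2^-1) :> R.
    by rewrite -expRD; congr expR; field.
  move=> h1; have h2 := expR_ge0 (2^-1 : R).
  have h3 : expR (2^-1) <= 2 :> R by lra.
  by have := ler_pM h2 h2 h3 h3; lra.
apply: (@le_trans _ _ (r%:E + (4 * r')%:E)%E); last first.
  rewrite vE -!EFinD -EFinM lee_fin /r'; have : 0 < K^-1 by rewrite invr_gt0.
  by lra.
apply: leeD; first by rewrite -vE.
apply: (@le_trans _ _ (expR (- (4 * a)) * q ^+ k)%:E).
  by rewrite EFinM lee_wpmul2l// lee_fin.
rewrite lee_fin; apply: (@le_trans _ _ (expR (- (4 * a)) * expR (a + expR (3 * a) * r))).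
  by rewrite ler_wpM2l.
rewrite -expRD (_ : _ + _ = expR (3 * a) * r + - (3 * a)); last by ring.
rewrite expRD; apply: ler_pM => //; try exact: expR_ge0.
by apply: le_trans e4; rewrite ler_expR.
Qed.

End one_block.
End lln_tail.

Lemma measurable_lne_EFin {d} {X : measurableType d} {R : realType} (V : X -> R) :
  measurable_fun setT V -> measurable_fun setT (fun x => lne (V x)%:E).
Proof.
move=> mV; rewrite /lne; apply: measurable_fun_ifT => //.
  exact: measurable_fun_ler.
by apply/measurable_EFinP; exact: measurableT_comp.
Qed.

(** [lne V <= V] makes the negative part of [- lne V] integrable. The integral is then a true
    difference of its two parts, so an upper bound on it bounds the positive part as well. *)
Lemma integrable_oppe_lne {d} {X : measurableType d} {R : realType}
    (Q : probability X R) (V : X -> R) :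
  measurable_fun setT V -> (forall y, 0 <= V y) ->
  (\int[Q]_y (V y)%:E < +oo)%E ->
  (\int[Q]_y (- lne (V y)%:E) < +oo)%E ->
  Q.-integrable setT (fun y => - lne (V y)%:E)%E.
Proof.
move=> mV V0 Vfin Vc.
have mVE : measurable_fun setT (fun y => (V y)%:E : \bar R) by exact/measurable_EFinP.
have mlV := measurable_lne_EFin mV.
pose W y := (- lne (V y)%:E)%E.
have mW : measurable_fun setT W by exact: measurableT_comp.
have lneV y : (lne (V y)%:E <= (V y)%:E)%E.
  have := V0 y; rewrite le_eqVlt => /predU1P[<-|Vy0]; first by rewrite le0_lneNy// leNye.
  by rewrite lne_EFin// lee_fin ltW// ln_sublinear.
have Wneg : (\int[Q]_y W^\- y < +oo)%E.
  apply: le_lt_trans Vfin; apply: ge0_le_integral => //.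
  - by apply: measurable_funeneg.
  - by move=> y _; rewrite funenegE /W oppeK ge_max lneV lee_fin V0.
apply/integrableP; split=> //.
have -> : (fun y => `|W y|%E) = (fun y => W^\+ y + W^\- y)%E.
  exact: fune_abse.
rewrite ge0_integralD//; [|exact: measurable_funepos|exact: measurable_funeneg].
apply: lte_add_pinfty => //; move: Vc; rewrite -/W [X in (X < +oo)%E -> _]integralE.
have : (\int[Q]_y W^\- y)%E \is a fin_num by rewrite ge0_fin_numE// integral_ge0.
case: (\int[Q]_y W^\- y)%E => // r _.
by case: (\int[Q]_y W^\+ y)%E => // s _; rewrite ltry.
Qed.

Section lln_upper.
Context {dS : measure_display} {S : measurableType dS} {R : realType}.
Context {dO : measure_display} {Omega : measurableType dO}.
Variables (P : probability Omega R) (Q : probability S R) (Y : nat -> Omega -> S).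
Hypotheses (mY : forall i, measurable_fun setT (Y i))
  (lawY : forall i B, measurable B -> P (Y i @^-1` B) = Q B)
  (indepY : forall (J : {fset nat}) (B : nat -> set S),
    (forall i, measurable (B i)) ->
    P (\bigcap_(i in [set` J]) (Y i @^-1` B i)) =
      (\prod_(i <- J) P (Y i @^-1` B i))%E).

Lemma ae_law (p : set S) : {ae Q, forall y, p y} ->
  {ae P, forall w, forall i, p (Y i w)}.
Proof.
move=> [N [mN QN pN]]; apply: ae_foralln => i.
exists (Y i @^-1` N); split => [||w /= npw].
- by rewrite -(setTI (_ @^-1` _)); exact: mY.
- by have := lawY i mN; rewrite QN.
- exact: pN.
Qed.

(** Blocks of length [2 ^ j], truncated at their own length, have summable failure bounds. For
    [2 ^ j <= n < 2 ^ j.+1] the sum up to [n] is below that of block [j.+1], which is at most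
    [4 * 2 ^+ j.+1 <= 8 * n]. The crude constant 8 does no harm: [lln_upper] applies the lemma to a
    rescaled small remainder. *)
Lemma lln_mean_le1 (t : S -> R) :
  measurable_fun setT t -> (forall y, 0 <= t y) -> (\int[Q]_y (t y)%:E <= 1)%E ->
  {ae P, forall w, \forall n \near \oo, \sum_(i < n) t (Y i w) <= 8 * n%:R}.
Proof.
move=> mt t0 it.
have pow1 j : 1 <= 2 ^+ j :> R by rewrite exprn_ege1// ler1n.
have powE j : (2 ^ j)%:R = 2 ^+ j :> R by rewrite natrX.
have /choice[f fP] : forall j, exists f : Omega -> R,
   [/\ measurable_fun setT f, forall w, 0 <= f w,
      (forall w, f w < 1 -> \sum_(i < 2 ^ j) t (Y i w) <= 4 * 2 ^+ j) &
      (\int[P]_w (f w)%:E <=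
       5%:E * (\int[Q]_y (Num.min (t y) (2 ^+ j) ^+ 2 / 2 ^+ j)%:E
               + ((2 ^+ j)^-1)%:E))%E].
  move=> j; exact: (block_sum_bound mY lawY indepY mt t0 it (pow1 j) (powE j)).
have v0 j y : 0 <= Num.min (t y) (2 ^+ j) ^+ 2 / 2 ^+ j.
  by rewrite divr_ge0 ?sqr_ge0// exprn_ge0.
have mv j : measurable_fun setT (fun y => (Num.min (t y) (2 ^+ j) ^+ 2 / 2 ^+ j)%:E : \bar R).
  apply/measurable_EFinP; apply: measurable_funM => //.
  by apply: measurable_funX; exact: measurable_minr.
have ae1 : {ae P, forall w, \forall j \near \oo, ((f j w)%:E < 1)%E}.
  apply: ae_eventually_lt1.
  - by move=> j; have [mf _ _ _] := fP j; exact/measurable_EFinP.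
  - by move=> j w; have [_ f0 _ _] := fP j; rewrite lee_fin.
  apply: (@le_lt_trans _ _ (40%:E)); last exact: ltry.
  apply: nneseries_le => [j|N].
    by apply: integral_ge0 => w _; have [_ f0 _ _] := fP j; rewrite lee_fin.
  apply: (@le_trans _ _ (\sum_(0 <= j < N) (5%:E *
    (\int[Q]_y (Num.min (t y) (2 ^+ j) ^+ 2 / 2 ^+ j)%:E + ((2 ^+ j)^-1)%:E)))%E).
    by apply: lee_sum => j _; have [_ _ _ ] := fP j.
  rewrite -ge0_sume_distrr; last first.
    move=> j _; apply: adde_ge0; last by rewrite lee_fin invr_ge0 exprn_ge0.
    by apply: integral_ge0 => y _; rewrite lee_fin.
  (* 5 comes from the block bound, 6 from the dyadic truncation sum with mean at most 1, and 2 from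
     the sum of the [(2 ^+ j)^-1]. *)
  have -> : 40%:E = (5%:E * (6%:E + 2%:E))%E :> \bar R.
    by rewrite -EFinD -EFinM; congr EFin; ring.
  rewrite lee_wpmul2l// ?lee_fin// big_split/=; apply: leeD; last first.
    rewrite sumEFin lee_fin big_mkord.
    have -> : \sum_(i < N) (2 ^+ i)^-1 = 2 * (1 - (2 ^+ N)^-1) :> R.
      elim: N => [|N IHN]; first by rewrite big_ord0 expr0 invr1 subrr mulr0.
      rewrite big_ord_recr/= IHN [2 ^+ N.+1]exprS; field.
      by rewrite expf_neq0.
    have h : 0 <= (2 ^+ N)^-1 :> R by rewrite invr_ge0 exprn_ge0.
    by lra.
  rewrite -ge0_integral_sum//; last by move=> j y _; rewrite lee_fin.
  apply: (@le_trans _ _ (\int[Q]_y (6%:E * (t y)%:E))%E).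
    apply: ge0_le_integral => //.
    - by move=> y _; apply: sume_ge0 => j _; rewrite lee_fin.
    - by apply: emeasurable_sum.
    - by apply: measurable_funeM; exact/measurable_EFinP.
    - move=> y _; rewrite sumEFin -EFinM lee_fin big_mkord.
      exact: sum_min_sqr_dyadic_le.
  rewrite ge0_integralZl_EFin//; last 2 first.
  - by move=> y _; rewrite lee_fin.
  - exact/measurable_EFinP.
  by rewrite -[leRHS]mule1 lee_wpmul2l// lee_fin.
apply: filterS ae1 => w [N _ fN].
near=> n.
have nN : (2 ^ N <= n)%N by near: n; exists (2 ^ N)%N.
have n0 : (0 < n)%N by apply: leq_trans nN; rewrite expn_gt0.
have /andP[nlo nhi] := trunc_log_bounds (isT : (1 < 2)%N) n0.
set j := trunc_log 2 n in nlo nhi.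
have Nj : (N <= j)%N by exact: trunc_log_max.
have [_ _ /(_ w) + _] := fP j.+1.
have fj : f j.+1 w < 1 by have := fN j.+1; rewrite /= lte_fin; apply; exact: leqW.
move=> /(_ fj) h.
apply: (@le_trans _ _ (\sum_(i < 2 ^ j.+1) t (Y i w))).
  rewrite (big_ord_widen _ (fun i => t (Y i w)) (ltnW nhi)) big_mkcond/=.
  by apply: ler_sum => i _; case: ifP.
apply: le_trans h _; rewrite exprS mulrA (_ : 4 * 2 = 8 :> R); last by ring.
by rewrite ler_wpM2l// -natrX ler_nat.
Unshelve. all: by end_near. Qed.

(** [u] is split into its truncation at a level [M], to which the bounded law applies, and [e * t]
    with [t] of mean at most 1. The latter sums to at most [8 * e * n], so [e = (c - m) / 9] makes
    [(m + e) + 8 * e] equal to [c]. *)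
Lemma lln_upper (u : S -> R) (c : R) :
  measurable_fun setT u -> (forall y, 0 <= u y) -> (\int[Q]_y (u y)%:E < c%:E)%E ->
  {ae P, forall w, \forall n \near \oo, \sum_(i < n) u (Y i w) <= c * n%:R}.
Proof.
move=> mu u0 uc.
have muE : measurable_fun setT (fun y => (u y)%:E : \bar R) by exact/measurable_EFinP.
have iu0 : (0 <= \int[Q]_y (u y)%:E)%E.
  by apply: integral_ge0 => y _; rewrite lee_fin.
have iufin : (\int[Q]_y (u y)%:E)%E \is a fin_num.
  by rewrite ge0_fin_numE// (lt_trans uc)// ltry.
pose m := fine (\int[Q]_y (u y)%:E)%E.
have mE : (\int[Q]_y (u y)%:E)%E = m%:E by rewrite fineK.
have mc : m < c by rewrite -lte_fin -mE.
pose e := (c - m) / 9; have e0 : 0 < e by rewrite divr_gt0// subr_gt0.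
have min0 M y : (0 <= (Num.min (u y) M%:R)%:E)%E by rewrite lee_fin le_min u0 ler0n.
have mmin (M : nat) : measurable_fun setT (fun y => Num.min (u y) M%:R).
  exact: measurable_minr.
have mminE (M : nat) : measurable_fun setT (fun y => (Num.min (u y) M%:R)%:E : \bar R).
  exact/measurable_EFinP.
have [M Me] : exists M : nat, (m%:E - e%:E < \int[Q]_y (Num.min (u y) M%:R)%:E)%E.
  have : (\int[Q]_y (Num.min (u y) n%:R)%:E)%E @[n --> \oo] -->
      (\int[Q]_y limn (fun n => (Num.min (u y) n%:R)%:E))%E.
    apply: cvg_monotone_convergence => //.
    by move=> y _ n n' nn'; rewrite lee_fin le_min2// ler_nat.
  rewrite (eq_integral (fun y => (u y)%:E)) => [|y _]; last first.
    apply: lim_near_cst => //; near=> n.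
    rewrite min_l//; apply: le_trans (ltW (truncnS_gt _)) _.
    by rewrite ler_nat; near: n; exists (Num.truncn (u y)).+1.
  rewrite mE => /fine_cvgP[fin /cvgr_gt/(_ (m - e))].
  rewrite ltrBlDr ltrDl => /(_ e0) gt.
  have [M _ MP] := filterI fin gt.
  exists M; have [/= fM] := MP M (leqnn M).
  by rewrite -EFinB -(fineK fM) lte_fin.
pose t y := (u y - Num.min (u y) M%:R) / e.
have mt : measurable_fun setT t.
  by apply: measurable_funM => //; exact: measurable_funB.
have t0 y : 0 <= t y by rewrite divr_ge0 ?(ltW e0)// subr_ge0 ge_min lexx.
have iminle : (\int[Q]_y (Num.min (u y) M%:R)%:E <= m%:E)%E.
  rewrite -mE; apply: ge0_le_integral => // y _.
  by rewrite lee_fin ge_min lexx.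
have iminfin : (\int[Q]_y (Num.min (u y) M%:R)%:E)%E \is a fin_num.
  by rewrite ge0_fin_numE ?(le_lt_trans iminle)// ?ltry// integral_ge0.
have it1 : (\int[Q]_y (t y)%:E <= 1)%E.
  have : (\int[Q]_y (u y)%:E = \int[Q]_y (Num.min (u y) M%:R)%:E +
      e%:E * \int[Q]_y (t y)%:E)%E.
    rewrite -ge0_integralZl_EFin//; last 3 first.
    - by move=> y _; rewrite lee_fin.
    - exact/measurable_EFinP.
    - exact: ltW.
    rewrite -ge0_integralD//; last 2 first.
    - by move=> y _; rewrite mule_ge0// lee_fin// ltW.
    - by apply: measurable_funeM; exact/measurable_EFinP.
    apply: eq_integral => y _; rewrite -EFinM -EFinD; congr EFin.
    by rewrite /t; field; rewrite gt_eqF.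
  rewrite mE => mE'.
  have it0 : (0 <= \int[Q]_y (t y)%:E)%E.
    by apply: integral_ge0 => y _; rewrite lee_fin.
  move: mE' Me; rewrite -(fineK iminfin).
  case: (\int[Q]_y (t y)%:E)%E it0 => [r|_|//].
    rewrite lee_fin => r0; rewrite -EFinM -!EFinD lte_fin => -[->] h.
    by rewrite lee_fin -(ler_pM2l e0); lra.
  by rewrite gt0_muley ?lte_fin.
have := lln_mean_le1 mt t0 it1.
have bounded : {ae P, forall w, \forall n \near \oo,
    \sum_(i < n) Num.min (u (Y i w)) M%:R <= (m + e) * n%:R}.
  apply: (lln_bounded mY lawY indepY (mmin M) (M := M%:R)).
    by move=> y; rewrite le_min u0 ler0n/= ge_min lexx orbT.
  by apply: le_lt_trans iminle _; rewrite lte_fin ltrDl.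
move: bounded; apply: filterS2 => w; apply: filterS2 => n h1 h2.
have -> : \sum_(i < n) u (Y i w) = \sum_(i < n) Num.min (u (Y i w)) M%:R +
    e * \sum_(i < n) t (Y i w).
  rewrite mulr_sumr -big_split/=; apply: eq_bigr => i _.
  by rewrite /t; field; rewrite gt_eqF.
have : e * \sum_(i < n) t (Y i w) <= e * (8 * n%:R) by rewrite ler_pM2l.
have : c * n%:R = (m + e) * n%:R + e * (8 * n%:R) by rewrite /e; field.
by lra.
Unshelve. all: by end_near. Qed.

(** The upper law is applied to the nonnegative function [max (M - ln V) 0]. Cutting at 0 adds
    [ln V - M] where it is positive, which is at most [expR (- M) * V] and therefore has a small
    mean for large [M]. *)
Lemma prod_lower (V : S -> R) (c : R) :
  measurable_fun setT V -> (forall y, 0 <= V y) ->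
  (\int[Q]_y (V y)%:E < +oo)%E ->
  (\int[Q]_y (- lne (V y)%:E) < c%:E)%E ->
  {ae P, forall w, \forall n \near \oo,
    expR (- (c * n%:R)) <= \prod_(i < n) V (Y i w)}.
Proof.
move=> mV V0 Vfin Vc.
have mVE : measurable_fun setT (fun y => (V y)%:E : \bar R) by exact/measurable_EFinP.
have mlV := measurable_lne_EFin mV.
pose W y := (- lne (V y)%:E)%E.
have mW : measurable_fun setT W by exact: measurableT_comp.
have iV : Q.-integrable setT (fun y => (V y)%:E).
  by apply: integrable_ge0 => // y; rewrite lee_fin.
have iW : Q.-integrable setT W.
  by apply: integrable_oppe_lne => //; apply: lt_trans Vc _; rewrite ltry.
have Vpos : {ae Q, forall y, 0 < V y}.
  apply: filterS (integrable_ae measurableT iW) => y /(_ Logic.I).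
  rewrite lt_neqAle V0 andbT; apply: contraTneq => Vy.
  by rewrite /W -Vy le0_lneNy.
have iWfin := integrable_fin_num measurableT iW.
pose b := fine (\int[Q]_y W y)%E; pose C := fine (\int[Q]_y (V y)%:E)%E.
have bE : (\int[Q]_y W y = b%:E)%E by rewrite fineK.
have CE : (\int[Q]_y (V y)%:E = C%:E)%E by rewrite fineK// (integrable_fin_num measurableT iV).
have bc : b < c by rewrite -lte_fin -bE.
have C0 : 0 <= C by rewrite fine_ge0// integral_ge0// => y _; rewrite lee_fin.
(* Since [M * expR (- M) <= 1], this choice makes the truncation error [expR (- M) * C] at most half
   of the gap [c - b]. *)
pose M := C / ((c - b) / 2).
have M0 : 0 <= M by rewrite divr_ge0// divr_ge0// ltW// subr_gt0.
have MC : expR (- M) * C < c - b.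
  have cb0 : 0 < (c - b) / 2 by rewrite divr_gt0// subr_gt0.
  have : (1 + M) * expR (- M) <= 1.
    by rewrite expRN ler_pdivrMr ?expR_gt0// mul1r expR_ge1Dx.
  have : C = M * ((c - b) / 2) by rewrite /M divfK// gt_eqF.
  have := expR_gt0 (- M); set E := expR (- M) => E0 -> h.
  suff : E * M * ((c - b) / 2) <= 1 * ((c - b) / 2) by lra.
  by rewrite ler_pM2r//; lra.
pose u y := Num.max (M - ln (V y)) 0.
have u0 y : 0 <= u y by rewrite le_max lexx orbT.
have mu : measurable_fun setT u.
  apply: measurable_maxr => //; apply: measurable_funB => //.
  exact: measurableT_comp.
pose g y := (M%:E + (W y + (expR (- M))%:E * (V y)%:E))%E.
have mg : measurable_fun setT g.
  apply: emeasurable_funD => //; apply: emeasurable_funD => //.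
  exact: measurable_funeM.
have ug y : ((u y)%:E <= g y)%E.
  have := V0 y; rewrite le_eqVlt => /predU1P[Vy|Vy0].
    by rewrite /g /W -Vy le0_lneNy//= mule0 adde0 addey// leey.
  rewrite /g /W lne_EFin// -EFinN -EFinM -!EFinD lee_fin /u ge_max.
  have h : ln (V y) - M <= expR (- M) * V y.
    have -> : ln (V y) - M = ln (expR (- M) * V y).
      by rewrite lnM ?posrE ?expR_gt0// expRK addrC.
    by rewrite ltW// ln_sublinear// mulr_gt0// expR_gt0.
  have : 0 <= expR (- M) * V y by rewrite mulr_ge0// expR_ge0.
  by move=> h'; apply/andP; split; lra.
have iu : (\int[Q]_y (u y)%:E < (M + c)%:E)%E.
  apply: (@le_lt_trans _ _ (\int[Q]_y g y)%E).
    apply: ge0_le_integral => //.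
      by move=> y _; rewrite lee_fin.
    exact/measurable_EFinP.
  have iVE : Q.-integrable setT (fun y => (expR (- M))%:E * (V y)%:E)%E.
    exact: integrableZl.
  rewrite integralD//; last 2 first.
  - exact: finite_measure_integrable_cst.
  - exact: integrableD.
  rewrite integralD// integral_cst//= probability_setT mule1 integralZl//.
  by rewrite bE CE -EFinM -!EFinD lte_fin; lra.
have := ae_law Vpos.
have := lln_upper mu u0 iu.
apply: filterS2 => w + Vw; apply: filterS => n h.
have -> : \prod_(i < n) V (Y i w) = expR (\sum_(i < n) ln (V (Y i w))).
  by rewrite expR_sum; apply: eq_bigr => i _; rewrite lnK// posrE.
rewrite ler_expR.
have : \sum_(i < n) (M - ln (V (Y i w))) <= (M + c) * n%:R.
  by apply: le_trans h; apply: ler_sum => i _; rewrite le_max lexx.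
by rewrite sumrB sumr_const card_ord -mulr_natr; lra.
Qed.

End lln_upper.

(** * Uniform power bound for convex families *)

Section Rintegral_extra.
Context {d} {X : measurableType d} {R : realType}.
Variable Q : probability X R.

Lemma le_integrable_EFin (f g : X -> R) : measurable_fun setT f ->
  (forall x, `|f x| <= g x) -> Q.-integrable setT (EFin \o g) ->
  Q.-integrable setT (EFin \o f).
Proof.
move=> mf fg; apply: le_integrable => //; first exact/measurable_EFinP.
move=> x _ /=; rewrite lee_fin; apply: le_trans (fg x) _; exact: ler_norm.
Qed.

Lemma integrable_EFinD (f g : X -> R) : Q.-integrable setT (EFin \o f) ->
  Q.-integrable setT (EFin \o g) ->
  Q.-integrable setT (EFin \o (fun x => f x + g x)).
Proof. exact: integrableD. Qed.

Lemma integrable_EFinZ (c : R) (f : X -> R) : Q.-integrable setT (EFin \o f) ->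
  Q.-integrable setT (EFin \o (fun x => c * f x)).
Proof. exact: integrableZl. Qed.

Lemma integrable_EFin_cst (c : R) : Q.-integrable setT (EFin \o (fun=> c)).
Proof. exact: finite_measure_integrable_cst. Qed.

Lemma measurable_of_integrable (f : X -> R) : Q.-integrable setT (EFin \o f) ->
  measurable_fun setT f.
Proof. by move=> /(measurable_int Q)/measurable_EFinP. Qed.

Lemma integrable_EFin_bounded (M : R) (f : X -> R) : measurable_fun setT f ->
  (forall x, `|f x| <= M) -> Q.-integrable setT (EFin \o f).
Proof. move=> mf fM; exact: le_integrable_EFin mf fM (integrable_EFin_cst M). Qed.

Lemma Rintegral_cst_prob (c : R) : \int[Q]_x c = c.
Proof. by rewrite Rintegral_cst//= probability_setT/= mulr1. Qed.

Lemma EFin_Rintegral (f : X -> R) : Q.-integrable setT (EFin \o f) ->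
  ((\int[Q]_x f x)%:E = \int[Q]_x (f x)%:E)%E.
Proof. by move=> fi; rewrite /Rintegral fineK//; exact: integrable_fin_num. Qed.

Lemma ae_le_Rintegral (f g : X -> R) : Q.-integrable setT (EFin \o f) ->
  Q.-integrable setT (EFin \o g) -> {ae Q, forall x, f x <= g x} ->
  \int[Q]_x f x <= \int[Q]_x g x.
Proof.
move=> fi gi fg.
have mf := measurable_of_integrable fi; have mg := measurable_of_integrable gi.
(* The maximum lies above [f] everywhere and equals [g] almost everywhere. *)
have mi : Q.-integrable setT (EFin \o (fun x => Num.max (f x) (g x))).
  apply: (@le_integrable_EFin _ (fun x => `|f x| + `|g x|)).
  - exact: measurable_maxr.
  - by move=> x; case: (leP (f x) (g x)) => _; rewrite ?lerDl ?lerDr.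
  - by apply: integrable_EFinD; exact: integrable_norm.
apply: (@le_trans _ _ (\int[Q]_x Num.max (f x) (g x))).
  by apply: le_Rintegral => // x _; rewrite le_max lexx.
rewrite le_eqVlt; apply/orP; left; apply/eqP.
rewrite /Rintegral; congr fine; apply: ae_eq_integral => //.
- exact: measurable_int mi.
- exact: measurable_int gi.
- by apply: filterS fg => x fgx _ /=; rewrite max_r.
Qed.

End Rintegral_extra.

Lemma ln_addr_norm_le {R : realType} (x c : R) : 0 <= x -> 0 < c <= 1 ->
  `|ln (x + c)| <= x + c^-1.
Proof.
move=> x0 /andP[c0 c1].
have ci : 0 < c^-1 by rewrite invr_gt0.
have xc : 0 < x + c by lra.
rewrite ler_norml; apply/andP; split; last first.
  have /ltW := ln_sublinear xc.
  have := le_ln1Dx (x := x + c - 1); rewrite (_ : 1 + (x + c - 1) = x + c); last by ring.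
  by move=> h _; apply: le_trans (h _) _; lra.
have : ln c^-1 <= c^-1 by rewrite ltW// ln_sublinear.
rewrite lnV ?posrE// => h.
have : ln c <= ln (x + c) by rewrite ler_ln ?posrE//; lra.
by lra.
Qed.

(* Second order bound of [x ^ a = exp (a ln x)] around [a = 0]. *)
Lemma powR_le_quad {R : realType} (x c a : R) : 0 < c <= x -> c <= 1 ->
  0 <= a <= 2^-1 ->
  x `^ a <= 1 + a * ln x + a ^+ 2 * (16 * x + 2 * ln c ^+ 2).
Proof.
move=> /andP[c0 cx] c1 /andP[a0 a2].
have x0 : 0 < x by lra.
rewrite /powR gt_eqF//; set y := ln x.
have xE : x = expR y by rewrite /y lnK.
have lcy : ln c <= y by rewrite /y ler_ln ?posrE.
have lc0 : ln c <= 0 by rewrite ln_le0.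
have aa0 : 0 <= a ^+ 2 by rewrite sqr_ge0.
have [y0|y0] := leP y 0.
  apply: le_trans (expR_le_quad _) _; first by nra.
  rewrite exprMn lerD2l mulrCA ler_wpM2l//.
  have : y ^+ 2 <= ln c ^+ 2 by nra.
  by lra.
apply: le_trans (expR_le_quad_ge0 _) _; first by rewrite mulr_ge0// ltW.
rewrite lerD2l exprMn -mulrA ler_wpM2l//.
(* Each factor [y] costs at most [4 * expR (y / 4)], and [a <= 1/2] leaves [expR (y / 2)]; the
   product of the exponentials is [expR y = x]. *)
suff : y ^+ 2 * expR (a * y) <= 16 * x by have := sqr_ge0 (ln c); lra.
have h1 : y / 4 <= expR (y / 4) by have := expR_ge1Dx (y / 4); lra.
have h2 : y ^+ 2 <= 16 * (expR (y / 4) * expR (y / 4)).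
  have h3 : 0 <= y / 4 by rewrite divr_ge0// ltW.
  by have := ler_pM h3 h3 h1 h1; lra.
rewrite -expRD in h2.
have h3 : expR (a * y) <= expR (y / 2) by rewrite ler_expR; nra.
rewrite xE (_ : expR y = expR (y / 4 + y / 4) * expR (y / 2)); last first.
  by rewrite -expRD; congr expR; field.
by rewrite mulrA ler_pM ?sqr_ge0 ?expR_ge0.
Qed.

Section uniform_power.
Context {d} {X : measurableType d} {R : realType}.
Variables (Q : probability X R) (VV : set (X -> R)) (C : R).
Hypotheses (mVV : forall V, VV V -> measurable_fun setT V)
  (VV0 : forall V, VV V -> forall y, 0 <= V y)
  (VVC : forall V, VV V -> (\int[Q]_y (V y)%:E <= C%:E)%E).

Lemma family_integrable V : VV V -> Q.-integrable setT (EFin \o V).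
Proof.
move=> VVV; apply: integrable_ge0.
- by apply/measurable_EFinP; exact: mVV.
- by move=> y; rewrite lee_fin VV0.
- by rewrite (le_lt_trans (VVC VVV))// ltry.
Qed.

Lemma family_Rintegral_le V : VV V -> \int[Q]_y V y <= C.
Proof.
by move=> VVV; rewrite -lee_fin EFin_Rintegral ?VVC//; exact: family_integrable.
Qed.

Lemma family_ln_integrable V c : VV V -> 0 < c <= 1 ->
  Q.-integrable setT (EFin \o (fun y => ln (V y + c))).
Proof.
move=> VVV c01; apply: (@le_integrable_EFin _ _ _ _ _ (fun y => V y + c^-1)).
- apply: measurableT_comp => //; apply: measurable_funD => //; exact: mVV.
- by move=> y; exact: ln_addr_norm_le (VV0 VVV y) c01.
- apply: integrable_EFinD; [exact: family_integrable|exact: integrable_EFin_cst].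
Qed.

Lemma power_of_ln_bound (c e : R) : 0 < c <= 1 -> 0 < e ->
  (forall V, VV V -> \int[Q]_y ln (V y + c) <= - e) ->
  exists2 a : R, 0 < a & forall V, VV V -> (\int[Q]_y (V y `^ a)%:E <= 1)%E.
Proof.
move=> /andP[c0 c1] e0 lnVV.
pose K := 16 * (`|C| + 1) + 2 * ln c ^+ 2.
have K0 : 0 < K.
  by have := normr_ge0 C; have := sqr_ge0 (ln c); rewrite /K; lra.
(* [K] bounds the integrated second order remainder. [a * K <= e] lets the linear gain [a * e]
   absorb [a ^+ 2 * K], and the summand [2 * e] keeps [a] at most 1/2. *)
pose a := e / (K + 2 * e).
have a0 : 0 < a by rewrite divr_gt0//; lra.
have aK : a * (K + 2 * e) = e by rewrite /a divfK// gt_eqF//; lra.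
have a2 : a <= 2^-1 by nra.
have aKe : a * K <= e by nra.
exists a => // V VVV.
have iV := family_integrable VVV.
have ilnV := family_ln_integrable VVV (introT andP (conj c0 c1)).
pose g y := (1 + a ^+ 2 * (16 * c + 2 * ln c ^+ 2)) + (a * ln (V y + c) + (a ^+ 2 * 16) * V y).
have Vg y : V y `^ a <= g y.
  apply: (@le_trans _ _ ((V y + c) `^ a)).
    have V0 := VV0 VVV y.
    by apply: ge0_ler_powR; rewrite ?nnegrE; lra.
  apply: le_trans (@powR_le_quad _ (V y + c) c a _ c1 _) _.
  - by rewrite c0 lerDr VV0.
  - by rewrite (ltW a0).
  - by rewrite /g; lra.
have i1 := integrable_EFinZ a ilnV.
have i2 := integrable_EFinZ (a ^+ 2 * 16) iV.
have ig1 : Q.-integrable setT (EFin \o (fun y => a * ln (V y + c) + (a ^+ 2 * 16) * V y)).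
  exact: integrable_EFinD.
have ig : Q.-integrable setT (EFin \o g).
  by apply: integrable_EFinD => //; exact: integrable_EFin_cst.
have g0 y : 0 <= g y by apply: le_trans (Vg y); exact: powR_ge0.
apply: (@le_trans _ _ (\int[Q]_y (g y)%:E)%E).
  apply: ge0_le_integral => //.
  - by move=> y _; rewrite lee_fin powR_ge0.
  - apply/measurable_EFinP; apply: (measurableT_comp (measurable_powR _)) => //; exact: mVV.
  - exact: measurable_int ig.
  - by move=> y _; rewrite lee_fin.
rewrite -EFin_Rintegral// lee_fin /g RintegralD//=; last exact: integrable_EFin_cst.
rewrite Rintegral_cst_prob.
rewrite RintegralD//= !RintegralZl//=.
have h1 := lnVV V VVV; have h2 := family_Rintegral_le VVV.
have h3 : a * \int[Q]_y ln (V y + c) <= a * (- e) by rewrite ler_pM2l.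
have a20 : 0 <= a ^+ 2 by rewrite sqr_ge0.
have h4 : a ^+ 2 * 16 * \int[Q]_y V y <= a ^+ 2 * 16 * `|C|.
  by apply: ler_wpM2l; [rewrite mulr_ge0|apply: le_trans h2 (ler_norm _)].
have h5 : a ^+ 2 * (16 * c + 2 * ln c ^+ 2) + a ^+ 2 * 16 * `|C| <= a ^+ 2 * K.
  rewrite -[X in X <= _]/(_ + _) (_ : _ + _ = a ^+ 2 * (16 * c + 2 * ln c ^+ 2 + 16 * `|C|)); last by ring.
  by rewrite ler_wpM2l// /K; lra.
have h6 : a ^+ 2 * K <= a * e by rewrite expr2 -mulrA ler_pM2l.
by lra.
Qed.

End uniform_power.

(** The infima of [rho] over the shrinking sets increase to a limit [s]. Two points with [rho] at
    most [s + t j], in a common set whose infimum exceeds [s - t j], cannot have a large [D]: their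
    midpoint would fall below that infimum. This is the Cauchy argument for minimizers of a
    uniformly convex function, with a moving constraint. *)
Lemma near_minimizing_seq {R : realType} (T : Type) (Cs : nat -> set T)
    (rho : T -> R) (D : T -> T -> R) :
  (forall k, Cs k !=set0) -> (forall k l, (k <= l)%N -> Cs l `<=` Cs k) ->
  (forall x, 0 <= rho x <= 1) ->
  (forall k x y, Cs k x -> Cs k y ->
    exists2 z, Cs k z & rho z <= (rho x + rho y) / 2 - D x y) ->
  exists x : nat -> T, forall j, Cs j (x j) /\
    D (x j) (x j.+1) <= 2 * ((2 ^+ j)^-1) ^+ 2.
Proof.
move=> Cs0 Csd rho01 mid.
pose I k := inf (rho @` Cs k).
have rho0 x : 0 <= rho x by case/andP: (rho01 x).
have hlb k : has_lbound (rho @` Cs k) by exists 0 => _ [x _ <-].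
have hinf k : has_inf (rho @` Cs k).
  by split=> //; have [x Cx] := Cs0 k; exists (rho x); exists x.
have Ile k x : Cs k x -> I k <= rho x by move=> Cx; apply: ge_inf => //; exists x.
have I1 k : I k <= 1.
  have [x Cx] := Cs0 k; apply: le_trans (Ile _ _ Cx) _.
  by case/andP: (rho01 x).
have Ind k l : (k <= l)%N -> I k <= I l.
  move=> kl; apply: lb_le_inf; first by case: (hinf l).
  by move=> _ [x Cx <-]; apply: Ile; exact: Csd Cx.
have hsup : has_sup (range I).
  by split; [exists (I 0%N), 0%N|exists 1 => _ [k _ <-]].
pose s := sup (range I).
have Is k : I k <= s by apply: ub_le_sup; [case: hsup|exists k].
pose t j : R := ((2 ^+ j)^-1) ^+ 2.
have t0 j : 0 < t j by rewrite exprn_gt0// invr_gt0 exprn_gt0.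
have tS j : t j.+1 <= t j.
  rewrite /t [2 ^+ j.+1]exprS invfM exprMn.
  by have := sqr_ge0 ((2 ^+ j)^-1 : R); lra.
have /choice[xk xkP] j : exists z : T * nat,
    [/\ (j <= z.2)%N, Cs z.2 z.1, s - t j < I z.2 & rho z.1 <= s + t j].
  have [_ [k _ <-] sk] := sup_adherent (t0 j) hsup.
  have [_ [x Cx <-] Ix] := inf_adherent (t0 j) (hinf (maxn j k)).
  exists (x, maxn j k); split => //=; first exact: leq_maxl.
    by apply: lt_le_trans sk _; apply: Ind; exact: leq_maxr.
  by have := Is (maxn j k); move: (ltW Ix); rewrite /I; lra.
exists (fun j => (xk j).1) => j.
have [jk Cx sx rx] := xkP j; have [jk' Cy sy ry] := xkP j.+1.
split; first exact: Csd Cx.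
have tj := tS j.
(* By nesting both points lie in the set of smaller index, whose infimum is still above
   [s - t j]. *)
pose k := minn (xk j).2 (xk j.+1).2.
have sk : s - t j < I k.
  by rewrite /k /minn; case: ifP => // _; apply: le_lt_trans sy; lra.
have [|| z Cz rz] := mid k (xk j).1 (xk j.+1).1.
- by apply: Csd Cx; exact: geq_minl.
- by apply: Csd Cy; exact: geq_minr.
have := Ile _ _ Cz; rewrite -/(t j).
by lra.
Qed.

(** * Selecting an almost surely convergent sequence of near minimizers *)

Section ae_convergence.
Context {d} {X : measurableType d} {R : realType}.
Variable Q : probability X R.

(** By [|x| <= (2 ^+ j)^-1 + 2 ^+ j * x ^+ 2], the squared bound of order [4 ^- j] gives first
    moments of the increments of order [2 ^- j]. These are summable, so the increments form an
    absolutely convergent series almost everywhere. *)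
Lemma ae_cvg_of_fast_L2 (r : nat -> X -> R) (K : R) : 0 <= K ->
  (forall j, measurable_fun setT (r j)) ->
  (forall j, (\int[Q]_y ((r j y - r j.+1 y) ^+ 2)%:E <=
     (K * ((2 ^+ j)^-1) ^+ 2)%:E)%E) ->
  {ae Q, forall y, cvgn (fun j => r j y)}.
Proof.
move=> K0 mr rK.
have mdiff j : measurable_fun setT (fun y => r j y - r j.+1 y).
  exact: measurable_funB.
have mabs j : measurable_fun setT (fun y => `|r j y - r j.+1 y|%:E : \bar R).
  by apply/measurable_EFinP; exact: measurableT_comp.
have msq j : measurable_fun setT (fun y => ((r j y - r j.+1 y) ^+ 2)%:E : \bar R).
  by apply/measurable_EFinP; exact: measurable_funX.
have pow0 j : 0 < 2 ^+ j :> R by rewrite exprn_gt0.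
have absle j : (\int[Q]_y `|r j y - r j.+1 y|%:E <= ((K + 1) * (2^-1) ^+ j)%:E)%E.
  apply: (@le_trans _ _ (\int[Q]_y ((2 ^+ j)^-1%:E +
      (2 ^+ j)%:E * ((r j y - r j.+1 y) ^+ 2)%:E))%E).
    apply: ge0_le_integral => //.
    - by apply: emeasurable_funD => //; exact: measurable_funeM.
    - move=> y _; rewrite -EFinM -EFinD lee_fin.
      set x := r j y - r j.+1 y; set p := 2 ^+ j.
      have p0 : 0 < p := pow0 j.
      have : 0 <= p * (`|x| - p^-1 / 2) ^+ 2 by rewrite mulr_ge0 ?sqr_ge0// ltW.
      rewrite (_ : p * (`|x| - p^-1 / 2) ^+ 2 = p * `|x| ^+ 2 - `|x| + p^-1 / 4); last first.
        by field; rewrite gt_eqF.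
      rewrite real_normK ?num_real//.
      have pV0 : 0 < p^-1 by rewrite invr_gt0.
      by lra.
  rewrite ge0_integralD//; last 2 first.
  - by move=> y _; rewrite mule_ge0// lee_fin ?sqr_ge0// ltW.
  - exact: measurable_funeM.
  rewrite integral_cst//= probability_setT mule1 ge0_integralZl_EFin//; last first.
    by move=> y _; rewrite lee_fin sqr_ge0.
  apply: (@le_trans _ _ ((2 ^+ j)^-1%:E + (2 ^+ j)%:E * (K * ((2 ^+ j)^-1) ^+ 2)%:E)%E).
    by rewrite leeD2l// lee_wpmul2l// lee_fin ltW.
  rewrite -EFinM -EFinD lee_fin [2^-1 ^+ j]exprVn le_eqVlt; apply/orP; left; apply/eqP.
  by field; rewrite gt_eqF.
have : {ae Q, forall y, (\sum_(j <oo) `|r j y - r j.+1 y|%:E < +oo)%E}.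
  apply: ae_lty.
  - by apply: ge0_emeasurable_sum => // j y _ _; rewrite lee_fin.
  - by move=> y; apply: nneseries_ge0 => j _ _; rewrite lee_fin.
  rewrite integral_nneseries//.
  apply: (@le_lt_trans _ _ (\sum_(j <oo) ((K + 1)%:E * ((2^-1) ^+ j)%:E))%E).
    apply: lee_nneseries => j _; first by move=> _; apply: integral_ge0 => y _; rewrite lee_fin.
    by rewrite -EFinM.
  rewrite nneseriesZl; last by move=> j _; rewrite lee_fin exprn_ge0// invr_ge0.
  apply: lte_mul_pinfty; rewrite ?lee_fin ?addr_ge0//.
  by apply: geometric_nneseries_lty; lra.
apply: filterS => y yoo.
pose u j := r j.+1 y - r j y.
have cu : cvgn (series u).
  apply: normed_cvg; apply: nondecreasing_is_cvgn.
    by apply: nondecreasing_series => n _ _ /=.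
  exists (fine (\sum_(j <oo) `|r j y - r j.+1 y|%:E)%E) => _ [n _ <-].
  rewrite -lee_fin fineK; last first.
    by rewrite ge0_fin_numE// nneseries_ge0// => j _ _; rewrite lee_fin.
  apply: le_trans (nneseries_lim_ge n _); last by move=> j _ _; rewrite lee_fin.
  by rewrite sumEFin lee_fin /series/= ler_sum// => j _; rewrite distrC.
rewrite (_ : (fun j => r j y) = (fun j => series u j + r 0%N y)); last first.
  by apply/funext => j; rewrite /series/= telescope_sumr// subrK.
by apply: is_cvgD => //; exact: is_cvg_cst.
Qed.

End ae_convergence.

Section limit.
Context {d} {X : measurableType d} {R : realType}.
Variables (Q : probability X R) (VV : set (X -> R)) (C : R).
Hypotheses (mVV : forall V, VV V -> measurable_fun setT V)
  (VV0 : forall V, VV V -> forall y, 0 <= V y)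
  (VVC : forall V, VV V -> (\int[Q]_y (V y)%:E <= C%:E)%E)
  (mixVV : forall (w : nat -> R) (V : nat -> X -> R), (forall n, 0 <= w n) ->
    (\sum_(n <oo) (w n)%:E = 1)%E -> (forall n, VV (V n)) ->
    exists2 g, VV g &
      {ae Q, forall y n, \sum_(i < n) w i * V i y <= g y}).

Lemma family_midpoint V W : VV V -> VV W -> exists2 g, VV g &
  {ae Q, forall y, (V y + W y) / 2 <= g y}.
Proof.
move=> VVV VVW.
have [||| g VVg gP] := mixVV (w := fun n => if (n < 2)%N then 2^-1 else 0)
  (V := fun n => if n == 0%N then V else W).
- by move=> n; case: ifP => // _; rewrite invr_ge0.
- apply: lim_near_cst => //; near=> n.
  rewrite (big_cat_nat (n := 2%N))//=; last by near: n; exists 2%N.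
  rewrite [X in (_ + X)%E]big_nat_cond [X in (_ + X)%E]big1; last first.
    by move=> i /andP[/andP[i2 _] _]; rewrite ltnNge i2.
  by rewrite adde0 big_nat_recr//= big_nat1/= -EFinD; congr EFin; field.
- by move=> n; case: ifP.
exists g => //; apply: filterS gP => y /(_ 2%N).
by rewrite big_ord_recr/= big_ord1/=; lra.
Unshelve. all: by end_near. Qed.

(** With [a = expR (- (x / 2))] and [b = expR (- (y / 2))], the gap between the mean of [a ^+ 2],
    [b ^+ 2] and [a * b] is [(a - b) ^+ 2 / 2]. As [a + b <= 2], it is at least
    [(a ^+ 2 - b ^+ 2) ^+ 2 / 8]. *)
Lemma expRN_mid_le (x y z : R) : 0 <= x -> 0 <= y -> (x + y) / 2 <= z ->
  expR (- z) <= (expR (- x) + expR (- y)) / 2 - (expR (- x) - expR (- y)) ^+ 2 / 8.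
Proof.
move=> x0 y0 xyz; set a := expR (- (x / 2)); set b := expR (- (y / 2)).
have ax : expR (- x) = a * a by rewrite -expRD; congr expR; field.
have byy : expR (- y) = b * b by rewrite -expRD; congr expR; field.
have : expR (- z) <= a * b by rewrite -expRD ler_expR; lra.
have a0 : 0 <= a by exact: expR_ge0.
have b0 : 0 <= b by exact: expR_ge0.
have a1 : a <= 1 by rewrite /a -[leRHS]expR0 ler_expR; lra.
have b1 : b <= 1 by rewrite /b -[leRHS]expR0 ler_expR; lra.
rewrite ax byy => h.
have h1 : (a + b) ^+ 2 <= 4 by nra.
have h2 := ler_wpM2l (sqr_ge0 (a - b)) h1.
by lra.
Qed.

Variable e : R.
Hypothesis ln_large : forall c : R, 0 < c <= 1 ->
  exists2 V, VV V & - e < \int[Q]_y ln (V y + c).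

(* Strict convexity of [x |-> exp (- x)]: near minimizers of [\int exp (- V)] over
   nested midpoint-convex families are close in L2. *)
Lemma convergent_near_minimizers : exists V : nat -> X -> R,
  (forall j, VV (V j) /\ - e < \int[Q]_y ln (V j y + j.+1%:R^-1)) /\
  {ae Q, forall y, cvgn (fun j => expR (- V j y))}.
Proof.
pose c (k : nat) : R := k.+1%:R^-1.
have c01 k : 0 < c k <= 1 by rewrite invr_gt0 ltr0Sn invf_le1 ?ltr0Sn// ler1n.
(* Nonempty by [ln_large], decreasing in [k] because [c k] is, and stable under midpoints because
   [ln] is concave. *)
pose Cs k := [set V | VV V /\ - e < \int[Q]_y ln (V y + c k)].
have mexp V : VV V -> measurable_fun setT (fun y => expR (- V y)).
  by move=> VVV; apply: measurableT_comp => //; apply: measurableT_comp => //; exact: mVV.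
have iexp V : VV V -> Q.-integrable setT (EFin \o (fun y => expR (- V y))).
  move=> VVV; apply: (@integrable_EFin_bounded _ _ _ _ 1) => [|y]; first exact: mexp.
  by rewrite ger0_norm ?expR_ge0// -expR0 ler_expR oppr_le0 VV0.
pose VVT := {V : X -> R | VV V}.
pose rho (V : VVT) := \int[Q]_y expR (- sval V y).
pose D (V W : VVT) := \int[Q]_y ((expR (- sval V y) - expR (- sval W y)) ^+ 2 / 8).
have iD V W : VV V -> VV W ->
    Q.-integrable setT (EFin \o (fun y => (expR (- V y) - expR (- W y)) ^+ 2 / 8)).
  move=> VVV VVW; apply: (@integrable_EFin_bounded _ _ _ _ 1) => [|y].
    apply: measurable_funM => //; apply: measurable_funX.
    by apply: measurable_funB; exact: mexp.
  rewrite ger0_norm ?divr_ge0 ?sqr_ge0//.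
  have eV : expR (- V y) <= 1 by rewrite -expR0 ler_expR oppr_le0 VV0.
  have eW : expR (- W y) <= 1 by rewrite -expR0 ler_expR oppr_le0 VV0.
  have eV0 := expR_ge0 (- V y); have eW0 := expR_ge0 (- W y).
  by nra.
have iln V k (VVV : VV V) := family_ln_integrable mVV VV0 VVC VVV (c01 k).
have [|k l kl V [VVV lnV]|V|k V W [VVV lnV] [VVW lnW]|V VP] :=
    @near_minimizing_seq R VVT (fun k => [set V | Cs k (sval V)]) rho D.
- by move=> k; have [V VVV lnV] := ln_large (c01 k); exists (exist _ V VVV).
- split => //; apply: lt_le_trans lnV _; apply: le_Rintegral => //; try exact: iln.
  move=> y _; have V0 := VV0 VVV y; have /andP[cl0 _] := c01 l; have /andP[ck0 _] := c01 k.
  have lk : c l <= c k by rewrite lef_pV2 ?posrE ?ltr0Sn// ler_nat ltnS.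
  by rewrite ler_ln ?posrE; lra.
- apply/andP; split; first by apply: Rintegral_ge0 => y _; exact: expR_ge0.
  rewrite -[leRHS](Rintegral_cst_prob Q); apply: le_Rintegral => //.
  + exact: iexp (svalP V).
  + exact: integrable_EFin_cst.
  + by move=> y _; rewrite -expR0 ler_expR oppr_le0 VV0//; exact: svalP.
- have [g VVg gP] := family_midpoint VVV VVW.
  exists (exist _ g VVg).
    split => //=.
    have i1 := integrable_EFinZ 2^-1 (iln _ k VVV).
    have i2 := integrable_EFinZ 2^-1 (iln _ k VVW).
    apply: (@lt_le_trans _ _ (\int[Q]_y (2^-1 * ln (sval V y + c k) + 2^-1 * ln (sval W y + c k)))).
      rewrite RintegralD//= RintegralZl//=; last exact: iln.
      by rewrite RintegralZl//=; [lra|exact: iln].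
    apply: ae_le_Rintegral; [exact: integrable_EFinD|exact: iln|].
    apply: filterS gP => y gy.
    have V0 := VV0 VVV y; have W0 := VV0 VVW y; have /andP[ck0 _] := c01 k.
    set a := sval V y + c k; set b := sval W y + c k.
    have a0 : 0 < a by rewrite /a; lra.
    have b0 : 0 < b by rewrite /b; lra.
    apply: (@le_trans _ _ (ln ((a + b) / 2))); last by rewrite ler_ln ?posrE /a /b; lra.
    have : ln a + ln b <= ln ((a + b) / 2) + ln ((a + b) / 2).
      have ab0 : 0 < (a + b) / 2 by lra.
      rewrite -!lnM ?posrE// ler_ln ?posrE ?(mulr_gt0 a0 b0) ?(mulr_gt0 ab0 ab0)//.
      rewrite -subr_ge0 (_ : _ - _ = ((a - b) / 2) ^+ 2) ?sqr_ge0//; by field.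
    by lra.
  rewrite /rho /D/=.
  have i1 := integrable_EFinZ 2^-1 (iexp _ VVV).
  have i2 := integrable_EFinZ 2^-1 (iexp _ VVW).
  have i3 := integrable_EFinZ (-1) (iD _ _ VVV VVW).
  apply: (@le_trans _ _ (\int[Q]_y ((2^-1 * expR (- sval V y) + 2^-1 * expR (- sval W y)) +
      -1 * ((expR (- sval V y) - expR (- sval W y)) ^+ 2 / 8)))).
    apply: ae_le_Rintegral; first exact: iexp.
      by apply: integrable_EFinD => //; exact: integrable_EFinD.
    apply: filterS gP => y gy.
    by have := expRN_mid_le (VV0 VVV y) (VV0 VVW y) gy; lra.
  have i12 := integrable_EFinD i1 i2.
  rewrite RintegralD//= RintegralD//= !RintegralZl//=; first by lra.
  - exact: iD.
  - exact: iexp.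
  - exact: iexp.
exists (fun j => sval (V j)); split; first by move=> j; have [] := VP j.
(* 16 is the 8 in the denominator of [D] times the 2 of [near_minimizing_seq]. *)
apply: (@ae_cvg_of_fast_L2 _ _ _ Q _ 16) => // [j|j].
  by apply: mexp; exact: svalP.
have [_] := VP j; rewrite /D.
have iDj := iD _ _ (svalP (V j)) (svalP (V j.+1)).
move=> h; have := iDj; move=> /(integrable_EFinZ 8) i8.
rewrite (eq_integral (fun y => (8 * ((expR (- sval (V j) y) - expR (- sval (V j.+1) y)) ^+ 2 / 8))%:E)).
  by rewrite -EFin_Rintegral// lee_fin RintegralZl//; lra.
by move=> y _; congr EFin; field.
Qed.

End limit.

(** * Lower limits, and the logarithm along a convergent sequence *)

Section limn_einf_extra.
Context {R : realType}.
Local Open Scope ereal_scope.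

Lemma limn_einf_le (u : nat -> \bar R) (M : \bar R) :
  (forall n, u n <= M) -> limn_einf u <= M.
Proof.
move=> uM; rewrite limn_einf_lim; apply: lime_le; first exact: is_cvg_einfs.
apply: nearW => n; apply: le_trans (uM n).
by apply: ereal_inf_lbound; exists n => /=.
Qed.

Lemma limn_einf_lt_frequently (u : nat -> \bar R) (M : \bar R) :
  limn_einf u < M -> forall N, exists2 k, (N <= k)%N & u k < M.
Proof.
move=> uM N; apply: contrapT => h; move: uM; apply/negP; rewrite -leNgt.
rewrite limn_einf_lim; apply: lime_ge; first exact: is_cvg_einfs.
near=> n; apply: le_ereal_inf_tmp => _ [k /= nk <-].
rewrite leNgt; apply/negP => ukM; apply: h; exists k => //.
by apply: leq_trans nk; near: n; exists N.
Unshelve. all: by end_near. Qed.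

Lemma measurable_limn_einf {d} {X : measurableType d} (u : nat -> X -> \bar R) :
  (forall n, measurable_fun setT (u n)) ->
  measurable_fun setT (fun x => limn_einf (u ^~ x)).
Proof.
move=> mu; rewrite /limn_einf; apply: measurableT_comp => //.
by apply: measurable_fun_limn_esup => n; exact: measurableT_comp.
Qed.

Lemma cvg_limn_einf (u : nat -> \bar R) (l : \bar R) :
  u @ \oo --> l -> limn_einf u = l.
Proof. by move=> /cvg_limn_einf_sup[]. Qed.

End limn_einf_extra.

(** The slope [t] can be as small as desired, at the price of the constant [t - ln t]. A small
    multiple of [V] is thus enough to bound [- ln V] from below. *)
Lemma ln_addr1_le {R : realType} (t x : R) : 0 < t -> 0 <= x ->
  ln (x + 1) <= t * x + (t - ln t).
Proof.
move=> t0 x0; have x1 : 0 < x + 1 by lra.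
have tx : 0 < t * (x + 1) by rewrite mulr_gt0.
have -> : ln (x + 1) = ln (t * (x + 1)) - ln t by rewrite lnM ?posrE// addrAC subrr add0r.
by have := ln_sublinear tx; lra.
Qed.

Section limit_point.
Context {R : realType}.
Variables (t : R) (v : nat -> R).
Hypotheses (t0 : 0 < t) (v0 : forall k, 0 <= v k).
Let K := t - ln t.
Let psi k := t * v k - ln (v k + k.+1%:R^-1) + K.

Let c0 k : 0 < k.+1%:R^-1 :> R. Proof. by rewrite invr_gt0 ltr0Sn. Qed.
Let c1 k : k.+1%:R^-1 <= 1 :> R. Proof. by rewrite invf_le1 ?ltr0Sn// ler1n. Qed.

Let ln_le k : ln (v k + k.+1%:R^-1) <= ln (v k + 1).
Proof.
by rewrite ler_ln ?posrE ?lerD2l ?c1// ltr_wpDl// v0.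
Qed.

(** The penalty [t * v k] and the constant [K] are there for this bound, which makes Fatou
    applicable to [- ln]. *)
Lemma penalized_ln_ge0 k : 0 <= psi k.
Proof. by have := ln_addr1_le t0 (v0 k); have := ln_le k; rewrite /psi /K; lra. Qed.

(** Convergence of [expR (- v k)] leaves three cases for the limit of [v]: infinite, 0, or positive
    and finite. A finite lower limit of [psi] excludes the first, where the linear penalty wins over
    the logarithm, and the second, where [- ln] blows up. *)
Lemma penalized_ln_cvg : cvgn (fun k => expR (- v k)) ->
  (limn_einf (fun k => (psi k)%:E) < +oo)%E ->
  exists l : R, [/\ 0 < l, v @ \oo --> l &
    limn_einf (fun k => (psi k)%:E) = (t * l - ln l + K)%:E].
Proof.
move=> /cvg_ex[r /= cr] psioo.
have [M psiM] : exists M : R, (limn_einf (fun k => (psi k)%:E) < M%:E)%E.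
  case: limn_einf psioo => [s _|//|_]; last by exists 0; rewrite ltNyr.
  by exists (s + 1); rewrite lte_fin ltrDl.
have freq := limn_einf_lt_frequently psiM.
have t2 : 0 < t / 2 by rewrite divr_gt0.
(* The logarithm is bounded with slope [t / 2], so that half of the penalty remains to bound
   [v k]. *)
pose B := (M - K + (t / 2 - ln (t / 2))) / (t / 2).
have vB k : psi k < M -> v k <= B.
  move=> h; rewrite /B ler_pdivlMr//.
  by have := ln_addr1_le t2 (v0 k); have := ln_le k; rewrite /psi in h; lra.
have r0 : 0 < r.
  apply: lt_le_trans (expR_gt0 (- B)) _; rewrite leNgt; apply/negP => rB.
  have /= [N _ NP] := cvgr_lt r cr _ rB.
  have [k Nk] := freq N; rewrite lte_fin => /vB vkB.
  by have := NP k Nk; rewrite /= ltr_expR ltrN2 ltNge vkB.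
have cv : v @ \oo --> - ln r.
  rewrite (_ : v = (fun k => - ln (expR (- v k)))); last first.
    by apply/funext => k; rewrite expRK opprK.
  by apply: cvgN; apply: continuous_cvg => //; exact: continuous_ln.
have cvc : (fun k => v k + k.+1%:R^-1) @ \oo --> - ln r.
  by rewrite -[- ln r]addr0; apply: cvgD => //; exact: cvg_harmonic.
have l0 : 0 < - ln r.
  apply: lt_le_trans (expR_gt0 (K - M)) _; rewrite leNgt; apply/negP => rB.
  have /= [N _ NP] := cvgr_lt _ cvc _ rB.
  have [k Nk] := freq N; rewrite lte_fin /psi => h.
  have := NP k Nk; rewrite /= => h'.
  have vc0 : 0 < v k + k.+1%:R^-1 by rewrite ltr_wpDl.
  have : ln (v k + k.+1%:R^-1) < K - M by rewrite -[ltRHS]expRK ltr_ln ?posrE// expR_gt0.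
  have : 0 <= t * v k by rewrite mulr_ge0// ltW.
  by lra.
exists (- ln r); split => //; apply: cvg_limn_einf.
apply: cvg_EFin; first exact: nearW.
apply: cvgD; last exact: cvg_cst.
apply: cvgB; first by apply: cvgM => //; exact: cvg_cst.
by apply: continuous_cvg => //; exact: continuous_ln.
Qed.

End limit_point.

(** Adding [V] makes the integrand nonnegative, so that its integral can be estimated before
    [- lne V] is known to be integrable. When it is infinite there is nothing to prove; otherwise
    the integral of [V] is subtracted again. *)
Lemma le_integral_subr_lne {d} {X : measurableType d} {R : realType}
    (Q : probability X R) (V : X -> R) (c : R) :
  measurable_fun setT V -> (forall y, 0 <= V y) ->
  (\int[Q]_y (V y)%:E < +oo)%E -> (c%:E <= \int[Q]_y - lne (V y)%:E)%E ->
  (\int[Q]_y (V y)%:E + c%:E <= \int[Q]_y ((V y)%:E - lne (V y)%:E))%E.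
Proof.
move=> mV V0 Voo cV; pose Z y := ((V y)%:E - lne (V y)%:E)%E.
have Z0 y : (0 <= Z y)%E.
  have := V0 y; rewrite le_eqVlt => /predU1P[Vy|Vy]; rewrite /Z.
    by rewrite -Vy le0_lneNy// add0e leey.
  by rewrite lne_EFin// -EFinB lee_fin subr_ge0 ltW// ln_sublinear.
have mVE : measurable_fun setT (fun y => (V y)%:E : \bar R) by exact/measurable_EFinP.
have mZ : measurable_fun setT Z.
  by apply: emeasurable_funB => //; exact: measurable_lne_EFin.
have [Zoo|] := eqVneq (\int[Q]_y Z y)%E +oo%E; first by rewrite Zoo leey.
rewrite -ltey => Zoo.
have iZ := integrable_ge0 mZ Z0 Zoo.
have iV : Q.-integrable setT (fun y => (V y)%:E).
  by apply: integrable_ge0 => // y; rewrite lee_fin.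
have iVfin := integrable_fin_num measurableT iV.
rewrite addeC -leeBrDr//.
rewrite -integralB//.
rewrite (eq_integral (fun y => - lne (V y)%:E)%E)// => y _.
by rewrite /Z/= addeAC subee// add0e.
Qed.

Lemma geometric_weights {R : realType} (q : R) : 0 <= q < 1 ->
  (\sum_(n <oo) ((1 - q) * q ^+ n)%:E = 1)%E.
Proof.
move=> /andP[q0 q1].
have q_lt1 : `|q| < 1 by rewrite ger0_norm.
have := cvg_geometric_series (a := 1 - q) q_lt1.
rewrite divff ?subr_eq0 ?gt_eqF// => cv.
apply/cvg_lim => //.
rewrite [X in X @ _ --> _](_ : _ = EFin \o series (geometric (1 - q) q)).
  by apply: cvg_EFin => //; exact: nearW.
by apply/funext => n; rewrite /series/= sumEFin.
Qed.

(** [s j] is chosen with probability at most [eta / 2 ^+ j.+1]; the integral is the expected number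
    of events that occur. *)
Lemma fast_subsequence {d} {X : measurableType d} {R : realType}
    (Q : probability X R) (F : nat -> set X) (eta : R) : 0 < eta ->
  (forall m, measurable (F m)) ->
  (forall tau : R, 0 < tau -> exists m, (Q (F m) <= tau%:E)%E) ->
  exists s : nat -> nat,
    (\int[Q]_y (\sum_(j <oo) (\1_(F (s j)) y)%:E) <= eta%:E)%E.
Proof.
move=> eta0 mF Fsmall.
have half : 0 <= (2^-1 : R) < 1 by apply/andP; split; lra.
have t0 j : 0 < eta * ((1 - 2^-1) * 2^-1 ^+ j) :> R.
  by rewrite !mulr_gt0// ?exprn_gt0// ?invr_gt0//; lra.
have /choice[s sP] := fun j => Fsmall _ (t0 j).
exists s.
have mI j : measurable_fun setT (fun y => (\1_(F (s j)) y)%:E : \bar R).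
  by apply/measurable_EFinP; exact: measurable_indic.
rewrite integral_nneseries//.
apply: (@le_trans _ _ (\sum_(j <oo) (eta%:E * ((1 - 2^-1) * 2^-1 ^+ j)%:E))%E).
  apply: lee_nneseries => j _; first by move=> _; apply: integral_ge0 => y _; rewrite lee_fin.
  by rewrite integral_indic// setIT -EFinM; exact: sP.
rewrite nneseriesZl; last first.
  by move=> j _; rewrite lee_fin mulr_ge0 ?exprn_ge0 ?invr_ge0//; lra.
by rewrite geometric_weights ?mule1.
Qed.

(* With [v j --> l] and [g >= (1 - q) q ^ j v j], the first index [N] outside
   of the bad events [b j] bounds [- ln g] by
   [- ln l - 2 ln (1 - q) - N ln q], and [N] is at most the number of bad
   events. *)
Lemma lne_mixture_le {R : realType} (q l g : R) (v : nat -> R) (b : nat -> bool) :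
  0 < q < 1 -> 0 < l -> (forall j, 0 <= v j) ->
  (forall j, ~~ b j -> (1 - q) * l <= v j) ->
  (forall n, \sum_(i < n) ((1 - q) * q ^+ i) * v i <= g) ->
  (- lne g%:E <= (- ln l)%:E + ((- (2 * ln (1 - q)))%:E +
     (- ln q)%:E * (\sum_(j <oo) (b j)%:R%:E)))%E.
Proof.
move=> /andP[q0 q1] l0 v0 bP gP.
have q1' : 0 < 1 - q by lra.
have lnq0 : 0 < - ln q by rewrite oppr_gt0 ln_lt0// q0.
have b0 n : (0 <= (b n)%:R%:E :> \bar R)%E by rewrite lee_fin ler0n.
have bsum n : (forall j, (j < n)%N -> b j) ->
    (n%:R%:E <= \sum_(j <oo) (b j)%:R%:E :> \bar R)%E.
  move=> bn; apply: le_trans (nneseries_lim_ge n _) => //.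
  rewrite sumEFin lee_fin big_mkord (eq_bigr (fun=> 1)) => [|i _].
    by rewrite sumr_const card_ord.
  by rewrite bn.
(* If every index is bad, the count is infinite and so is the right-hand side, since
   [- ln q > 0]. *)
have [bN|allb] := pselect (exists N, ~~ b N); last first.
  have -> : (\sum_(j <oo) (b j)%:R%:E = +oo :> \bar R)%E.
    apply/eqyP => A A0; apply: le_trans (bsum (Num.truncn A).+1 _).
      by rewrite lee_fin ltW// truncnS_gt.
    by move=> j _; apply: contrapT => /negP bj; apply: allb; exists j.
  by rewrite gt0_muley ?lte_fin// addey// leey.
case: (ex_minnP bN) => N nbN Nmin {bN}.
have bj j : (j < N)%N -> b j.
  by move=> jN; apply: contraLR jN => /Nmin; rewrite -leqNgt.
have wv0 i : 0 <= (1 - q) * q ^+ i * v i.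
  by rewrite mulr_ge0// mulr_ge0 ?exprn_ge0// ltW.
have gN : (1 - q) * q ^+ N * ((1 - q) * l) <= g.
  apply: le_trans (gP N.+1); rewrite big_ord_recr/=.
  apply: (@le_trans _ _ ((1 - q) * q ^+ N * v N)); last by rewrite lerDr sumr_ge0.
  by rewrite ler_wpM2l ?bP// mulr_ge0 ?exprn_ge0// ltW.
have qN0 : 0 < q ^+ N by rewrite exprn_gt0.
have pos : 0 < (1 - q) * q ^+ N * ((1 - q) * l) by rewrite !mulr_gt0.
have g0 : 0 < g := lt_le_trans pos gN.
rewrite lne_EFin// -EFinN.
apply: (@le_trans _ _ ((- ln l)%:E + ((- (2 * ln (1 - q)))%:E + (- ln q)%:E * N%:R%:E))%E).
  rewrite -EFinM -!EFinD lee_fin.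
  have : ln ((1 - q) * q ^+ N * ((1 - q) * l)) <= ln g by rewrite ler_ln.
  rewrite !lnM ?posrE ?mulr_gt0// lnXn// -mulr_natr.
  by lra.
rewrite leeD2l// leeD2l//; apply: lee_wpmul2l; first by rewrite lee_fin ltW.
exact: bsum.
Qed.

(** * A mixture that nearly attains the limit, and the common exponent *)

Section uniform.
Context {d} {X : measurableType d} {R : realType}.
Variables (Q : probability X R) (VV : set (X -> R)) (C : R).
Hypotheses (mVV : forall V, VV V -> measurable_fun setT V)
  (VV0 : forall V, VV V -> forall y, 0 <= V y)
  (VVC : forall V, VV V -> (\int[Q]_y (V y)%:E <= C%:E)%E)
  (mixVV : forall (w : nat -> R) (V : nat -> X -> R), (forall n, 0 <= w n) ->
    (\sum_(n <oo) (w n)%:E = 1)%E -> (forall n, VV (V n)) ->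
    exists2 g, VV g &
      {ae Q, forall y n, \sum_(i < n) w i * V i y <= g y}).

(** Fatou bounds the mean of [- ln l] for the limit [l] of the near minimizers by [e] plus a small
    penalty. The geometric mixture of a fast subsequence then has [- lne g] above [- ln l] by a
    constant and a multiple of the number of bad events. Three errors arise, of [eta / 8] each: the
    penalty [t * C], the constant [- 2 * ln (1 - q)], and the expected bad events weighted by
    [- ln q]. *)
Lemma exists_small_lne_mixture (e eta : R) : 0 < e -> 0 < eta ->
  (forall c : R, 0 < c <= 1 -> exists2 V, VV V & - e < \int[Q]_y ln (V y + c)) ->
  exists2 g, VV g & (\int[Q]_y ((g y)%:E - lne (g y)%:E) <
    \int[Q]_y (g y)%:E + (e + eta)%:E)%E.
Proof.
move=> e0 eta0 ln_large.
have [V [VP Vcvg]] := convergent_near_minimizers mVV VV0 VVC mixVV ln_large.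
have VVV k : VV (V k) by case: (VP k).
have V0 k y : 0 <= V k y := VV0 (VVV k) y.
have mV k : measurable_fun setT (V k) := mVV (VVV k).
have mVE k : measurable_fun setT (fun y => (V k y)%:E : \bar R).
  exact/measurable_EFinP.
have C0 : 0 <= C.
  rewrite -lee_fin; apply: le_trans (VVC (VVV 0%N)).
  by apply: integral_ge0 => y _; rewrite lee_fin.
pose t := eta / (8 * (C + 1)).
have t0 : 0 < t by rewrite divr_gt0//; lra.
have tC : t * C <= eta / 8.
  have : t * (C + 1) = eta / 8 by rewrite /t; field; lra.
  by move=> <-; rewrite ler_pM2l//; lra.
pose K := t - ln t.
pose psi k y := t * V k y - ln (V k y + k.+1%:R^-1) + K.
have psi0 k y : 0 <= psi k y by exact: (penalized_ln_ge0 t0 (fun k => V0 k y) k).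
have c01 k : 0 < (k.+1%:R^-1 : R) <= 1.
  by rewrite invr_gt0 ltr0Sn invf_le1 ?ltr0Sn// ler1n.
have ipsi k : Q.-integrable setT (EFin \o psi k).
  apply: integrable_EFinD; last exact: integrable_EFin_cst.
  have := integrable_EFinZ (-1) (family_ln_integrable mVV VV0 VVC (VVV k) (c01 k)).
  move=> /(integrable_EFinD (integrable_EFinZ t (family_integrable mVV VV0 VVC (VVV k)))).
  by under [X in _ \o X]eq_fun do rewrite mulN1r.
have psi_le k : (\int[Q]_y (psi k y)%:E <= (t * C + e + K)%:E)%E.
  have i1 := integrable_EFinZ t (family_integrable mVV VV0 VVC (VVV k)).
  have i2 := family_ln_integrable mVV VV0 VVC (VVV k) (c01 k).
  have i12 : Q.-integrable setT (EFin \o (fun y => t * V k y - ln (V k y + k.+1%:R^-1))).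
    exact: (integrableB measurableT i1 i2).
  rewrite -EFin_Rintegral// lee_fin /psi RintegralD//=; last exact: integrable_EFin_cst.
  rewrite Rintegral_cst_prob lerD2r RintegralB//= RintegralZl//=; last first.
    exact: (family_integrable mVV VV0 VVC).
  have := family_Rintegral_le mVV VV0 VVC (VVV k); have [_] := VP k => h1 h2.
  have : t * \int[Q]_y V k y <= t * C by rewrite ler_pM2l.
  by lra.
pose psioo y := limn_einf (fun k => (psi k y)%:E).
have mpsi k : measurable_fun setT (fun y => (psi k y)%:E : \bar R).
  exact: measurable_int (ipsi k).
have mpsioo : measurable_fun setT psioo by exact: measurable_limn_einf.
have psioo0 y : (0 <= psioo y)%E.
  rewrite leNgt; apply/negP => /limn_einf_lt_frequently/(_ 0%N)[k _].
  by rewrite ltNge lee_fin psi0.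
have psioo_le : (\int[Q]_y psioo y <= (t * C + e + K)%:E)%E.
  apply: le_trans (fatou Q measurableT mpsi _) _.
    by move=> k y _; rewrite lee_fin.
  exact: limn_einf_le.
have psioo_fin : {ae Q, forall y, (psioo y < +oo)%E}.
  by apply: ae_lty => //; rewrite (le_lt_trans psioo_le)// ltry.
have good : {ae Q, forall y, exists l : R, [/\ 0 < l, V ^~ y @ \oo --> l &
    psioo y = (t * l - ln l + K)%:E]}.
  by move: Vcvg psioo_fin; apply: filterS2 => y; exact: penalized_ln_cvg.
(* A measurable, everywhere defined version of the almost sure limit, needed to define the events
   [F k]. *)
pose Vi y := limn_einf (fun k => (V k y)%:E).
have mVi : measurable_fun setT Vi by exact: measurable_limn_einf.
(* A factor [1 - q] is lost twice, in the weights and in the threshold [(1 - q) * Vi] of [F k];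
   together they cost [- 2 * ln (1 - q) = eta / 8]. *)
pose q := 1 - expR (- (eta / 16)).
have eq1 : 1 - q = expR (- (eta / 16)) by rewrite /q; lra.
have q1 : q < 1 by rewrite /q; have := expR_gt0 (- (eta / 16)); lra.
have q0 : 0 < q by rewrite /q subr_gt0 -[ltRHS]expR0 ltr_expR; lra.
have lnq : ln (1 - q) = - (eta / 16) by rewrite eq1 expRK.
pose F k := [set y | ((V k y)%:E < (1 - q)%:E * Vi y)%E].
have mF k : measurable (F k).
  rewrite -[F k]setTI; apply: measurable_lte => //.
  exact: measurable_funeM.
have Fsmall (tau : R) : 0 < tau -> exists m, (Q (F m) <= tau%:E)%E.
  move=> tau0.
  have mI k : measurable_fun setT (fun y => (\1_(F k) y)%:E : \bar R).
    by apply/measurable_EFinP; exact: measurable_indic.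
  have [||||_ _] := @dominated_convergence _ _ _ Q setT measurableT
    (fun k y => (\1_(F k) y)%:E) (cst 0%E) (cst 1%E) mI.
  - exact: measurable_cst.
  - apply: filterS good => y [l [l0 Vl _]] _.
    apply: cvg_near_cst.
    have Viy : Vi y = l%:E.
      by apply: cvg_limn_einf; apply: cvg_EFin => //; exact: nearW.
    have ql : (1 - q) * l < l by rewrite gtr_pMl//; lra.
    apply: filterS (cvgr_gt l Vl _ ql) => k Vk.
    rewrite indicE memNset// /F/= Viy -EFinM lte_fin.
    by apply/negP; rewrite -leNgt ltW.
  - exact: finite_measure_integrable_cst.
  - apply: aeW => y k _; rewrite gee0_abs ?lee_fin// indicE.
  have -> : (\int[Q]_x cst 0 x = 0)%E by exact: integral0.
  move=> /fine_cvgP[fin /cvgr_lt/(_ _ tau0) lt].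
  have [m _ mP] := filterI fin lt.
  exists m; have [/= fm fmt] := mP m (leqnn m).
  have := fmt; rewrite -lte_fin fineK// integral_indic// setIT.
  exact: ltW.
have lnq0 : 0 < - ln q by rewrite oppr_gt0 ln_lt0// q0.
have tau0 : 0 < eta / 8 / - ln q by rewrite !divr_gt0.
have [s sP] := fast_subsequence tau0 mF Fsmall.
have [||j|g VVg gP] := mixVV (w := fun n => (1 - q) * q ^+ n) (V := fun j => V (s j)).
- by move=> n; rewrite mulr_ge0 ?exprn_ge0 ?(ltW q0)// subr_ge0 ltW.
- by apply: geometric_weights; rewrite (ltW q0).
- exact: VVV.
exists g => //.
have mg := mVV VVg; have g0 := VV0 VVg.
have mgE : measurable_fun setT (fun y => (g y)%:E : \bar R) by exact/measurable_EFinP.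
have mI k : measurable_fun setT (fun y => (\1_(F (s k)) y)%:E : \bar R).
  by apply/measurable_EFinP; exact: measurable_indic.
pose N y := (\sum_(j <oo) (\1_(F (s j)) y)%:E : \bar R)%E.
have N0 y : (0 <= N y)%E by apply: nneseries_ge0 => j _ _; rewrite lee_fin.
have mN : measurable_fun setT N by apply: ge0_emeasurable_sum => // j y _ _; rewrite lee_fin.
have K0 : 0 <= K by have := ln_sublinear t0; rewrite /K; lra.
have Z0 y : (0 <= (g y)%:E - lne (g y)%:E)%E.
  have := g0 y; rewrite le_eqVlt => /predU1P[gy|gy].
    by rewrite -gy le0_lneNy// add0e leey.
  by rewrite lne_EFin// -EFinB lee_fin subr_ge0 ltW// ln_sublinear.
have mZ : measurable_fun setT (fun y => ((g y)%:E - lne (g y)%:E)%E).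
  by apply: emeasurable_funB => //; exact: measurable_lne_EFin.
have eta0' : (0 <= (eta / 8)%:E)%E by rewrite lee_fin divr_ge0// ltW.
have ptwise : {ae Q, forall y, setT y -> ((g y)%:E - lne (g y)%:E + K%:E <=
    (g y)%:E + (psioo y + ((eta / 8)%:E + (- ln q)%:E * N y)))%E}.
  move: good gP; apply: filterS2 => y [l [l0 Vl ->]] gy _.
  have Viy : Vi y = l%:E.
    by apply: cvg_limn_einf; apply: cvg_EFin => //; exact: nearW.
  have h := @lne_mixture_le _ q l (g y) (fun j => V (s j) y) (fun j => y \in F (s j)).
  rewrite -addeA leeD2l//.
  apply: (@le_trans _ _ ((- ln l)%:E + ((eta / 8)%:E + (- ln q)%:E * N y) + K%:E)%E).
    rewrite leeD2r//.
    have -> : eta / 8 = - (2 * ln (1 - q)) by rewrite lnq; field.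
    apply: h => //; first by rewrite q0.
    move=> j; rewrite notin_setE /F/= Viy -EFinM lte_fin => /negP.
    by rewrite -leNgt.
  rewrite addeAC -EFinD leeD2r// lee_fin.
  have : 0 <= t * l by rewrite mulr_ge0// ltW.
  by lra.
have ig : (\int[Q]_y (g y)%:E \is a fin_num)%E.
  exact: integrable_fin_num (family_integrable mVV VV0 VVC VVg).
have mlN : measurable_fun setT (fun y => ((- ln q)%:E * N y)%E).
  exact: measurable_funeM.
have lN0 y : (0 <= (- ln q)%:E * N y)%E by rewrite mule_ge0// lee_fin ltW.
have mBN : measurable_fun setT (fun y => ((eta / 8)%:E + (- ln q)%:E * N y)%E).
  exact: emeasurable_funD.
have mpBN : measurable_fun setT (fun y => (psioo y + ((eta / 8)%:E + (- ln q)%:E * N y))%E).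
  exact: emeasurable_funD.
have BN0 y : (0 <= (eta / 8)%:E + (- ln q)%:E * N y)%E by rewrite adde_ge0.
have pBN0 y : (0 <= psioo y + ((eta / 8)%:E + (- ln q)%:E * N y))%E by rewrite adde_ge0.
have le_int : (\int[Q]_y ((g y)%:E - lne (g y)%:E + K%:E) <=
    \int[Q]_y ((g y)%:E + (psioo y + ((eta / 8)%:E + (- ln q)%:E * N y))))%E.
  apply: ae_ge0_le_integral => //.
  - by move=> y _; rewrite adde_ge0// lee_fin.
  - exact: emeasurable_funD.
  - by move=> y _; rewrite adde_ge0// lee_fin.
  - exact: emeasurable_funD.
have intN : ((- ln q)%:E * \int[Q]_y N y <= (eta / 8)%:E)%E.
  apply: (@le_trans _ _ ((- ln q)%:E * (eta / 8 / - ln q)%:E)%E).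
    by rewrite lee_wpmul2l// lee_fin ltW.
  by rewrite -EFinM lee_fin mulrC divfK// gt_eqF.
have rhs_le : (\int[Q]_y ((g y)%:E + (psioo y + ((eta / 8)%:E + (- ln q)%:E * N y))) <=
    \int[Q]_y (g y)%:E + ((t * C + e + K)%:E + ((eta / 8)%:E + (eta / 8)%:E)))%E.
  rewrite ge0_integralD//; last by move=> y _; rewrite lee_fin.
  rewrite leeD2l// ge0_integralD//; apply: leeD => //.
  rewrite ge0_integralD// integral_cst//= probability_setT mule1 leeD2l//.
  by rewrite ge0_integralZl_EFin// ltW.
have := le_trans le_int rhs_le.
rewrite ge0_integralD// integral_cst//= probability_setT mule1.
rewrite -(fineK ig).
case: (\int[Q]_y ((g y)%:E - lne (g y)%:E))%E => [r||]; rewrite ?ltNyr//.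
  by rewrite -!EFinD !lee_fin lte_fin; lra.
Qed.

Lemma uniform_power_bound (delta : R) : 0 < delta ->
  (forall V, VV V -> (delta%:E <= \int[Q]_y - lne (V y)%:E)%E) ->
  exists2 a : R, 0 < a & forall V, VV V -> (\int[Q]_y (V y `^ a)%:E <= 1)%E.
Proof.
move=> delta0 VVdelta; pose e := delta / 2.
have e0 : 0 < e by rewrite divr_gt0.
have [[c c01 cP]|h] := pselect (exists2 c : R, 0 < c <= 1 &
    forall V, VV V -> \int[Q]_y ln (V y + c) <= - e).
  exact: (power_of_ln_bound mVV VV0 VVC c01 e0 cP).
(* With [e = eta = delta / 2] the mixture would have divergence below [delta], against [VVdelta]. *)
have [c c01|g VVg] := @exists_small_lne_mixture e e e0 e0.
  apply: contrapT => nV; apply: h; exists c => // V VVV.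
  by rewrite leNgt; apply/negP => eV; apply: nV; exists V.
have Voo : (\int[Q]_y (g y)%:E < +oo)%E by rewrite (le_lt_trans (VVC VVg))// ltry.
rewrite ltNge (_ : e + e = delta); last by rewrite /e; field.
by rewrite (le_integral_subr_lne (mVV VVg) (VV0 VVg) Voo (VVdelta _ VVg)).
Qed.

End uniform.

(** * Densities and their mixtures *)

Lemma measurable_ratio {d} {X : measurableType d} {R : realType} (f g : X -> R) :
  measurable_fun setT f -> measurable_fun setT g -> (forall x, 0 <= g x) ->
  measurable_fun setT (fun x => f x / g x).
Proof.
move=> mf mg g0; apply: measurable_funM => //.
under eq_fun do rewrite -powR_inv1//.
exact: (measurableT_comp (measurable_powR _) mg).
Qed.

Lemma probability_of_measure {d} {X : measurableType d} {R : realType}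
    (m : {measure set X -> \bar R}) : m setT = 1%E ->
  exists p : probability X R, forall A, p A = m A.
Proof.
move=> m1; exists (mnormalize m (@dirac _ X point R)) => A.
by rewrite /= /mnormalize m1/= onee_eq0/= invr1 mule1.
Qed.

Section density_space_theory.
Context {dS : measure_display} {S : measurableType dS} {R : realType}.
Variable mu : {sigma_finite_measure set S -> \bar R}.
Context {dT : measure_display} {T : measurableType dT}.
Variable dens : T -> S -> R.
Hypothesis hT : density_space mu dens.

Lemma dens_ge0 t y : 0 <= dens t y.
Proof. by have [_ + _] := ds_density hT t; apply. Qed.

Lemma measurable_dens t : measurable_fun setT (dens t).
Proof. by have [] := ds_density hT t. Qed.

Lemma measurable_dens_at y : measurable_fun setT (dens ^~ y).
Proof. exact: (measurable_fun_pair1 y (ds_measurable hT)). Qed.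

(* [t] is a zero of the measurable function [t |-> \int |dens t - dens s|] if
   and only if [t = s]. *)
Lemma measurable_density_set1 (s : T) : measurable [set s].
Proof.
pose f (z : T * S) := (`|dens z.1 z.2 - dens s z.2|%:E : \bar R).
have mf : measurable_fun setT f.
  apply/measurable_EFinP; apply: measurableT_comp => //.
  apply: measurable_funB; first exact: (ds_measurable hT).
  by apply: (measurableT_comp (measurable_dens s)).
have f0 z : (0 <= f z)%E by rewrite lee_fin.
have mF : measurable_fun setT (fun t => \int[mu]_y f (t, y))%E.
  exact: (@measurable_fun_fubini_tonelli_F _ _ _ _ _ mu f mf f0).
rewrite (_ : [set s] = (fun t => \int[mu]_y f (t, y))%E @^-1` [set 0%E]).
  by rewrite -[X in measurable X]setTI; apply: mF => //; exact: emeasurable_set1.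
apply/seteqP; split=> [_ ->|t /= ft].
  by rewrite /= (eq_integral (cst 0%E)) ?integral0// => y _; rewrite /f/= subrr normr0.
apply: (ds_inj hT).
have /ae_eq_integral_abs : (\int[mu]_y `|(dens t y - dens s y)%:E| = 0)%E by [].
move=> /(_ measurableT); have mg : measurable_fun setT (fun y => (dens t y - dens s y)%:E : \bar R).
  by apply/measurable_EFinP; apply: measurable_funB; exact: measurable_dens.
move=> /(_ mg); apply: filterS => y /(_ Logic.I)/= [] /eqP.
by rewrite subr_eq0 => /eqP.
Qed.

(** The mixing measure is the sum of the [w n] times the point mass at [t n]. It is carried by the
    range of [t], which is measurable because singletons are. Only the lower bound by partial sums
    is kept: it is real-valued, and the logarithmic estimates ask for no more. *)
Lemma countable_mixture (A : set T) (w : nat -> R) (t : nat -> T) :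
  mixture_convex mu dens A -> (forall n, 0 <= w n) ->
  (\sum_(n <oo) (w n)%:E = 1)%E -> (forall n, A (t n)) ->
  exists2 s, A s &
    {ae mu, forall y n, \sum_(i < n) w i * dens (t i) y <= dens s y}.
Proof.
move=> cA w0 w1 At.
pose m n := mscale (NngNum (w0 n)) (@dirac _ T (t n) R).
pose nu0 : {measure set T -> \bar R} := mseries m 0.
have nu0E B : nu0 B = (\sum_(n <oo) (w n)%:E * \d_(t n) B)%E by [].
have nu01 : nu0 setT = 1%E.
  by rewrite nu0E -[RHS]w1; apply: eq_eseriesr => n _; rewrite diracT mule1.
have [nu nuE] := probability_of_measure nu01.
have [|s As nus] := cA nu.
  exists (range t); split.
  - rewrite (_ : range t = \bigcup_n [set t n]).
      by apply: bigcup_measurable => n _; exact: measurable_density_set1.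
    by apply/seteqP; split=> [_ [n _ <-]|_ [n _ ->]]; exists n.
  - by move=> _ [n _ <-].
  - rewrite nuE nu0E -[RHS]w1; apply: eq_eseriesr => n _.
    by rewrite diracE mem_set ?mule1//; exists n.
exists s => //; apply: filterS nus => y sy n.
have mdE : measurable_fun setT (fun t => (dens t y)%:E : \bar R).
  by apply/measurable_EFinP; exact: measurable_dens_at.
have d0 t' : setT t' -> (0 <= (dens t' y)%:E)%E by rewrite lee_fin dens_ge0.
rewrite -lee_fin sy.
rewrite (eq_measure_integral nu0); last by move=> B mB _; exact: nuE.
rewrite ge0_integral_measure_series//.
have termE i : (\int[m i]_s0 (dens s0 y)%:E = (w i * dens (t i) y)%:E)%E.
  rewrite ge0_integral_mscale//= integral_dirac//.
  by rewrite diracT mul1e -EFinM.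
under eq_eseriesr do rewrite termE.
apply: le_trans (nneseries_lim_ge n _); last first.
  by move=> i _; rewrite lee_fin mulr_ge0// dens_ge0.
by rewrite sumEFin lee_fin big_mkord.
Qed.

End density_space_theory.

(** * Integrals under the law with density [f0] *)

Section law.
Context {dS : measure_display} {S : measurableType dS} {R : realType}.
Variables (mu : {measure set S -> \bar R}) (Q : probability S R) (f0 : S -> R).
Hypotheses (mf0 : measurable_fun setT f0) (f0_ge0 : forall y, 0 <= f0 y)
  (QE : forall B, measurable B -> Q B = (\int[mu]_(y in B) (f0 y)%:E)%E).

Let mf0E D : measurable_fun D (fun y => (f0 y)%:E : \bar R).
Proof. by apply/measurable_EFinP; exact: measurable_funTS. Qed.

Lemma integral_law (g : S -> \bar R) : measurable_fun setT g ->
  (forall y, 0 <= g y)%E -> (\int[Q]_y g y = \int[mu]_y (g y * (f0 y)%:E))%E.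
Proof. by move=> mg g0; apply: ge0_integral_density. Qed.

Lemma ae_law_of_ae (p : set S) : {ae mu, forall y, p y} -> {ae Q, forall y, p y}.
Proof.
move=> [N [mN muN pN]]; exists N; split => //.
rewrite QE// (ae_eq_integral (cst 0%E))//; first exact: integral0.
exact: ae_eq0.
Qed.

Lemma ae_law_gt0 : {ae Q, forall y, 0 < f0 y}.
Proof.
exists (f0 @^-1` [set 0]); split.
- by rewrite -[X in measurable X]setTI; exact: mf0.
- rewrite QE; last by rewrite -[X in measurable X]setTI; exact: mf0.
  rewrite (eq_integral (cst 0%E)) ?integral0// => y.
  by rewrite inE/= => ->.
- move=> y /= /negP; rewrite -leNgt => y0.
  by apply/eqP; rewrite eq_le y0 f0_ge0.
Qed.

(** An inequality only: the part of [f] that lives where [f0] vanishes is lost. *)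
Lemma integral_law_ratio_le (f : S -> R) : measurable_fun setT f ->
  (forall y, 0 <= f y) ->
  (\int[Q]_y (f y / f0 y)%:E <= \int[mu]_y (f y)%:E)%E.
Proof.
move=> mf f_ge0.
have mr : measurable_fun setT (fun y => f y / f0 y).
  exact: measurable_ratio.
rewrite integral_law//; last 2 first.
- exact/measurable_EFinP.
- by move=> y; rewrite lee_fin divr_ge0.
apply: ge0_le_integral => //.
- by move=> y _; rewrite -EFinM lee_fin mulr_ge0// divr_ge0.
- by apply: emeasurable_funM => //; exact/measurable_EFinP.
- exact/measurable_EFinP.
- move=> y _; rewrite -EFinM lee_fin.
  by have [->|y0] := eqVneq (f0 y) 0; rewrite ?mulr0// divfK.
Qed.

(** The integrands agree at every point: both are 0 where [f0] is 0, and +oo where only [f] is. The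
    integrand is signed, so the change of measure is made on its positive and negative parts. *)
Lemma KL_law (f : S -> R) : measurable_fun setT f -> (forall y, 0 <= f y) ->
  (KL mu f0 f = \int[Q]_y - lne (f y / f0 y)%:E)%E.
Proof.
move=> mf f_ge0; pose g y := (- lne (f y / f0 y)%:E)%E.
have mg : measurable_fun setT g.
  apply: measurableT_comp => //; apply: measurable_lne_EFin.
  exact: measurable_ratio.
have -> : KL mu f0 f = (\int[mu]_y (g y * (f0 y)%:E))%E.
  apply: eq_integral => y _; rewrite /g.
  have := f0_ge0 y; rewrite le_eqVlt => /predU1P[<-|y0]; first by rewrite mul0e mule0.
  have := f_ge0 y; rewrite le_eqVlt => /predU1P[<-|fy0].
    by rewrite mul0r (@le0_lneNy _ 0%E)// inver eqxx (@gt0_muley _ (f0 y)%:E) ?lte_fin//.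
  rewrite inver gt_eqF// -EFinM !lne_EFin ?divr_gt0// muleC -EFinN; congr (_%:E * _)%E.
  by rewrite !ln_div ?posrE// opprB.
rewrite [RHS]integralE [LHS]integralE !integral_law//.
- congr (_ - _)%E; apply: eq_integral => y _.
    by rewrite !funeposE maxe_pMl ?mul0e// lee_fin.
  by rewrite !funenegE -mulNe maxe_pMl ?mul0e// lee_fin.
- exact: measurable_funeneg.
- exact: measurable_funepos.
Qed.

End law.

Section convex_sets.
Context {dS : measure_display} {S : measurableType dS} {R : realType}.
Variable mu : {sigma_finite_measure set S -> \bar R}.
Context {dT : measure_display} {T : measurableType dT}.
Variable dens : T -> S -> R.
Hypothesis hT : density_space mu dens.
Variables (Q : probability S R) (f0 : S -> R).
Hypotheses (mf0 : measurable_fun setT f0) (f0_ge0 : forall y, 0 <= f0 y)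
  (QE : forall B, measurable B -> Q B = (\int[mu]_(y in B) (f0 y)%:E)%E).

(** The factor [expR k] builds the rate in: an [a]-th moment at most 1 for this function says that
    likelihood ratios decay at rate [k]. *)
Definition scaled_ratio (k : R) (t : T) (y : S) : R := expR k * (dens t y / f0 y).

Lemma scaled_ratio_ge0 k t y : 0 <= scaled_ratio k t y.
Proof. by rewrite mulr_ge0 ?expR_ge0// divr_ge0// (dens_ge0 hT). Qed.

Lemma measurable_scaled_ratio k t : measurable_fun setT (scaled_ratio k t).
Proof.
by apply: measurable_funM => //; apply: measurable_ratio => //; exact: (measurable_dens hT).
Qed.

Lemma measurable_scaled_ratio_pair k :
  measurable_fun setT (fun z : T * S => scaled_ratio k z.1 z.2).
Proof.
apply: measurable_funM => //; apply: measurable_ratio => //.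
  exact: (ds_measurable hT).
exact: (measurableT_comp mf0 measurable_snd).
Qed.

Lemma measurable_scaled_ratio_comp k {dZ} {Z : measurableType dZ}
    (f : Z -> T) (g : Z -> S) : measurable_fun setT f -> measurable_fun setT g ->
  measurable_fun setT (fun z => scaled_ratio k (f z) (g z)).
Proof.
move=> mf mg.
exact: (measurableT_comp (measurable_scaled_ratio_pair k) (measurable_fun_pair mf mg)).
Qed.

Lemma integral_scaled_ratio_le k t :
  (\int[Q]_y (scaled_ratio k t y)%:E <= (expR k)%:E)%E.
Proof.
under eq_integral do rewrite EFinM.
have mr : measurable_fun setT (fun y => (dens t y / f0 y)%:E : \bar R).
  by apply/measurable_EFinP; apply: measurable_ratio => //; exact: (measurable_dens hT).
rewrite ge0_integralZl_EFin//; last first.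
  by move=> y _; rewrite lee_fin divr_ge0// (dens_ge0 hT).
rewrite -[leRHS]mule1 lee_wpmul2l// ?lee_fin ?expR_ge0//.
have [mt t0 <-] := ds_density hT t.
exact: (integral_law_ratio_le mf0 f0_ge0 QE).
Qed.

Lemma scaled_ratio_mixture k (A : set T) : mixture_convex mu dens A ->
  forall (w : nat -> R) (t : nat -> T), (forall n, 0 <= w n) ->
    (\sum_(n <oo) (w n)%:E = 1)%E -> (forall n, A (t n)) ->
    exists2 s, A s &
      {ae Q, forall y n, \sum_(i < n) w i * scaled_ratio k (t i) y <= scaled_ratio k s y}.
Proof.
move=> cA w t w0 w1 At.
have [s As sP] := countable_mixture hT cA w0 w1 At.
exists s => //; apply: filterS (ae_law_of_ae mf0 QE sP) => y ys n.
rewrite (_ : \sum_(i < n) _ = expR k * ((\sum_(i < n) w i * dens (t i) y) / f0 y)).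
  by rewrite /scaled_ratio ler_wpM2l ?expR_ge0// ler_wpM2r// invr_ge0.
rewrite mulr_suml mulr_sumr; apply: eq_bigr => i _.
by rewrite /scaled_ratio; ring.
Qed.

Lemma lne_scaled_ratio k t y :
  (lne (scaled_ratio k t y)%:E = k%:E + lne (dens t y / f0 y)%:E)%E.
Proof.
have : 0 <= dens t y / f0 y by rewrite divr_ge0// (dens_ge0 hT).
rewrite /scaled_ratio le_eqVlt => /predU1P[<-|r0].
  by rewrite mulr0 le0_lneNy.
rewrite (lne_EFin (mulr_gt0 (expR_gt0 k) r0)) (lne_EFin r0).
by rewrite [ln (expR k * _)]lnM ?posrE ?expR_gt0// expRK.
Qed.

Lemma convex_power_bound (A : set T) (k k' : R) : mixture_convex mu dens A ->
  k < k' -> (forall t, A t -> (k'%:E <= KL mu f0 (dens t))%E) ->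
  exists2 a : R, 0 < a & forall t, A t ->
    (\int[Q]_y (scaled_ratio k t y `^ a)%:E <= 1)%E.
Proof.
move=> cA kk' AK.
pose VV := [set scaled_ratio k t | t in A].
have [||||| |a a0 aP] := @uniform_power_bound _ _ _ Q VV (expR k) _ _ _ _ (k' - k).
- by move=> _ [t _ <-]; exact: measurable_scaled_ratio.
- by move=> _ [t _ <-] y; exact: scaled_ratio_ge0.
- by move=> _ [t _ <-]; exact: integral_scaled_ratio_le.
- move=> w V w0 w1 /(_ _)/cid2-/all_sig2[t At tV].
  have [s As sP] := scaled_ratio_mixture k cA w0 w1 At.
  exists (scaled_ratio k s); first by exists s.
  by apply: filterS sP => y ys n; have := ys n; under eq_bigr do rewrite tV.
- by rewrite subr_gt0.
(* By contradiction, because the negated bound is what makes [- lne] integrable and allows the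
   constant [k] to be split off. *)
- move=> _ [t At <-]; rewrite leNgt; apply/negP => lt.
  have iV : Q.-integrable setT (fun y => - lne (scaled_ratio k t y)%:E)%E.
    apply: integrable_oppe_lne; first exact: measurable_scaled_ratio.
    - by move=> y; exact: scaled_ratio_ge0.
    - by rewrite (le_lt_trans (integral_scaled_ratio_le k t))// ltry.
    - by rewrite (lt_trans lt)// ltry.
  have := AK t At; rewrite leNgt => /negP; apply.
  rewrite (KL_law mf0 f0_ge0 QE (measurable_dens hT t) (dens_ge0 hT t)).
  rewrite (eq_integral (fun y => - lne (scaled_ratio k t y)%:E + k%:E))%E; last first.
    move=> y _; rewrite lne_scaled_ratio; case: lne => [r||] //=.
    by rewrite -!EFinD; congr EFin; ring.
  rewrite integralD//; last exact: finite_measure_integrable_cst.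
  rewrite integral_cst//= probability_setT mule1.
  by rewrite -lteBrDr// -EFinB.
by exists a => // t At; apply: aP; exists t.
Qed.

Section predictive.
Variables (A B : set T) (k a : R) (Pi : probability T R).
Hypotheses (cA : mixture_convex mu dens A) (mB : measurable B) (BA : B `<=` A)
  (a0 : 0 < a)
  (aP : forall t, A t -> (\int[Q]_y (scaled_ratio k t y `^ a)%:E <= 1)%E).

(* Normalizing the weight [l] gives a probability carried by [A], so that the
   integral over [t] is [c * scaled_ratio k s y] for one [s] in [A]. *)
Lemma predictive_power_bound (l : T -> R) :
  measurable_fun setT l -> (forall t, 0 <= l t) -> (forall t, ~ B t -> l t = 0) ->
  (\int[Q]_y (poweR (\int[Pi]_t (l t * scaled_ratio k t y)%:E) a) <=
   poweR (\int[Pi]_t (l t)%:E) a)%E.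
Proof.
move=> ml l0 lB.
have mlE : measurable_fun setT (fun t => (l t)%:E : \bar R) by exact/measurable_EFinP.
have c_ge0 : (0 <= \int[Pi]_t (l t)%:E)%E.
  by apply: integral_ge0 => t _; rewrite lee_fin.
have mrat y : measurable_fun setT (fun t => scaled_ratio k t y).
  apply: measurable_funM => //; apply: measurable_funM => //.
  exact: (measurable_dens_at hT).
have an0 : a != 0 by rewrite gt_eqF.
move: c_ge0; case cE : (\int[Pi]_t (l t)%:E)%E => [c||] // => [|_]; last first.
  by rewrite poweRyr// leey.
(* A weight of total mass 0 cannot be normalized; both sides vanish then, as [a] is not 0. *)
rewrite lee_fin le_eqVlt => /predU1P[c0|c0].
  have lae : ae_eq Pi setT (fun t => (l t)%:E) (cst 0%E).
    apply/ae_eq_integral_abs => //.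
    by under eq_integral do rewrite gee0_abs ?lee_fin//; rewrite cE -c0.
  rewrite -c0 (eq_integral (cst 0%E)) ?integral0 ?poweR_ge0// => y _.
  rewrite (ae_eq_integral (cst 0%E))//.
  - by rewrite integral0 poweR0r.
  - by apply/measurable_EFinP; exact: measurable_funM.
  - by apply: filterS lae => t /(_ Logic.I)/= [->] _; rewrite mul0r.
pose h t := l t / c.
have mh : measurable_fun setT h by exact: measurable_funM.
have h0 t : 0 <= h t by rewrite divr_ge0// ltW.
have ih : (\int[Pi]_t (h t)%:E = 1)%E.
  under eq_integral do rewrite /h mulrC EFinM.
  rewrite ge0_integralZl_EFin//; last 2 first.
  - by move=> t _; rewrite lee_fin.
  - by rewrite invr_ge0 ltW.
  by rewrite cE -EFinM mulVf// gt_eqF.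
have [m mE] := density_measureP Pi mh h0.
have [|nu nuE] := @probability_of_measure _ _ _ m; first by rewrite mE.
have [s As nus] : exists2 s, A s & is_mixture mu dens nu s.
  apply: cA.
  exists B; split => //; rewrite nuE mE.
  change ((\int[Pi]_(t in B) (h t)%:E = 1)%E); rewrite -ih.
  rewrite integral_mkcond; apply: eq_integral => t _.
  rewrite patchE; case: ifPn => //; rewrite notin_setE => /lB lt.
  by rewrite /h lt mul0r.
have sP := ae_law_of_ae mf0 QE nus.
have key : {ae Q, forall y, setT y -> poweR (\int[Pi]_t (l t * scaled_ratio k t y)%:E) a =
    ((c `^ a)%:E * (scaled_ratio k s y `^ a)%:E)%E}.
  apply: filterS sP => y ys _.
  rewrite -EFinM -powRM ?(ltW c0) ?scaled_ratio_ge0// -poweR_EFin; congr poweR.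
  have mdE : measurable_fun setT (fun t => (dens t y)%:E : \bar R).
    by apply/measurable_EFinP; exact: (measurable_dens_at hT).
  have d0 t : (0 <= (dens t y)%:E)%E by rewrite lee_fin (dens_ge0 hT).
  rewrite (ge0_integral_density (mu := Pi) mh h0) in ys => //; last first.
    by move=> B' mB'; have := nuE B'; rewrite mE.
  have rE t : (l t * scaled_ratio k t y)%:E =
      ((c * expR k / f0 y)%:E * ((dens t y)%:E * (h t)%:E))%E.
    rewrite -!EFinM /scaled_ratio /h; congr EFin.
    have c0' : c != 0 by rewrite gt_eqF.
    rewrite (_ : dens t y * (l t / c) = (dens t y * l t) * c^-1); last by rewrite mulrA.
    rewrite (_ : c * expR k / f0 y * (dens t y * l t / c) = (c / c) * (expR k / f0 y * (dens t y * l t))); last by ring.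
    by rewrite divff// mul1r; ring.
  under eq_integral do rewrite rE.
  rewrite ge0_integralZl_EFin//.
  - rewrite -ys -EFinM; congr EFin; rewrite /scaled_ratio; ring.
  - by move=> t _; rewrite mule_ge0// lee_fin.
  - by apply: emeasurable_funM => //; exact/measurable_EFinP.
  - by rewrite divr_ge0// mulr_ge0 ?expR_ge0// ltW.
have ms : measurable_fun setT (fun y => (scaled_ratio k s y `^ a)%:E : \bar R).
  apply/measurable_EFinP; apply: (measurableT_comp (measurable_powR _)).
  exact: measurable_scaled_ratio.
rewrite (ge0_ae_eq_integral _ _ _ _ _ key)//; last 4 first.
- apply: (measurableT_comp (measurable_poweR _)).
  apply: (@measurable_fun_fubini_tonelli_G _ _ T S R Pi
    (fun z => (l z.1 * scaled_ratio k z.1 z.2)%:E)) => [|z].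
    apply/measurable_EFinP; apply: measurable_funM; last exact: measurable_scaled_ratio_pair.
    exact: (measurableT_comp ml measurable_fst).
  by rewrite lee_fin mulr_ge0// scaled_ratio_ge0.
- exact: measurable_funeM.
- by move=> y _; rewrite poweR_ge0.
- by move=> y _; rewrite mule_ge0// lee_fin powR_ge0.
rewrite ge0_integralZl_EFin//; last 2 first.
- by move=> y _; rewrite lee_fin powR_ge0.
- exact: powR_ge0.
by rewrite -[leRHS]mule1 lee_wpmul2l ?aP// lee_fin powR_ge0.
Qed.

End predictive.
End convex_sets.

(** * Numerator and denominator of the posterior *)

Section posterior_masses.
Context {dS : measure_display} {S : measurableType dS} {R : realType}.
Variable mu : {sigma_finite_measure set S -> \bar R}.
Context {dT : measure_display} {T : measurableType dT}.
Variable dens : T -> S -> R.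
Hypothesis hT : density_space mu dens.
Variables (Q : probability S R) (f0 : S -> R).
Hypotheses (mf0 : measurable_fun setT f0) (f0_ge0 : forall y, 0 <= f0 y)
  (QE : forall B, measurable B -> Q B = (\int[mu]_(y in B) (f0 y)%:E)%E).
Context {dO : measure_display} {Omega : measurableType dO}.
Variables (P : probability Omega R) (Y : nat -> Omega -> S).
Hypotheses (mY : forall i, measurable_fun setT (Y i))
  (lawY : forall i B, measurable B -> P (Y i @^-1` B) = Q B)
  (indepY : forall (J : {fset nat}) (B : nat -> set S),
    (forall i, measurable (B i)) ->
    P (\bigcap_(i in [set` J]) (Y i @^-1` B i)) =
      (\prod_(i <- J) P (Y i @^-1` B i))%E).
Variable Pi : probability T R.

Local Notation ratio := (scaled_ratio dens f0).

(** The indicator is part of the integrand, so that indicator times likelihood is a weight [l] as in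
    [predictive_power_bound]. *)
Definition mass (k : R) (B : set T) (n : nat) (w : Omega) : \bar R :=
  (\int[Pi]_t (\1_B t * \prod_(i < n) ratio k t (Y i w))%:E)%E.

Lemma mass_integrand_ge0 k B n w t :
  (0 <= (\1_B t * \prod_(i < n) ratio k t (Y i w))%:E)%E.
Proof.
rewrite lee_fin mulr_ge0// prodr_ge0// => i _.
exact: (scaled_ratio_ge0 hT f0_ge0).
Qed.

Lemma mass_ge0 k B n w : (0 <= mass k B n w)%E.
Proof. by apply: integral_ge0 => t _; exact: mass_integrand_ge0. Qed.

Lemma measurable_prod_ratio k n {dZ} {Z : measurableType dZ} (f : Z -> T) (g : nat -> Z -> S) :
  measurable_fun setT f -> (forall i, (i < n)%N -> measurable_fun setT (g i)) ->
  measurable_fun setT (fun z => \prod_(i < n) ratio k (f z) (g i z)).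
Proof.
move=> mf mg; apply: measurable_prod => i _.
by apply: (measurable_scaled_ratio_comp hT mf0 f0_ge0) => //; exact: mg.
Qed.

Lemma measurable_mass_integrand k B n w : measurable B ->
  measurable_fun setT (fun t => \1_B t * \prod_(i < n) ratio k t (Y i w)).
Proof.
move=> mB; apply: measurable_funM; first exact: measurable_indic.
apply: (@measurable_prod_ratio k n _ T idfun (fun i _ => Y i w)).
  exact: measurable_id.
move=> i _; exact: measurable_cst.
Qed.

Lemma measurable_mass_past k B n : measurable B ->
  measurable_fun setT (mass k B n : past Y n -> \bar R).
Proof.
move=> mB.
apply: (@measurable_fun_fubini_tonelli_G _ _ T (past Y n) R Pi
  (fun z => (\1_B z.1 * \prod_(i < n) ratio k z.1 (Y i (z.2 : Omega)))%:E)) => [|z].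
  apply/measurable_EFinP; apply: measurable_funM.
    exact: (@measurableT_comp _ _ _ (T * past Y n)%type T R \1_B setT fst
      (measurable_indic mB) measurable_fst).
  apply: (@measurable_prod_ratio k n _ (T * past Y n)%type fst (fun i z => Y i (z.2 : Omega))).
    exact: measurable_fst.
  move=> i ltin; exact: (@measurableT_comp _ _ _ (T * past Y n)%type (past Y n) S (Y i)
    setT snd (measurable_past_coord ltin) measurable_snd).
rewrite lee_fin mulr_ge0// prodr_ge0// => i _; exact: (scaled_ratio_ge0 hT f0_ge0).
Qed.

Lemma measurable_mass k B n : measurable B -> measurable_fun setT (mass k B n).
Proof.
by move=> mB; apply: (measurable_fun_past mY (n := n)); exact: measurable_mass_past.
Qed.

Section power.
Variables (A B : set T) (k a : R).
Hypotheses (cA : mixture_convex mu dens A) (mB : measurable B) (BA : B `<=` A)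
  (a0 : 0 < a)
  (aP : forall t, A t -> (\int[Q]_y (ratio k t y `^ a)%:E <= 1)%E).

Lemma mass_power_bound n : (\int[P]_w poweR (mass k B n w) a <= 1)%E.
Proof.
elim: n => [|n IHn].
  have mass1 w : (poweR (mass k B 0 w) a <= 1)%E.
    have m1 : (mass k B 0 w <= 1)%E.
      rewrite /mass; under eq_integral do rewrite big_ord0 mulr1.
      by rewrite integral_indic// setIT probability_le1.
    rewrite -[leRHS](poweR1r a); apply: gt0_ler_poweR => //; first exact: ltW.
    - by rewrite in_itv/= mass_ge0 leey.
    - by rewrite in_itv/= lee01 leey.
  apply: (@le_trans _ _ (\int[P]_w cst 1%E w)%E).
    apply: ge0_le_integral => //.
    - by move=> w _; rewrite poweR_ge0.
    - by apply: (measurableT_comp (measurable_poweR _)); exact: measurable_mass.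
  by rewrite integral_cst//= probability_setT mule1.
(* The next mass with the last observation as a separate argument, measurable with respect to the
   past in the other one, as [integral_past] requires. *)
pose g (z : past Y n * S) := poweR (\int[Pi]_t (\1_B t *
  \prod_(i < n) ratio k t (Y i (z.1 : Omega)) * ratio k t z.2)%:E)%E a.
have mg : measurable_fun setT g.
  apply: (measurableT_comp (measurable_poweR _)).
  apply: (@measurable_fun_fubini_tonelli_G _ _ T (past Y n * S)%type R Pi
    (fun z => (\1_B z.1 * \prod_(i < n) ratio k z.1 (Y i (z.2.1 : Omega)) * ratio k z.1 z.2.2)%:E)) => [|z].
    apply/measurable_EFinP; apply: measurable_funM; first apply: measurable_funM.
    - exact: (@measurableT_comp _ _ _ (T * (past Y n * S))%type T R \1_B setT fst
        (measurable_indic mB) measurable_fst).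
    - apply: (@measurable_prod_ratio k n _ (T * (past Y n * S))%type fst
        (fun i z => Y i (z.2.1 : Omega))); first exact: measurable_fst.
      move=> i ltin; exact: (@measurableT_comp _ _ _ (T * (past Y n * S))%type (past Y n) S
        (Y i) setT (fun z => z.2.1) (measurable_past_coord ltin)
        (measurableT_comp measurable_fst measurable_snd)).
    - apply: (@measurable_scaled_ratio_comp _ _ _ _ _ _ _ hT _ mf0 f0_ge0 k _
        (T * (past Y n * S))%type fst (fun z => z.2.2)); first exact: measurable_fst.
      exact: (measurableT_comp measurable_snd measurable_snd).
  rewrite lee_fin mulr_ge0 ?(scaled_ratio_ge0 hT f0_ge0)// mulr_ge0// prodr_ge0// => i _.
  exact: (scaled_ratio_ge0 hT f0_ge0).
rewrite (eq_integral (fun w => g (w, Y n w))); last first.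
  move=> w _; rewrite /g /mass; congr poweR; apply: eq_integral => t _.
  by rewrite big_ord_recr/= mulrA.
rewrite (integral_past mY lawY indepY mg); last by move=> z; rewrite poweR_ge0.
apply: le_trans IHn; apply: ge0_le_integral => //.
- by move=> w _; apply: integral_ge0 => y _; rewrite poweR_ge0.
- apply: (measurable_fun_past mY (n := n)).
  apply: (@measurable_fun_fubini_tonelli_F _ _ (past Y n) S R Q g mg).
  by move=> z; rewrite poweR_ge0.
- by apply: (measurableT_comp (measurable_poweR _)); exact: measurable_mass.
- move=> w _; apply: (predictive_power_bound hT mf0 f0_ge0 QE Pi cA mB BA a0 aP
    (l := fun t => \1_B t * \prod_(i < n) ratio k t (Y i w))).
  + exact: measurable_mass_integrand.
  + by move=> t; rewrite mulr_ge0// prodr_ge0// => i _; exact: (scaled_ratio_ge0 hT f0_ge0).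
  + by move=> t Bt; rewrite indicE memNset// mul0r.
Qed.

Lemma mass_upper (eta : R) : 0 < eta ->
  {ae P, forall w, \forall n \near \oo, (mass k B n w <= (expR (eta * n%:R))%:E)%E}.
Proof.
move=> eta0.
pose q := expR (- (a * eta)).
have q01 : 0 <= q < 1.
  by rewrite expR_ge0/= -[ltRHS]expR0 ltr_expR oppr_lt0 mulr_gt0.
pose f n w := ((q ^+ n)%:E * poweR (mass k B n w) a)%E.
have qn0 n : (0 <= (q ^+ n)%:E)%E by rewrite lee_fin exprn_ge0//; case/andP: q01.
have mp n : measurable_fun setT (fun w => poweR (mass k B n w) a).
  by apply: (measurableT_comp (measurable_poweR _)); exact: measurable_mass.
have ae1 : {ae P, forall w, \forall n \near \oo, (f n w < 1)%E}.
  apply: ae_eventually_lt1.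
  - by move=> n; exact: measurable_funeM.
  - by move=> n w; rewrite mule_ge0// poweR_ge0.
  apply: le_lt_trans (geometric_nneseries_lty q01).
  apply: lee_nneseries => n _.
    by move=> _; apply: integral_ge0 => w _; rewrite mule_ge0// poweR_ge0.
  rewrite ge0_integralZl//; last by move=> w _; rewrite poweR_ge0.
  by rewrite -[leRHS]mule1 lee_wpmul2l// mass_power_bound.
apply: filterS ae1 => w; apply: filterS => n fn.
rewrite leNgt; apply/negP => mn.
move: fn; apply/negP; rewrite -leNgt.
have : (poweR (expR (eta * n%:R))%:E a <= poweR (mass k B n w) a)%E.
  apply: gt0_ler_poweR; [exact: ltW| | |exact: ltW].
  - by rewrite in_itv/= lee_fin expR_ge0 leey.
  - by rewrite in_itv/= mass_ge0 leey.
rewrite poweR_EFin => /(lee_wpmul2l (qn0 n)); apply: le_trans.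
rewrite -EFinM lee_fin /powR gt_eqF ?expR_gt0// expRK /q -expRM_natl -expRD.
by rewrite -[leLHS]expR0 ler_expR; lra.
Qed.

End power.

Lemma mass_scale k B n w : measurable B ->
  mass k B n w = ((expR (k * n%:R))%:E * mass 0 B n w)%E.
Proof.
move=> mB; rewrite /mass -ge0_integralZl_EFin//.
- apply: eq_integral => t _; rewrite -EFinM mulrCA; congr (_ * _)%:E.
  rewrite [k * _]mulrC expRM_natl.
  transitivity (\prod_(i < n) (expR k * ratio 0 t (Y i w))).
    by apply: eq_bigr => i _; rewrite /scaled_ratio expR0 mul1r.
  by rewrite big_split/= prodr_const card_ord.
- by move=> t _; exact: mass_integrand_ge0.
- by apply/measurable_EFinP; exact: measurable_mass_integrand.
Qed.

Lemma convex_mass_upper (A B : set T) (k k' : R) : mixture_convex mu dens A ->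
  measurable B -> B `<=` A -> k < k' ->
  (forall t, A t -> (k'%:E <= KL mu f0 (dens t))%E) ->
  {ae P, forall w, \forall n \near \oo,
    (mass 0 B n w <= (expR (- (k * n%:R)))%:E)%E}.
Proof.
(* Half of the gap [k' - k] pays for the moment bound at rate [k1], the other half for
   Borel-Cantelli. *)
move=> cA mB BA kk' AK; pose k1 := (k + k') / 2.
have k1k' : k1 < k' by rewrite /k1; lra.
have kk1 : 0 < k1 - k by rewrite /k1; lra.
have [a a0 aP] := convex_power_bound hT mf0 f0_ge0 QE cA k1k' AK.
have := mass_upper cA mB BA a0 aP kk1.
apply: filterS => w; apply: filterS => n; rewrite mass_scale//.
move=> /(lee_wpmul2l (x := (expR (- (k1 * n%:R)))%:E)).
rewrite lee_fin expR_ge0 => /(_ isT).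
rewrite muleA -!EFinM -!expRD addNr expR0 mul1e => /le_trans; apply.
by rewrite lee_fin ler_expR; lra.
Qed.

End posterior_masses.

Lemma ge0_integral_eq0_ae {d} {X : measurableType d} {R : realType}
    (m : {measure set X -> \bar R}) (f : X -> \bar R) :
  measurable_fun setT f -> (forall x, (0 <= f x)%E) ->
  (\int[m]_x f x = 0)%E <-> {ae m, forall x, f x = 0%E}.
Proof.
move=> mf f0; have -> : (\int[m]_x f x = \int[m]_x `|f x|)%E.
  by apply: eq_integral => x _; rewrite gee0_abs.
rewrite ae_eq_integral_abs//; split; apply: filterS => x.
  exact.
by move=> ->.
Qed.

(** Tonelli for the indicator of the complement of [G]: its double integral is 0 in one order, hence
    in the other. *)
Lemma ae_ae_swap {d1} {X1 : measurableType d1} {d2} {X2 : measurableType d2} {R : realType}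
    (m1 : {sigma_finite_measure set X1 -> \bar R})
    (m2 : {sigma_finite_measure set X2 -> \bar R}) (G : set (X1 * X2)) :
  measurable G -> (forall y, {ae m1, forall x, G (x, y)}) ->
  {ae m1, forall x, {ae m2, forall y, G (x, y)}}.
Proof.
move=> mG GP; pose f z := (\1_(~` G) z)%:E : \bar R.
have fE z : f z = 0%E <-> G z.
  rewrite /f indicE; split=> [|Gz].
    case: (boolP (z \in ~` G)) => [_ []/eqP|]; first by rewrite oner_eq0.
    by rewrite notin_setE => /contrapT.
  by rewrite memNset//= => /(_ Gz).
have mf : measurable_fun setT f.
  by apply/measurable_EFinP; apply: measurable_indic; exact: measurableC.
have f0 z : (0 <= f z)%E by rewrite lee_fin.
have mF : measurable_fun setT (fun x => \int[m2]_y f (x, y))%E.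
  exact: (@measurable_fun_fubini_tonelli_F _ _ _ _ _ m2 f mf f0).
have : (\int[m1]_x \int[m2]_y f (x, y) = 0)%E.
  rewrite fubini_tonelli// (eq_integral (cst 0%E)) ?integral0// => y _.
  apply/ge0_integral_eq0_ae => //.
    exact: (measurableT_comp mf (pair2_measurable y)).
  by apply: filterS (GP y) => x /fE.
move=> /ge0_integral_eq0_ae -/(_ mF) H.
have {H}: {ae m1, forall x, \int[m2]_y f (x, y) = 0}%E.
  by apply: H => x; apply: integral_ge0.
apply: filterS => x /ge0_integral_eq0_ae H.
have {H} : {ae m2, forall y, f (x, y) = 0%E}.
  by apply: H => //; exact: (measurableT_comp mf (pair1_measurable x)).
by apply: filterS => y /fE.
Qed.

(** * Exponential lower bound for the denominator *)

Section posterior_masses_lower.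
Context {dS : measure_display} {S : measurableType dS} {R : realType}.
Variable mu : {sigma_finite_measure set S -> \bar R}.
Context {dT : measure_display} {T : measurableType dT}.
Variable dens : T -> S -> R.
Hypothesis hT : density_space mu dens.
Variables (Q : probability S R) (f0 : S -> R).
Hypotheses (mf0 : measurable_fun setT f0) (f0_ge0 : forall y, 0 <= f0 y)
  (QE : forall B, measurable B -> Q B = (\int[mu]_(y in B) (f0 y)%:E)%E).
Context {dO : measure_display} {Omega : measurableType dO}.
Variables (P : probability Omega R) (Y : nat -> Omega -> S).
Hypotheses (mY : forall i, measurable_fun setT (Y i))
  (lawY : forall i B, measurable B -> P (Y i @^-1` B) = Q B)
  (indepY : forall (J : {fset nat}) (B : nat -> set S),
    (forall i, measurable (B i)) ->
    P (\bigcap_(i in [set` J]) (Y i @^-1` B i)) =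
      (\prod_(i <- J) P (Y i @^-1` B i))%E).
Variable Pi : probability T R.

Local Notation ratio := (scaled_ratio dens f0).
Local Notation mass := (mass dens f0 Y Pi).

Lemma measurable_KL : measurable_fun setT (fun t => KL mu f0 (dens t)).
Proof.
pose g (z : T * S) := (- lne (dens z.1 z.2 / f0 z.2)%:E)%E.
have mg : measurable_fun setT g.
  apply: measurableT_comp => //; apply: measurable_lne_EFin.
  apply: measurable_ratio => //; first exact: (ds_measurable hT).
  exact: (measurableT_comp mf0 measurable_snd).
rewrite (_ : (fun t => _) = (fun t => \int[Q]_y (g^\+ (t, y)) - \int[Q]_y (g^\- (t, y))))%E.
  apply: emeasurable_funB.
    apply: (@measurable_fun_fubini_tonelli_F _ _ T S R Q g^\+%E); first exact: measurable_funepos.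
    by move=> z.
  apply: (@measurable_fun_fubini_tonelli_F _ _ T S R Q g^\-%E); first exact: measurable_funeneg.
  by move=> z.
apply/funext => t; rewrite (KL_law mf0 f0_ge0 QE (measurable_dens hT t) (dens_ge0 hT t)).
by rewrite [LHS]integralE; congr (_ - _)%E; apply: eq_integral => y _; rewrite ?funeposE ?funenegE.
Qed.

Lemma measurable_KL_lt (c : R) : measurable [set t | (KL mu f0 (dens t) < c%:E)%E].
Proof.
rewrite (_ : [set t | _] = (fun t => KL mu f0 (dens t)) @^-1` `]-oo, c%:E[).
  by rewrite -[X in measurable X]setTI; apply: measurable_KL => //; exact: emeasurable_itv.
by apply/seteqP; split => t /=; rewrite in_itv.
Qed.

Lemma prod_ratio_lower (c : R) (t : T) : (KL mu f0 (dens t) < c%:E)%E ->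
  {ae P, forall w, \forall n \near \oo,
    expR (- (c * n%:R)) <= \prod_(i < n) ratio 0 t (Y i w)}.
Proof.
move=> tc; apply: (prod_lower mY lawY indepY).
- exact: (measurable_scaled_ratio hT).
- by move=> y; exact: (scaled_ratio_ge0 hT).
- by rewrite (le_lt_trans (integral_scaled_ratio_le hT mf0 f0_ge0 QE 0 t))// ltry.
- move: tc; rewrite (KL_law mf0 f0_ge0 QE (measurable_dens hT t) (dens_ge0 hT t)).
  by under [X in (X < _)%E -> _]eq_integral do rewrite -[lne _]add0e -(lne_scaled_ratio hT f0_ge0).
Qed.

Lemma mass_lower (E : set T) (c : R) : measurable E -> (0 < Pi E)%E ->
  (forall t, E t -> (KL mu f0 (dens t) < c%:E)%E) ->
  {ae P, forall w, exists2 p : R, 0 < p &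
    \forall n \near \oo, ((p * expR (- (c * n%:R)))%:E <= mass 0 E n w)%E}.
Proof.
move=> mE E0 Ec.
pose g n (z : Omega * T) := \prod_(i < n) ratio 0 z.2 (Y i z.1).
have mg n : measurable_fun setT (g n).
  apply: (@measurable_prod_ratio _ _ _ _ _ _ _ hT _ mf0 f0_ge0 0 n _ (Omega * T)%type snd
    (fun i z => Y i z.1)); first exact: measurable_snd.
  by move=> i _; exact: (measurableT_comp (mY i) measurable_fst).
pose H n := [set z | expR (- (c * n%:R)) <= g n z].
have mH n : measurable (H n).
  rewrite (_ : H n = g n @^-1` `[expR (- (c * n%:R)), +oo[).
    by rewrite -[X in measurable X]setTI; exact: mg.
  by apply/seteqP; split => z; rewrite /H /= in_itv/= andbT.
(* Points outside [E] are put into [G], so that the section at every [t] has full probability. *)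
pose G := (snd @^-1` (~` E) : set (Omega * T)) `|` \bigcup_N \bigcap_(n in [set n | (N <= n)%N]) H n.
have mG : measurable G.
  apply: measurableU.
    by rewrite -[X in measurable X]setTI; apply: measurable_snd => //; exact: measurableC.
  by apply: bigcup_measurable => N _; apply: bigcap_measurableType => n _; exact: mH.
have GP t : {ae P, forall w, G (w, t)}.
  have [Et|nEt] := pselect (E t); last by apply: aeW => w; left.
  apply: filterS (prod_ratio_lower (Ec t Et)) => w [N _ Nw].
  by right; exists N => // n /= /Nw.
apply: filterS (ae_ae_swap Pi mG GP) => w wG.
(* For the fixed [w] these sets exhaust [E] up to a null set, so one of them has positive prior
   mass. That mass, which depends on [w], is the [p] of the conclusion. *)
pose EN N := E `&` [set t | forall n, (N <= n)%N -> H n (w, t)].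
have mHw n : measurable [set t | H n (w, t)].
  by rewrite -[X in measurable X]setTI; exact: (pair1_measurable w).
have mEN N : measurable (EN N).
  apply: measurableI => //.
  rewrite (_ : [set t | _] = \bigcap_(n in [set n | (N <= n)%N]) [set t | H n (w, t)]).
    by apply: bigcap_measurableType => n _.
  by apply/seteqP; split=> t h n; apply: h.
have [N PN] : exists N, (0 < Pi (EN N))%E.
  apply: contrapT => /forallNP Pi0.
  have /ae_foralln EN0 : forall N, {ae Pi, forall t, ~ EN N t}.
    move=> N; exists (EN N); split => //; last by move=> t /contrapT.
    by apply/eqP; rewrite eq_le measure_ge0 andbT leNgt; exact/negP.
  move: E0; rewrite lt_neqAle => /andP[/eqP + _]; apply; apply/esym.
  have : {ae Pi, forall t, ~ E t}.
    apply: filterS2 wG EN0 => t [//|[N _ Nt]] Hn Et; apply: (Hn N); split => // n.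
  move=> [A [mA A0 EA]]; apply: (subset_measure0 mE mA _ A0) => t Et.
  by apply: EA => /(_ Et).
exists (fine (Pi (EN N))).
  by rewrite fine_gt0// PN/= ltey_eq fin_num_measure.
exists N => // n /= Nn.
rewrite mulrC EFinM fineK ?fin_num_measure// -(integral_cst _ (mEN N)) integral_mkcond.
apply: ge0_le_integral => //.
- by move=> t _; rewrite patchE; case: ifP => // _; rewrite lee_fin expR_ge0.
- by apply/(measurable_restrictT _ (mEN N)); exact: measurable_cst.
- by apply/measurable_EFinP; exact: (measurable_mass_integrand hT mf0 f0_ge0).
- move=> t _; rewrite patchE indicE; case: ifPn => [|_].
    by rewrite inE => -[Et /(_ n Nn) h]; rewrite mem_set// mul1r lee_fin.
  exact: (mass_integrand_ge0 hT f0_ge0).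
Qed.

End posterior_masses_lower.

(** * Posterior consistency *)

Lemma finite_dball_cover {R : realType} {T : choiceType} (A : set T)
    (d : @metric_on R T A) (F : set T) (r : R) : metric_compact d F -> 0 < r ->
  exists2 s : seq T, (forall c, c \in s -> F c) &
    forall t, F t -> exists2 c, c \in s & dball d c r t.
Proof.
move=> [FA cF] r0; pose M := metric_space d.
(* The cover form of compactness is used on a pointed space, so the empty set is treated apart. *)
have [F0|/set0P[t0 Ft0]] := eqVneq F set0.
  by exists [::] => // t; rewrite F0.
pose pM : ptopologicalType :=
  HB.pack M (isPointed.Build M (SigSub (mem_set (FA _ Ft0)))).
have : @cover_compact pM [set x | F (\val (x : M))].
  by rewrite -compact_cover.
move=> /(_ M [set x | F (\val x)] (fun x => (ball x r)°)).
case=> [x _|x Fx|D DF FD].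
- exact: open_interior.
- by exists x => //; exact: nbhsx_ballx.
exists [seq \val x | x : M <- enum_fset D].
  by move=> _ /mapP[x xD ->]; have := DF _ xD; rewrite inE.
move=> t Ft; have At := FA _ Ft.
have [x xD /interior_subset xt] := FD (SigSub (mem_set At) : M) Ft.
exists (\val x); first by apply/mapP; exists x.
split=> //; rewrite dist_sym//; last exact: set_mem (valP x).
Qed.

Lemma dball_far {R : realType} {T : choiceType} (A : set T)
    (d : @metric_on R T A) (c f s : T) (r r' : R) : A c -> A s -> dball d c r f ->
  r + r' <= d c s -> r' < d f s.
Proof.
move=> Ac As [Af fc] /le_trans/(_ (dist_triangle d Ac Af As)).
by rewrite (dist_sym d Ac Af); lra.
Qed.

(** [C] stands for the change of reference density, common to both posterior integrals. The
    denominator may be infinite, and the ratio is then 0. *)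
Lemma le_ereal_ratio {R : realType} (C u v : R) (a b : \bar R) :
  0 < C -> (0 <= a <= u%:E)%E -> 0 < v -> (v%:E <= b)%E ->
  (0 <= (C%:E * a) / (C%:E * b) <= (u / v)%:E)%E.
Proof.
move=> C0 /andP[]; case: a => [a||]// a0 au v0; case: b => [b||]// vb; last first.
  rewrite gt0_muley ?lte_fin// invey mule0 lexx lee_fin divr_ge0//; last exact: ltW.
  by rewrite -lee_fin (le_trans a0).
move: a0 au vb; rewrite !lee_fin => a0 au vb.
have b0 : 0 < b by exact: lt_le_trans vb.
rewrite -!EFinM inver mulf_eq0 !gt_eqF//= -EFinM !lee_fin invfM mulrACA divff ?gt_eqF//.
rewrite mul1r divr_ge0 ?(ltW b0)//= ler_pM// ?invr_ge0 ?(ltW b0)//.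
by rewrite lef_pV2.
Qed.

Section posterior_masses_ratio.
Context {dS : measure_display} {S : measurableType dS} {R : realType}.
Variable mu : {sigma_finite_measure set S -> \bar R}.
Context {dT : measure_display} {T : measurableType dT}.
Variable dens : T -> S -> R.
Hypothesis hT : density_space mu dens.
Variable f0 : S -> R.
Hypotheses (mf0 : measurable_fun setT f0) (f0_ge0 : forall y, 0 <= f0 y).
Context {dO : measure_display} {Omega : measurableType dO}.
Variables (Y : nat -> Omega -> S) (Pi : probability T R).

Local Notation mass := (mass dens f0 Y Pi).
Local Notation ratio := (scaled_ratio dens f0).

(** The factor on the right does not depend on [t], so it cancels in the posterior. Positivity at
    the observations keeps the divisions honest. *)
Lemma integral_likelihood_ratio (s : T) (B : set T) (n : nat) (w : Omega) :
  measurable B -> (forall i, 0 < f0 (Y i w)) -> (forall i, 0 < dens s (Y i w)) ->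
  (\int[Pi]_(t in B) (likelihood_ratio dens s (fun i => Y i w) n t)%:E =
   (\prod_(i < n) (f0 (Y i w) / dens s (Y i w)))%:E * mass 0 B n w)%E.
Proof.
move=> mB f0_gt0 s_gt0; rewrite /mass -ge0_integralZl_EFin//.
- rewrite [LHS]integral_mkcond; apply: eq_integral => t _.
  rewrite patchE indicE; case: (boolP (t \in B)) => tB; last by rewrite mul0r mule0.
  rewrite mul1r -EFinM; congr EFin; rewrite -big_split; apply: eq_bigr => i _ /=.
  have := gt_eqF (f0_gt0 i); have := gt_eqF (s_gt0 i).
  rewrite /scaled_ratio expR0 mul1r => /negbT sn0 /negbT fn0.
  by field; rewrite sn0 fn0.
- by move=> t _; exact: (mass_integrand_ge0 hT f0_ge0).
- by apply/measurable_EFinP; exact: (measurable_mass_integrand hT mf0 f0_ge0).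
- by rewrite prodr_ge0// => i _; rewrite divr_ge0// ltW.
Qed.

Lemma mass_le_sum (B : set T) (J : nat) (D : nat -> set T) n w : measurable B ->
  (forall j, (j < J)%N -> measurable (D j)) ->
  B `<=` \bigcup_(j in `I_J) D j ->
  (mass 0 B n w <= \sum_(j < J) mass 0 (D j) n w)%E.
Proof.
move=> mB mD BD.
have mm B' : measurable B' ->
    measurable_fun setT (fun t => (\1_B' t * \prod_(i < n) ratio 0 t (Y i w))%:E : \bar R).
  by move=> mB'; apply/measurable_EFinP; exact: (measurable_mass_integrand hT mf0 f0_ge0).
have m0 B' t : (0 <= (\1_B' t * \prod_(i < n) ratio 0 t (Y i w))%:E)%E.
  exact: (mass_integrand_ge0 hT f0_ge0).
rewrite -ge0_integral_sum//; last by move=> j; apply: mm; exact: mD.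
apply: ge0_le_integral => //.
- exact: mm.
- by apply: emeasurable_sum => j; apply: mm; exact: mD.
- move=> t _; case: (boolP (t \in B)) => tB; last first.
    by rewrite indicE (negbTE tB) mul0r sume_ge0.
  have [j jJ Djt] := BD t (set_mem tB).
  rewrite (bigD1 (Ordinal jJ))//= -[leLHS]adde0 leeD ?sume_ge0// lee_fin.
  by rewrite !indicE tB mem_set.
Qed.

Lemma le_mass (B B' : set T) n w : measurable B -> measurable B' -> B `<=` B' ->
  (mass 0 B n w <= mass 0 B' n w)%E.
Proof.
move=> mB mB' BB'.
apply: (le_trans (@mass_le_sum B 1 (fun=> B') n w mB _ _)) => //.
  by move=> t /BB'; exists 0%N.
by rewrite big_ord1.
Qed.

End posterior_masses_ratio.

Theorem theorem2 (R : realType)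
  (dS : measure_display) (S : measurableType dS)
  (mu : {sigma_finite_measure set S -> \bar R})
  (dT : measure_display) (T : measurableType dT) (dens : T -> S -> R)
  (hT : density_space mu dens)
  (F0 : set T) (mF0 : measurable F0)
  (f0 : S -> R) (hf0 : is_density mu f0)
  (dO : measure_display) (Omega : measurableType dO) (P : probability Omega R)
  (Y : nat -> Omega -> S) (hY : iid_with_density mu P f0 Y)
  (Pi : probability T R) (hPi : Pi F0 = 1%E)
  (fstar : T) (hfstar : unique_KL_minimizer mu dens f0 F0 fstar)
  (hratio : forall f, F0 f ->
    (\int[mu]_y (dens f y / dens fstar y * f0 y)%:E < +oo)%E)
  (hratio0 : (\int[mu]_y (f0 y / dens fstar y)%:E < +oo)%E)
  (d : @metric_on R T (mixture_hull mu dens F0))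
  (hball : forall c r, mixture_hull mu dens F0 c -> 0 < r ->
    mixture_convex mu dens (dball d c r))
  (mball : forall c r, mixture_hull mu dens F0 c -> 0 < r ->
    measurable (dball d c r `&` F0))
  (hcompact : metric_compact d F0)
  (h1 : forall eps : R, 0 < eps ->
    (0 < Pi (F0 `&` [set f | KLstar mu f0 (dens fstar) (dens f) < eps%:E]))%E)
  (h2 : forall eps : R, 0 < eps -> exists2 delta : R, 0 < delta &
    [set f | mixture_hull mu dens F0 f /\
             (KLstar mu f0 (dens fstar) (dens f) < delta%:E)%E]
      `<=` dball d fstar eps)
  (eps : R) (heps : 0 < eps) :
  {ae P, forall w,
    posterior dens F0 Pi fstar (fun i => Y i w) n
      (mixture_hull mu dens F0 `\` dball d fstar eps)
    @[n --> \oo] --> 0%E}.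
Proof.
have [mf0 f0_ge0 f01] := hf0; have [mY lawP indepY] := hY.
have [Fstar _ Kfin _] := hfstar.
have hull_F0 := @sub_mixture_hull _ _ _ mu _ _ dens F0.
have [m mE] := density_measureP mu mf0 f0_ge0.
have [|Q QE'] := @probability_of_measure _ _ _ m; first by rewrite mE.
have QE B : measurable B -> Q B = (\int[mu]_(y in B) (f0 y)%:E)%E.
  by move=> mB; have := QE' B; rewrite mE.
have lawY i B : measurable B -> P (Y i @^-1` B) = Q B.
  by move=> mB; rewrite lawP// QE.
pose kappa := fine (KL mu f0 (dens fstar)).
have kE : KL mu f0 (dens fstar) = kappa%:E by rewrite fineK.
have KLstar_lt t c : (KLstar mu f0 (dens fstar) (dens t) < c%:E)%E =
    (KL mu f0 (dens t) < (kappa + c)%:E)%E.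
  by rewrite /KLstar kE lteBlDr// -EFinD addrC.
(* Radii: a covering ball of radius [eps / 4] that contains a point at distance at least [eps] from
   [fstar] has its center at distance at least [3 * eps / 4]. The whole ball, not only its part
   outside the neighborhood, then stays beyond [eps / 2], so the divergence bound holds on a convex
   set. *)
have [|delta delta0 hdelta] := h2 (eps / 2); first by rewrite divr_gt0.
have [|s sF0 scover] := finite_dball_cover hcompact (r := eps / 4).
  by rewrite divr_gt0.
pose far c := eps / 4 + eps / 2 <= d c fstar.
pose s' := [seq x <- s | far x]; pose c j := nth fstar s' j; pose J := size s'.
have cP j : (j < J)%N -> F0 (c j) /\ far (c j).
  move=> jJ; have := mem_nth fstar jJ; rewrite mem_filter => /andP[farc cs].
  by split => //; exact: sF0.
pose A j := dball d (c j) (eps / 4).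
have eps4 : 0 < eps / 4 by rewrite divr_gt0.
have AK j t : (j < J)%N -> A j t -> ((kappa + delta)%:E <= KL mu f0 (dens t))%E.
  move=> jJ Ajt; have [Fc farc] := cP j jJ.
  have tfar := dball_far (hull_F0 _ Fc) (hull_F0 _ Fstar) Ajt farc.
  rewrite leNgt -KLstar_lt; apply/negP => lt.
  have [At _] := Ajt.
  by have [_] := hdelta t (conj At lt); rewrite ltNge ltW.
pose B j := A j `&` F0.
have mB j : (j < J)%N -> measurable (B j).
  by move=> jJ; apply: mball => //; apply: hull_F0; have [] := cP j jJ.
(* Balls are measurable only within [F0], so [W] is rewritten as a difference inside [F0]. *)
pose W := (mixture_hull mu dens F0 `\` dball d fstar eps) `&` F0.
have mW : measurable W.
  rewrite (_ : W = F0 `\` (dball d fstar eps `&` F0)).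
    by apply: measurableD => //; apply: mball => //; exact: hull_F0.
  apply/seteqP; split=> [t [[_ nt] Ft]|t [Ft nt]]; split => //.
    by move=> [].
  by split; [exact: hull_F0|move=> dt; apply: nt].
have WB : W `<=` \bigcup_(j in `I_J) B j.
  move=> t [[ht nt] Ft]; have [x xs tx] := scover t Ft.
  have Fx := sF0 _ xs.
  have dt : eps <= d t fstar by rewrite leNgt; apply/negP => dt; apply: nt.
  have farx : far x.
    have := dist_triangle d (hull_F0 _ Ft) (hull_F0 _ Fx) (hull_F0 _ Fstar).
    by case: tx => _; rewrite /far; lra.
  have xs' : x \in s' by rewrite mem_filter farx.
  exists (index x s'); first by rewrite /= index_mem.
  by split => //; rewrite /A /c nth_index.
have upper : {ae P, forall w j, (j < J)%N -> \forall n \near \oo,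
    (mass dens f0 Y Pi 0 (B j) n w <= (expR (- ((kappa + delta / 2) * n%:R)))%:E)%E}.
  apply: ae_foralln => j; have [jJ|nJ] := ltnP j J; last exact: aeW.
  have [Fc _] := cP j jJ.
  have cA : mixture_convex mu dens (A j) by apply: hball => //; exact: hull_F0.
  have kk' : kappa + delta / 2 < kappa + delta by lra.
  have := convex_mass_upper hT mf0 f0_ge0 QE mY lawY indepY Pi cA (mB j jJ)
    (@subIsetl _ _ _) kk' (fun t => AK j t jJ).
  by apply: filterS => w Hw _.
(* The numerator decays at rate [kappa + delta / 2], the denominator at most at rate
   [kappa + delta / 4]; the difference [delta / 4] is the rate of the posterior mass. *)
pose E := F0 `&` [set t | (KL mu f0 (dens t) < (kappa + delta / 4)%:E)%E].
have mE' : measurable E by apply: measurableI => //; exact: (measurable_KL_lt hT mf0 f0_ge0 QE).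
have E0 : (0 < Pi E)%E.
  have := h1 (delta / 4); rewrite divr_gt0// => /(_ isT).
  rewrite (_ : [set f | _] = [set t | (KL mu f0 (dens t) < (kappa + delta / 4)%:E)%E])//.
  by apply/seteqP; split => t /=; rewrite KLstar_lt.
have EK t : E t -> (KL mu f0 (dens t) < (kappa + delta / 4)%:E)%E by case.
have lower := mass_lower hT mf0 f0_ge0 QE mY lawY indepY mE' E0 EK.
have f0Y := ae_law mY lawY (ae_law_gt0 mf0 f0_ge0 QE).
(* Finite divergence makes [- lne (dens fstar y / f0 y)] integrable, hence finite almost surely,
   which rules out zeros of [dens fstar]. *)
have fsQ : {ae Q, forall y, 0 < dens fstar y}.
  have := KL_law mf0 f0_ge0 QE (measurable_dens hT fstar) (dens_ge0 hT fstar).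
  rewrite kE => KLQ.
  have iW : Q.-integrable setT (fun y => - lne (dens fstar y / f0 y)%:E)%E.
    apply: integrable_oppe_lne.
    - by apply: measurable_ratio => //; exact: (measurable_dens hT).
    - by move=> y; rewrite divr_ge0// (dens_ge0 hT).
    - apply: (@le_lt_trans _ _ 1%E); last exact: ltry.
      have [mt t0 <-] := ds_density hT fstar.
      exact: (integral_law_ratio_le mf0 f0_ge0 QE).
    - by rewrite -KLQ ltry.
  apply: filterS (integrable_ae measurableT iW) => y /(_ Logic.I).
  rewrite lt_neqAle (dens_ge0 hT) andbT; apply: contraTneq => <-.
  by rewrite mul0r le0_lneNy.
have fsY := ae_law mY lawY fsQ.
apply: filterS2 (filterI upper lower) (filterI f0Y fsY) => w [uw [p p0 lw]] [f0w fsw].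
have uw' : \forall n \near \oo, (mass dens f0 Y Pi 0 W n w <=
    (J%:R * expR (- ((kappa + delta / 2) * n%:R)))%:E)%E.
  have : \forall n \near \oo, forall j : 'I_J,
      (mass dens f0 Y Pi 0 (B j) n w <= (expR (- ((kappa + delta / 2) * n%:R)))%:E)%E.
    by apply: filter_forall => j; exact: uw.
  apply: filterS => n un.
  apply: (le_trans (mass_le_sum hT mf0 f0_ge0 Y Pi n w mW mB WB)).
  apply: (le_trans (lee_sum _ (fun j _ => un j))).
  by rewrite [leLHS]sumEFin sumr_const card_ord mulr_natl.
pose q := expR (- (delta / 4)).
apply: (@squeeze_cvge _ _ _ _ (cst 0%E) _ (fun n => ((J%:R / p) * q ^+ n)%:E)).
- apply: filterS2 uw' lw => n un ln.
  rewrite /posterior.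
  rewrite -/W !(integral_likelihood_ratio hT mf0 f0_ge0)//.
  have C0 : 0 < \prod_(i < n) (f0 (Y i w) / dens fstar (Y i w)).
    by apply: prodr_gt0 => i _; rewrite divr_gt0.
  have v0 : 0 < p * expR (- ((kappa + delta / 4) * n%:R)) by rewrite mulr_gt0// expR_gt0.
  have -> : J%:R / p * q ^+ n = (J%:R * expR (- ((kappa + delta / 2) * n%:R))) /
      (p * expR (- ((kappa + delta / 4) * n%:R))).
    rewrite /q -expRM_natl invfM mulrACA -expRN -expRD; congr (_ * expR _); lra.
  apply: le_ereal_ratio => //.
    by rewrite un andbT; exact: (mass_ge0 hT f0_ge0).
  apply: le_trans ln _; apply: (le_mass hT mf0 f0_ge0) => //; exact: subIsetl.
- exact: cvg_cst.
- apply: cvg_EFin; first exact: nearW.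
  apply: cvg_geometric; rewrite ger0_norm ?expR_ge0// -[ltRHS]expR0 ltr_expR.
  by rewrite oppr_lt0 divr_gt0.
Qed.
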